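(* Suppose that $\lambda$ is a simple eigenvalue of $\mathcal{S}_{\alpha,\beta}(\Psi,\Phi)$ with eigenfunction $v$ normalized in $L_2(a,b)$. Then there exist an index $j$ and constants $c_1,c_2$ independent of $\varepsilon$ such that, for all sufficiently small $\varepsilon>0$, the $j$-th eigenvalue $\lambda_j^\varepsilon$ of $\mathcal{S}_\varepsilon$ is simple and has a corresponding $L_2(a,b)$-normalized eigenfunction $y_j^\varepsilon$ with $$|\lambda_j^\varepsilon-\lambda|\le c_1\varepsilon,\qquad \|y_j^\varepsilon-v\|_{L_2(a,b)}\le c_2\varepsilon.$$
   Context: Let $a<0<b$ and let $U$ be a smooth real-valued function on $[a,b]$. $C_0^\infty(-1,1)$ denotes the real-valued $C^\infty$ functions on $\mathbb{R}$ supported in $[-1,1]$. Let $(\alpha,\beta,\gamma_1,\gamma_2)\in\mathbb{R}^4$ and $(\Psi,\Phi,\Upsilon_1,\Upsilon_2)\in (C_0^\infty(-1,1))^4$ with $\operatorname{supp}\Psi=[-1,1]$. For $\varepsilon\in(0,1)$ put $$\Psi_\varepsilon(x)=\alpha\varepsilon^{-4}\Psi(x/\varepsilon)+\beta\varepsilon^{-3}\Phi(x/\varepsilon)+\gamma_1\varepsilon^{-2}\Upsilon_1(x/\varepsilon)+\gamma_2\varepsilon^{-1}\Upsilon_2(x/\varepsilon).$$ $\mathcal{S}_\varepsilon$ is the operator in $L_2(a,b)$ given by $\mathcal{S}_\varepsilon f=f^{(4)}+Uf+\Psi_\varepsilon f$ with domain $\{f\in W_2^4(a,b): f(a)=f'(a)=0,\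 f(b)=f'(b)=0\}$. It is self-adjoint with discrete spectrum; its eigenvalues $\lambda_1^\varepsilon\le\lambda_2^\varepsilon\le\dots$ are enumerated in increasing order counting multiplicity. Resonant set: $\Sigma_\Psi$ is the set of $\alpha\in\mathbb{R}$ for which the problem $w^{(4)}+\alpha\Psi w=0$ on $(-1,1)$, $w''(\pm1)=w'''(\pm1)=0$, has a nontrivial solution (an eigenfunction $w_\alpha$, with $\alpha$ as spectral parameter). Standing assumption (nondegenerate resonance): if $\alpha\in\Sigma_\Psi$, then $\alpha$ is a simple eigenvalue of this problem and $w_\alpha'(-1)\,w_\alpha'(1)\ne0$. In that case put $\theta_\Psi(\alpha)=w_\alpha'(1)/w_\alpha'(-1)$ and $\kappa=\int_{-1}^1\Phi(\xi)\bigl(w_\alpha(\xi)/w_\alpha'(-1)\bigr)^2d\xi$ (both independent of the choice of $w_\alpha$). Limit operator $\mathcal{S}_{\alpha,\beta}(\Psi,\Phi)$ in $L_2(a,b)$: it acts by $f\mapsto f^{(4)}+Uf$ on $(a,0)\cup(0,b)$. Its domain consists of those $f\in W_2^4((a,0)\cup(0,b))$ with $f(a)=f'(a)=f(b)=f'(b)=0$ and - if $\alpha\notin\Sigma_\Psi$: $f(\pm0)=f'(\pm0)=0$; - if $\alpha\in\Sigma_\Psi$: $f(\pm0)=0$, $f'(+0)-\theta_\Psi(\alpha)f'(-0)=0$, $\theta_\Psi(\alpha)f''(+0)-f''(-0)-\beta\kappa f'(-0)=0$. Here $f^{(k)}(\pm0)$ denote one-sided limits at $0$. *)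

(* Defs.v *)
From HB Require Import structures.
From mathcomp Require Import all_boot all_order all_algebra.
From mathcomp Require Import complex.
From mathcomp Require Import all_classical all_reals all_analysis.

Set Implicit Arguments.
Unset Strict Implicit.
Unset Printing Implicit Defensive.

Import Order.TTheory GRing.Theory Num.Theory.
Import numFieldNormedType.Exports.

Local Open Scope classical_set_scope.
Local Open Scope ring_scope.

(* Values at an endpoint are one-sided limits, so that the functions below only
   matter on open intervals: [rtrace f k x] is f^(k)(x+0) and [ltrace f k x] is
   f^(k)(x-0). *)
Definition rtrace (R : realType) (f : R -> R) (k : nat) (x : R) : R :=
  lim (derive1n k f t @[t --> x^'+]).

Definition ltrace (R : realType) (f : R -> R) (k : nat) (x : R) : R :=
  lim (derive1n k f t @[t --> x^'-]).

(* Smoothness up to the boundary: [D k] is the continuous extension of U^(k)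
   to [a, b]. *)
Definition smooth_on (R : realType) (a b : R) (U : R -> R) : Prop :=
  exists D : nat -> R -> R,
    (forall x, x \in `[a, b] -> D 0%N x = U x) /\
    forall k, {within `[a, b], continuous (D k)} /\
      forall x, x \in `]a, b[ -> is_derive x 1 (D k) (D k.+1 x).

Definition supp (R : realType) (f : R -> R) : set R :=
  closure [set x | f x != 0].

(* C_0^oo(-1, 1) *)
Definition test_function (R : realType) (f : R -> R) : Prop :=
  (forall k x, derivable (derive1n k f) x 1) /\ supp f `<=` `[-1, 1].

Definition square_integrable (R : realType) (c d : R) (g : R -> R) : Prop :=
  measurable_fun `]c, d[ g /\
  (@lebesgue_measure R).-integrable `]c, d[ (EFin \o (fun x => g x ^+ 2)).

(* f is the C^3 representative of an element of W_2^4(c, d) and g is its weak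
   fourth derivative: f''' is absolutely continuous with derivative g in L_2. *)
Definition W24 (R : realType) (c d : R) (f g : R -> R) : Prop :=
  [/\ forall k x, (k < 3)%N -> x \in `]c, d[ -> derivable (derive1n k f) x 1,
      square_integrable c d g &
      forall x y, c < x -> x <= y -> y < d ->
        derive1n 3 f y - derive1n 3 f x =
        \int[@lebesgue_measure R]_(t in `[x, y]) g t].

(* An operator in real L_2 is given by its graph; the second component is only
   relevant up to a null set. *)
Definition op_graph (R : realType) := (R -> R) -> (R -> R) -> Prop.

Definition clamped (R : realType) (a b : R) (f : R -> R) : Prop :=
  [/\ rtrace f 0 a = 0, rtrace f 1 a = 0, ltrace f 0 b = 0 & ltrace f 1 b = 0].

Definition Psi_eps (R : realType) (alpha beta gamma1 gamma2 : R)
    (Psi Phi Ups1 Ups2 : R -> R) (eps x : R) : R :=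
  alpha * eps ^- 4 * Psi (x / eps) + beta * eps ^- 3 * Phi (x / eps)
  + gamma1 * eps ^- 2 * Ups1 (x / eps) + gamma2 * eps ^- 1 * Ups2 (x / eps).

Definition S_eps (R : realType) (a b : R) (U : R -> R)
    (alpha beta gamma1 gamma2 : R) (Psi Phi Ups1 Ups2 : R -> R) (eps : R) :
    op_graph R := fun f h =>
  exists g, [/\ W24 a b f g, clamped a b f &
    {ae @lebesgue_measure R, forall x, `]a, b[%classic x ->
      h x = g x + U x * f x
            + Psi_eps alpha beta gamma1 gamma2 Psi Phi Ups1 Ups2 eps x * f x}].

(* [V] has dimension n over K, functions being identified when they agree
   almost everywhere on D. *)
Definition has_dim (R : realType) (K : fieldType) (D : set R)
    (V : set (R -> K)) (n : nat) : Prop :=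
  exists e : 'I_n -> R -> K,
    [/\ forall i, V (e i),
        forall c : 'I_n -> K,
          {ae @lebesgue_measure R, forall x, D x ->
            \sum_(i < n) c i * e i x = 0} -> forall i, c i = 0 &
        forall f, V f -> exists c : 'I_n -> K,
          {ae @lebesgue_measure R, forall x, D x ->
            f x = \sum_(i < n) c i * e i x}].

Definition inner_solutions (R : realType) (Psi : R -> R) (alpha : R) :
    set (R -> R) :=
  [set w | [/\ forall k x, (k < 4)%N -> x \in `]-1, 1[ ->
                 derivable (derive1n k w) x 1,
               forall x, x \in `]-1, 1[ ->
                 derive1n 4 w x + alpha * Psi x * w x = 0,
               rtrace w 2 (-1) = 0 /\ rtrace w 3 (-1) = 0 &
               ltrace w 2 1 = 0 /\ ltrace w 3 1 = 0]].

Definition inner_eigenfunctions (R : realType) (Psi : R -> R) (alpha : R) :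
    set (R -> R) :=
  [set w | inner_solutions Psi alpha w /\
           exists2 x, x \in `]-1, 1[ & w x != 0].

Definition resonant_set (R : realType) (Psi : R -> R) : set R :=
  [set alpha | exists w, inner_eigenfunctions Psi alpha w].

Definition nondegenerate_resonance (R : realType) (Psi : R -> R) (alpha : R) :
    Prop :=
  resonant_set Psi alpha ->
    has_dim `]-1, 1[ (inner_solutions Psi alpha) 1 /\
    forall w, inner_eigenfunctions Psi alpha w ->
      rtrace w 1 (-1) * ltrace w 1 1 != 0.

(* An arbitrary choice; [theta] and [kappa] do not depend on it when alpha is a
   nondegenerate resonance. *)
Definition w_ (R : realType) (Psi : R -> R) (alpha : R) : R -> R :=
  xget (cst 0) (inner_eigenfunctions Psi alpha).

Definition theta (R : realType) (Psi : R -> R) (alpha : R) : R :=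
  ltrace (w_ Psi alpha) 1 1 / rtrace (w_ Psi alpha) 1 (-1).

Definition kappa (R : realType) (Psi Phi : R -> R) (alpha : R) : R :=
  \int[@lebesgue_measure R]_(xi in `]-1, 1[)
    (Phi xi * (w_ Psi alpha xi / rtrace (w_ Psi alpha) 1 (-1)) ^+ 2).

Definition interface_conditions (R : realType) (alpha beta : R)
    (Psi Phi : R -> R) (f : R -> R) : Prop :=
  (~ resonant_set Psi alpha ->
     [/\ ltrace f 0 0 = 0, rtrace f 0 0 = 0,
         ltrace f 1 0 = 0 & rtrace f 1 0 = 0]) /\
  (resonant_set Psi alpha ->
     [/\ ltrace f 0 0 = 0, rtrace f 0 0 = 0,
         rtrace f 1 0 - theta Psi alpha * ltrace f 1 0 = 0 &
         theta Psi alpha * rtrace f 2 0 - ltrace f 2 0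
         - beta * kappa Psi Phi alpha * ltrace f 1 0 = 0]).

Definition S_limit (R : realType) (a b : R) (U : R -> R) (alpha beta : R)
    (Psi Phi : R -> R) : op_graph R := fun f h =>
  exists g, [/\ W24 a 0 f g /\ W24 0 b f g, clamped a b f,
    interface_conditions alpha beta Psi Phi f &
    {ae @lebesgue_measure R, forall x, `]a, b[%classic x ->
      h x = g x + U x * f x}].

(* The operators live in complex L_2(a, b). Their coefficients and boundary
   conditions are real, so they act separately on real and imaginary parts;
   for real mu the equation S f = mu f splits accordingly. *)
Definition op_eigenspace (R : realType) (S : op_graph R) (mu : R) :
    set (R -> R[i]) :=
  [set f | S (fun x => complex.Re (f x)) (fun x => mu * complex.Re (f x)) /\
           S (fun x => complex.Im (f x)) (fun x => mu * complex.Im (f x))].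

Definition simple_eigenvalue (R : realType) (a b : R) (S : op_graph R) (mu : R) :
    Prop :=
  has_dim `]a, b[ (op_eigenspace S mu) 1.

(* Each mu occurs in the nondecreasing sequence [lam] as often as its
   multiplicity, which is 0 when mu is not an eigenvalue. *)
Definition eigenvalue_enumeration (R : realType) (a b : R) (S : op_graph R)
    (lam : nat -> R) : Prop :=
  {homo lam : j k / (j <= k)%N >-> j <= k} /\
  forall mu, exists n : nat,
    ([set k | lam k = mu] #= `I_n)%card /\ has_dim `]a, b[ (op_eigenspace S mu) n.

Definition L2norm (R : realType) (a b : R) (f : R -> R[i]) : \bar R :=
  'N[@lebesgue_measure R]_2%:E
    [(fun x => (ComplexField.Normc.normc (f x))%:E) \_ `]a, b[].

(* Main.v *)
(* Eigenvalue problems are treated as shooting problems for y'''' = p y, so that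
   Gronwall estimates in the sup norm replace resolvent convergence.

   On [-eps, eps], after the scaling x = eps xi, a solution of the perturbed
   equation is parametrized by four data at xi = -1, 1, chosen so that no negative
   power of eps survives in its jets at -eps and eps. In the resonant case there is
   one exception, eps^-1 w''(-1), and Green's formula against the half-bound state
   shows that it tends to -beta kappa. Hence the pairs of jets at -eps and eps form
   a 4-dimensional space that converges at rate eps to the interface conditions of
   the limit operator. Continuing these jets to a and b by the unperturbed equation
   yields a 4 x 4 matrix F(eps, mu), Lipschitz up to eps = 0, whose kernel is the
   eigenspace. Since lambda is simple, F(0, lambda) has corank one, and bordering F
   gives a scalar D(eps, mu) that vanishes exactly at the eigenvalues mu near
   lambda. By Lagrange's identity D(0, mu) is mu - lambda times a nonvanishing
   factor; so D(eps, .) has a zero near lambda, all its zeros are O(eps) close to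
   lambda, and the corresponding eigenfunctions converge uniformly at rate eps.

   The index j is the number of eigenvalues below lambda - delta. No eigenvalue
   crosses that level for small eps, and for eps > 0 the count is locally constant:
   near a given (eps, mu) the eigenvalues are the zeros of the two eigenvalue
   branches of a symmetric 2 x 2 matrix that increases with mu. *)

(* As eps tends to 0 the potential is of size eps^-4 and may push eigenvalues to minus infinity. No
   lower bound of the spectrum is available uniformly in eps, so the index cannot be read off at eps
   = 0: the count below a level is instead shown to be constant on an interval of positive eps,
   where a lower bound exists locally. Away from the window around lambda the perturbed operators
   may have double eigenvalues, which the zeros of a determinant do not reveal; this is why counting
   uses monotone branches, while the window itself uses one bordered determinant. The factor mu -
   lambda in D(0, mu) arises because the bordered solution violates a single boundary condition: in
   Lagrange's identity against the limit eigenfunction only that boundary term is left. The rate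
   O(eps) survives near the origin because both eigenfunctions are themselves O(eps) on [-eps, eps],
   the limit one vanishing at 0 under either type of interface condition. *)
Require Import Defs.
From mathcomp Require Import all_boot all_order all_algebra.
From mathcomp Require Import complex ring lra zify.
From mathcomp Require Import all_classical all_reals all_analysis.
From mathcomp Require Import measurable_realfun.

Import Order.TTheory GRing.Theory Num.Theory.
Import numFieldNormedType.Exports.

Local Open Scope classical_set_scope.
Local Open Scope ring_scope.

Set Implicit Arguments.
Unset Strict Implicit.
Unset Printing Implicit Defensive.

(** * Derivatives and a Gronwall estimate *)

(* A plain synonym, so that [apply:] does not trigger type class resolution. *)
Definition der (R : realType) (f : R -> R) (x l : R) : Prop := is_derive x 1 f l.

Section Calculus.
Variable R : realType.
Implicit Types (f g : R -> R) (x y t : R).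

Lemma derD f g x a b : der f x a -> der g x b ->
  der (fun t => f t + g t) x (a + b).
Proof. by move=> fa gb; apply: is_deriveD. Qed.

Lemma derN f x a : der f x a -> der (fun t => - f t) x (- a).
Proof. by move=> fa; apply: is_deriveN. Qed.

Lemma derB f g x a b : der f x a -> der g x b ->
  der (fun t => f t - g t) x (a - b).
Proof. by move=> fa gb; apply: is_deriveB. Qed.

Lemma derM f g x a b : der f x a -> der g x b ->
  der (fun t => f t * g t) x (a * g x + f x * b).
Proof.
move=> fa gb; have := is_deriveM fa gb.
by rewrite /GRing.scale/= [g x * a]mulrC addrC.
Qed.

Lemma derC (c : R) x : der (fun _ : R => c) x 0.
Proof. exact: is_derive_cst. Qed.

Lemma derMl (c : R) f x a : der f x a -> der (fun t => c * f t) x (c * a).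
Proof. by move=> fa; have := derM (derC c x) fa; rewrite mul0r add0r. Qed.

Lemma der_id x : der (fun t => t) x 1.
Proof. exact: is_derive_id. Qed.

Lemma der_exp x : der expR x (expR x).
Proof. exact: is_derive_expR. Qed.

Lemma der_eq f x a b : der f x a -> a = b -> der f x b.
Proof. by move=> ? <-. Qed.

Lemma der_cont f x a : der f x a -> {for x, continuous f}.
Proof. by move=> fa; apply: differentiable_continuous; apply/derivable1_diffP; exact: (@ex_derive _ _ _ _ _ _ _ fa). Qed.

Lemma der_affine f c d x a : der f (c * x + d) a ->
  der (fun t => f (c * t + d)) x (c * a).
Proof.
move=> fa.
have h : der (fun t => c * t + d) x c.
  apply: der_eq (derD (derMl c (der_id x)) (derC d x)) _.
  by rewrite mulr1 addr0.
by have := @is_derive1_comp _ f (fun t => c * t + d) x a c fa h; rewrite mulrC.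
Qed.

Lemma der_congr f g (c d x a : R) : c < x < d ->
  (forall t, c < t < d -> f t = g t) -> der f x a -> der g x a.
Proof.
move=> /andP[cx xd] fg fa; apply: near_eq_is_derive fa => //.
near=> t; apply: fg; apply/andP; split.
- by near: t; apply: lt_nbhsr.
- by near: t; apply: lt_nbhsl.
Unshelve. all: by end_near. Qed.

Lemma der_le f f' x y : x <= y ->
  (forall t, x <= t <= y -> der f t (f' t)) ->
  (forall t, x <= t <= y -> 0 <= f' t) -> f x <= f y.
Proof.
move=> xy fd f0.
have [] := @MVT_segment R f f' x y xy.
- by move=> t; rewrite in_itv/= => /andP[a b]; apply: fd; rewrite !ltW.
- apply: continuous_in_subspaceT => t; rewrite inE/= in_itv/= => tI.
  exact: der_cont (fd t tI).
- move=> c; rewrite in_itv/= => cI H.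
  by rewrite -subr_ge0 H mulr_ge0 ?subr_ge0// f0.
Qed.

Lemma mean_value_ineq f f' (C c d : R) :
  (forall t, c <= t <= d -> der f t (f' t)) ->
  (forall t, c <= t <= d -> `|f' t| <= C) ->
  forall x y, c <= x <= d -> c <= y <= d -> `|f x - f y| <= C * `|x - y|.
Proof.
move=> fd fC.
suff H x y : c <= x -> x <= y -> y <= d -> `|f y - f x| <= C * (y - x).
  move=> x y /andP[cx xd] /andP[cy yd]; have [xy|/ltW xy] := leP x y.
    by rewrite distrC [`|x - y|]distrC [`|y - x|]ger0_norm ?subr_ge0//; exact: H.
  by rewrite [`|x - y|]ger0_norm ?subr_ge0//; exact: H.
move=> cx xy yd.
have I t : x <= t <= y -> c <= t <= d.
  by move=> /andP[xt ty]; rewrite (le_trans cx xt) (le_trans ty yd).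
have h1 := @der_le (fun t => C * t - f t) (fun t => C * 1 - f' t) x y xy.
have h2 := @der_le (fun t => C * t + f t) (fun t => C * 1 + f' t) x y xy.
rewrite ler_norml; apply/andP; split.
- have := h2 _ _; rewrite -subr_ge0 => h; rewrite -subr_ge0.
  have -> : f y - f x - - (C * (y - x)) = C * y + f y - (C * x + f x) by ring.
  apply: h => t tI.
  + by apply: derD; [apply: derMl; exact: der_id| exact: fd (I _ tI)].
  + by rewrite mulr1; have := fC _ (I _ tI); rewrite ler_norml => /andP[? _]; lra.
- have := h1 _ _; rewrite -subr_ge0 => h; rewrite -subr_ge0.
  have -> : C * (y - x) - (f y - f x) = C * y - f y - (C * x - f x) by ring.
  apply: h => t tI.
  + by apply: derB; [apply: derMl; exact: der_id| exact: fd (I _ tI)].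
  + by rewrite mulr1; have := fC _ (I _ tI); rewrite ler_norml => /andP[_ ?]; lra.
Qed.

Lemma der0_cst f (c d : R) : (forall t, c <= t <= d -> der f t 0) ->
  forall x y, c <= x <= d -> c <= y <= d -> f x = f y.
Proof.
move=> fd x y xI yI; apply/eqP; rewrite -subr_eq0 -normr_le0.
by rewrite -[leRHS](mul0r `|x - y|); apply: (@mean_value_ineq _ (fun=> 0)) xI yI => // t; rewrite normr0.
Qed.

(** Integrating from a base point gives a primitive only to the right of it. Two such primitives
    have the same increments wherever both are defined, so the base can move left together with
    [x]. *)
Lemma continuous_primitive f x0 : continuous f ->
  exists2 F, F x0 = 0 & forall x, der F x (f x).
Proof.
move=> cf.
pose G a x := \int[@lebesgue_measure R]_(t in `[a, x]) f t.
have Gd a x : a < x -> der (G a) x (f x).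
  move=> ax; have xx1 : x < x + 1 by rewrite ltrDl.
  have [|d1 <-] := @continuous_FTC1_closed R f a x (x + 1) xx1 _ ax (cf x).
    apply: continuous_compact_integrable; first exact: segment_compact.
    exact: continuous_subspaceT.
  by rewrite derive1E; apply: derivableP.
have Geq a a' x y : a < x -> a < y -> a' < x -> a' < y ->
    G a x - G a y = G a' x - G a' y.
  move=> ax ay a'x a'y.
  have : G a x - G a' x = G a y - G a' y.
    apply: (@der0_cst (fun t => G a t - G a' t) (Num.min x y) (Num.max x y)).
    - move=> t /andP[+ _]; rewrite ge_min => xyt.
      apply: der_eq (derB (Gd a t _) (Gd a' t _)) (subrr _);
        by case/orP: xyt => h; apply: lt_le_trans h.
    - by rewrite ge_min le_max lexx.
    - by rewrite ge_min le_max lexx !orbT.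
  by move=> h; lra.
exists (fun x => G (Num.min x x0 - 1) x - G (Num.min x x0 - 1) x0); first by rewrite subrr.
move=> x; pose a := Num.min x x0 - 2.
have mnl : Num.min x x0 <= x by rewrite ge_min lexx.
have mnr : Num.min x x0 <= x0 by rewrite ge_min lexx orbT.
have ax : a + 1 < x by rewrite /a; lra.
have ax0 : a + 1 < x0 by rewrite /a; lra.
apply: (@der_congr (fun t => G a t - G a x0) _ (x - 1) (x + 1)).
- by apply/andP; split; lra.
- move=> t /andP[xt tx].
  have ml : Num.min t x0 <= t by rewrite ge_min lexx.
  have mr : Num.min t x0 <= x0 by rewrite ge_min lexx orbT.
  by apply: Geq; lra.
- apply: der_eq (derB (Gd a x _) (derC _ _)) (subr0 _).
  by lra.
Qed.

End Calculus.

Section Gronwall.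
Variable R : realType.

Let mulrr_ge0 (x : R) : 0 <= x * x.
Proof. by rewrite -expr2 sqr_ge0. Qed.

(** The energy [E], the sum of the squares of the jet and of [eta], satisfies [|E'| <= (M + 4) E],
    which works in both directions from [x0]; the summand [eta ^+ 2] absorbs the inhomogeneity.
    Taking the square root would halve the exponent; the weaker bound is kept for simplicity. *)
Lemma gronwall (z : nat -> R -> R) (z4 : R -> R) (M eta del x0 x : R) :
  0 <= M -> 0 <= eta ->
  (forall t, Num.min x0 x <= t <= Num.max x0 x ->
     [/\ forall k, (k < 3)%N -> der (z k) t (z k.+1 t),
         der (z 3%N) t (z4 t) & `|z4 t| <= M * `|z 0%N t| + eta]) ->
  (forall k, (k < 4)%N -> `|z k x0| <= del) ->
  forall k, (k < 4)%N -> `|z k x| <= (2 * del + eta) * expR ((M + 4) * `|x - x0|).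
Proof.
move=> M0 eta0 H zdel.
pose K := M + 4.
pose E t := z 0%N t * z 0%N t + z 1%N t * z 1%N t + z 2%N t * z 2%N t + z 3%N t * z 3%N t + eta ^+ 2.
pose dE t := 2 * (z 0%N t * z 1%N t + z 1%N t * z 2%N t + z 2%N t * z 3%N t + z 3%N t * z4 t).
have dEP t : Num.min x0 x <= t <= Num.max x0 x -> der E t (dE t).
  move=> /H[h h3 _].
  have h0 := h 0%N isT; have h1 := h 1%N isT; have h2 := h 2%N isT.
  apply: der_eq (derD _ (derC _ _)) _.
    apply: derD; last exact: (derM h3 h3).
    apply: derD; last exact: (derM h2 h2).
    by apply: derD; [exact: (derM h0 h0)| exact: (derM h1 h1)].
  by rewrite /dE; ring.
have dEle t : Num.min x0 x <= t <= Num.max x0 x -> `|dE t| <= K * E t.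
  move=> /H[_ _ hb].
  have b (u v : R) : `|2 * (u * v)| <= u * u + v * v.
    rewrite ler_norml; apply/andP; split; rewrite -subr_ge0.
      by have := sqr_ge0 (u + v); rewrite expr2; lra.
    by have := sqr_ge0 (u - v); rewrite expr2; lra.
  have b4 : `|2 * (z 3%N t * z4 t)| <= (M + 1) * (z 3%N t * z 3%N t) + M * (z 0%N t * z 0%N t) + eta ^+ 2.
    rewrite normrM normrM ger0_norm//.
    apply: le_trans (_ : 2 * (`|z 3%N t| * (M * `|z 0%N t| + eta)) <= _).
      by rewrite ler_pM2l// ler_wpM2l.
    have e3 : z 3%N t * z 3%N t = `|z 3%N t| ^+ 2 by rewrite -normrX ger0_norm ?sqr_ge0.
    have e0 : z 0%N t * z 0%N t = `|z 0%N t| ^+ 2 by rewrite -normrX ger0_norm ?sqr_ge0.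
    rewrite e3 e0 -subr_ge0.
    have -> : (M + 1) * `|z 3%N t| ^+ 2 + M * `|z 0%N t| ^+ 2 + eta ^+ 2
      - 2 * (`|z 3%N t| * (M * `|z 0%N t| + eta)) = M * (`|z 3%N t| - `|z 0%N t|) ^+ 2
      + (`|z 3%N t| - eta) ^+ 2 by ring.
    by apply: addr_ge0; [apply: mulr_ge0 => //|]; exact: sqr_ge0.
  have -> : dE t = 2 * (z 0%N t * z 1%N t) + 2 * (z 1%N t * z 2%N t) + 2 * (z 2%N t * z 3%N t)
     + 2 * (z 3%N t * z4 t) by rewrite /dE; ring.
  apply: le_trans (ler_normD _ _) _.
  apply: le_trans (lerD (ler_normD _ _) b4) _.
  apply: le_trans (lerD (lerD (ler_normD _ _) (b _ _)) (lexx _)) _.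
  apply: le_trans (lerD (lerD (lerD (b _ _) (b _ _)) (lexx _)) (lexx _)) _.
  rewrite /K /E -subr_ge0.
  set a0 := z 0%N t * z 0%N t; set a1 := z 1%N t * z 1%N t; set a2 := z 2%N t * z 2%N t; set a3 := z 3%N t * z 3%N t.
  have p0 : 0 <= a0 by exact: mulrr_ge0.
  have p1 : 0 <= a1 by exact: mulrr_ge0.
  have p2 : 0 <= a2 by exact: mulrr_ge0.
  have p3 : 0 <= a3 by exact: mulrr_ge0.
  have pe : 0 <= eta ^+ 2 by rewrite sqr_ge0.
  rewrite [X in 0 <= X](_ : _ = 3 * a0 + (M + 2) * a1 + (M + 2) * a2 + 2 * a3 + (M + 3) * eta ^+ 2); last by ring.
  have q1 := mulr_ge0 M0 p1; have q2 := mulr_ge0 M0 p2; have qe := mulr_ge0 M0 pe.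
  by rewrite !mulrDl; lra.
have Eexp : E x <= E x0 * expR (K * `|x - x0|).
  have [xx|/ltW xx] := leP x0 x.
  - have I t : x0 <= t <= x -> Num.min x0 x <= t <= Num.max x0 x by rewrite min_l// max_r.
    have /= := @der_le R (fun t => - (E t * expR ((- K) * t + K * x0)))
      (fun t => - ((dE t * expR ((- K) * t + K * x0)) + E t * ((- K) * expR ((- K) * t + K * x0)))) _ _ xx.
    have e0 : - K * x0 + K * x0 = 0 by ring.
    rewrite lerN2 e0 expR0 mulr1 => h.
    rewrite ger0_norm ?subr_ge0//.
    have -> : K * (x - x0) = - ((- K) * x + K * x0) by ring.
    rewrite expRN ler_pdivlMr ?expR_gt0//; apply: h => t tI.
    + by apply: derN; apply: derM; [exact: dEP (I _ tI)|apply: der_affine; exact: der_exp].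
    + have -> : - (dE t * expR (- K * t + K * x0) + E t * (- K * expR (- K * t + K * x0)))
         = (K * E t - dE t) * expR (- K * t + K * x0) by ring.
      rewrite mulr_ge0 ?expR_ge0// subr_ge0; exact: le_trans (ler_norm _) (dEle _ (I _ tI)).
  - have I t : x <= t <= x0 -> Num.min x0 x <= t <= Num.max x0 x by rewrite min_r// max_l.
    have /= := @der_le R (fun t => (E t * expR (K * t - K * x0)))
      (fun t => ((dE t * expR (K * t - K * x0)) + E t * (K * expR (K * t - K * x0)))) _ _ xx.
    rewrite subrr expR0 mulr1 => h.
    rewrite distrC ger0_norm ?subr_ge0//.
    have -> : K * (x0 - x) = - (K * x - K * x0) by ring.
    rewrite expRN ler_pdivlMr ?expR_gt0//; apply: h => t tI.
    + by apply: derM; [exact: dEP (I _ tI)|apply: der_affine; exact: der_exp].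
    + have -> : dE t * expR (K * t - K * x0) + E t * (K * expR (K * t - K * x0))
         = (K * E t + dE t) * expR (K * t - K * x0) by ring.
      rewrite mulr_ge0 ?expR_ge0//; have := dEle _ (I _ tI).
      by rewrite ler_norml => /andP[? _]; lra.
have del0 : 0 <= del by apply: le_trans (zdel 0%N isT).
have sqle k : (k < 4)%N -> z k x0 * z k x0 <= del ^+ 2.
  by move=> k4; rewrite -expr2 -real_normK ?num_real// lerXn2r ?nnegrE//; exact: zdel.
move=> k k4.
set e := expR _.
have e1 : 1 <= e by rewrite -expR0 ler_expR mulr_ge0// addr_ge0.
have zE : z k x ^+ 2 <= E x.
  have := mulrr_ge0 (z 0%N x); have := mulrr_ge0 (z 1%N x).
  have := mulrr_ge0 (z 2%N x); have := mulrr_ge0 (z 3%N x); have := sqr_ge0 eta.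
  rewrite [z k x ^+ 2]expr2 /E; case: k k4 => [|[|[|[|]]]]// _;
    move: (z 0%N x * _) (z 1%N x * _) (z 2%N x * _) (z 3%N x * _) (eta ^+ 2) => a0 a1 a2 a3 a4 *; lra.
have E0 : E x0 <= (2 * del + eta) ^+ 2.
  have := sqle 0%N isT; have := sqle 1%N isT; have := sqle 2%N isT; have := sqle 3%N isT.
  have : 0 <= del * eta by rewrite mulr_ge0.
  rewrite /E [(2 * del + eta) ^+ 2](_ : _ = 4 * del ^+ 2 + 4 * (del * eta) + eta ^+ 2); last by ring.
  move: (z 0%N x0 * _) (z 1%N x0 * _) (z 2%N x0 * _) (z 3%N x0 * _) (del * _) (del ^+ 2) (eta ^+ 2).
  by move=> *; lra.
rewrite -(@ler_pXn2r _ 2)// ?nnegrE//; last by rewrite mulr_ge0 ?expR_ge0// addr_ge0// mulr_ge0.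
rewrite real_normK ?num_real// (le_trans zE)// (le_trans Eexp)//.
rewrite exprMn; apply: ler_pM => //; first by rewrite /E !addr_ge0 ?sqr_ge0//; exact: mulrr_ge0.
by rewrite expr2 -/K -/e ler_peMl// (le_trans ler01).
Qed.

End Gronwall.

(** * Existence of solutions *)

Section Picard.
Variable R : realType.

Lemma le0_half_exp (x C : R) : 0 <= C -> (forall n, x <= C * 2^-1 ^+ n) -> x <= 0.
Proof.
move=> C0 H; rewrite leNgt; apply/negP => x0.
have Cx : 0 <= C / x by rewrite divr_ge0// ltW.
have := archi_boundP Cx; set n := Num.bound _ => Cn.
have : x * 2 ^+ n <= C.
  have := H n; by rewrite exprVn ler_pdivlMr ?exprn_gt0.
have n2 : n%:R <= 2 ^+ n :> R by rewrite -natrX ler_nat ltnW// ltn_expl.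
move=> xC; have : C < x * n%:R by rewrite mulrC -ltr_pdivrMr.
by rewrite ltNge (le_trans _ xC)// ler_pM2l.
Qed.

(** The intervals of radius [r n] around [u n] are nested, because [r n - r n.+1] is exactly the
    allowed step; the limit is the supremum of their left ends. *)
Lemma geometric_limit (u : nat -> R) (C : R) : 0 <= C ->
  (forall n, `|u n.+1 - u n| <= C * 2^-1 ^+ n) ->
  exists l, forall n, `|l - u n| <= 2 * C * 2^-1 ^+ n.
Proof.
move=> C0 H.
pose r n : R := 2 * C * 2^-1 ^+ n.
have r0 n : 0 <= r n by rewrite /r !mulr_ge0// exprn_ge0// invr_ge0.
have rS n : C * 2^-1 ^+ n = r n - r n.+1.
  by rewrite /r exprS; field.
have lo n m : u n - r n <= u (n + m)%N - r (n + m)%N.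
  elim: m => [|m IH]; first by rewrite addn0.
  rewrite (le_trans IH)// addnS; have := H (n + m)%N; rewrite rS ler_norml => /andP[? _]; lra.
have hi n m : u (n + m)%N + r (n + m)%N <= u n + r n.
  elim: m => [|m IH]; first by rewrite addn0.
  rewrite (le_trans _ IH)// addnS; have := H (n + m)%N; rewrite rS ler_norml => /andP[_ ?]; lra.
have lohi n m : u n - r n <= u m + r m.
  have := lo n m; have := hi m n; rewrite [(m + n)%N]addnC; have := r0 (n + m)%N; lra.
pose E := range (fun n => u n - r n).
have E0 : E !=set0 by exists (u 0%N - r 0%N); exists 0%N.
have hub m : ubound E (u m + r m) by move=> _ [n _ <-]; exact: lohi.
exists (sup E) => n; rewrite -/(r n) ler_norml; apply/andP; split.
- have : u n - r n <= sup E by apply: ub_le_sup; [exists (u 0%N + r 0%N); exact: hub|exists n].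
  by lra.
- have : sup E <= u n + r n by apply: ge_sup => //; exact: hub.
  by lra.
Qed.

Definition prim (f : R -> R) (x0 : R) : R -> R :=
  xget (fun=> 0) [set F | F x0 = 0 /\ forall x, der F x (f x)].

Lemma primP f x0 : continuous f ->
  prim f x0 x0 = 0 /\ forall x, der (prim f x0) x (f x).
Proof.
move=> cf; rewrite /prim; have [F F0 dF] := continuous_primitive x0 cf.
exact: (@xgetPex _ (fun=> 0) [set F | F x0 = 0 /\ forall x, der F x (f x)]
  (ex_intro _ F (conj F0 dF))).
Qed.

Lemma prim_cont f x0 : continuous f -> continuous (prim f x0).
Proof. by move=> cf x; have [_ h] := primP x0 cf; exact: der_cont (h x). Qed.

Section Weight.
Variables (K x0 : R).
Hypothesis K1 : 1 <= K.
Let K0 : 0 < K. Proof. exact: lt_le_trans ltr01 K1. Qed.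

(** Twice cosh (K (x - x0)), the weight of a Bielecki norm. With it a single Picard iteration
    converges on the whole line, and solutions need not be continued from short intervals. *)
Definition weight (x : R) : R := expR (K * x + - (K * x0)) + expR (- K * x + K * x0).

Lemma weight_ge1 x : 1 <= weight x.
Proof.
rewrite /weight; have [h|h] := leP 0 (K * x + - (K * x0)).
- by rewrite ler_wpDr ?expR_ge0// -[leLHS]expR0 ler_expR.
- by rewrite ler_wpDl ?expR_ge0// -[leLHS]expR0 ler_expR; lra.
Qed.

(* Integration contracts the weighted sup norm by the factor [K^-1]. *)
Lemma weight_int h e C : 0 <= C -> (forall x, der h x (e x)) -> h x0 = 0 ->
  (forall x, `|e x| <= C * weight x) -> forall x, `|h x| <= C / K * weight x.
Proof.
move=> C0 dh h0 eC x.
pose S t := C / K * (expR (K * t + - (K * x0)) - expR (- K * t + K * x0)).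
have dS t : der S t (C * weight t).
  apply: der_eq (derMl _ (derB (der_affine (der_exp _)) (der_affine (der_exp _)))) _.
  by rewrite /weight; field; rewrite gt_eqF.
have S0 : S x0 = 0.
  rewrite /S (_ : K * x0 + - (K * x0) = 0); last by ring.
  by rewrite (_ : - K * x0 + K * x0 = 0); [rewrite subrr mulr0|ring].
have CK : 0 <= C / K by rewrite divr_ge0// ltW.
have Sl t : `|S t| <= C / K * weight t.
  rewrite normrM ger0_norm// ler_wpM2l// /weight ler_norml.
  by have := expR_ge0 (K * t + - (K * x0)); have := expR_ge0 (- K * t + K * x0); lra.
have P1 t : der (fun t => S t - h t) t (C * weight t - e t) by apply: derB.
have P2 t : der (fun t => S t + h t) t (C * weight t + e t) by apply: derD.
have Q1 t : 0 <= C * weight t - e t by have := eC t; rewrite ler_norml => /andP[]; lra.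
have Q2 t : 0 <= C * weight t + e t by have := eC t; rewrite ler_norml => /andP[]; lra.
have := Sl x; rewrite !ler_norml => /andP[b1 b2].
have [xx|/ltW xx] := leP x0 x.
- have := der_le xx (fun t _ => P1 t) (fun t _ => Q1 t).
  have := der_le xx (fun t _ => P2 t) (fun t _ => Q2 t).
  by rewrite S0 h0; lra.
- have := der_le xx (fun t _ => P1 t) (fun t _ => Q1 t).
  have := der_le xx (fun t _ => P2 t) (fun t _ => Q2 t).
  by rewrite S0 h0; lra.
Qed.

(** The weight is bounded near each point, so convergence in the weighted norm is locally
    uniform. *)
Lemma weight_lim (y : R -> R) (Y : nat -> R -> R) C : 0 <= C ->
  (forall n, continuous (Y n)) ->
  (forall n x, `|y x - Y n x| <= C * 2^-1 ^+ n * weight x) -> continuous y.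
Proof.
move=> C0 cY H x.
apply/cvgrPdist_lt => e e0.
pose W := weight x + 1.
have W0 : 0 < W by rewrite /W; have := weight_ge1 x; lra.
have cw : {for x, continuous weight}.
  have dw : der weight x (K * expR (K * x + - (K * x0)) + - K * expR (- K * x + K * x0)).
    by apply: derD; apply: der_affine; exact: der_exp.
  exact: der_cont dw.
have [n nP] : exists n, C * 2^-1 ^+ n * W < e / 3.
  apply: contrapT => /forallNP h.
  have : e / 3 <= 0.
    apply: (@le0_half_exp _ (C * W)); first by rewrite mulr_ge0// ltW.
    by move=> n; rewrite mulrAC leNgt; apply/negP => /h.
  by lra.
near=> t.
have wt : weight t < W.
  near: t; have /cvgrPdist_lt/(_ 1 ltr01) := cw; apply: filterS => t.
  by rewrite /W ltr_norml => /andP[]; lra.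
have Yt : `|Y n x - Y n t| < e / 3.
  near: t; have /cvgrPdist_lt := cY n x; apply; lra.
have C2 : 0 <= C * 2^-1 ^+ n by rewrite mulr_ge0// exprn_ge0// invr_ge0.
have b1 : `|y x - Y n x| < e / 3.
  rewrite (le_lt_trans (H n x))// (le_lt_trans _ nP)//; apply: ler_wpM2l => //; rewrite /W; lra.
have b2 : `|y t - Y n t| < e / 3.
  rewrite (le_lt_trans (H n t))// (le_lt_trans _ nP)//; apply: ler_wpM2l => //; exact: ltW.
move: b1 b2 Yt; rewrite !ltr_norml => /andP[? ?] /andP[? ?] /andP[? ?].
by apply/andP; split; lra.
Unshelve. all: by end_near. Qed.

End Weight.

(* [y k] is the k-th derivative of a solution [y 0] of [y'''' = p y]. *)
Definition sol (p : R -> R) (y : nat -> R -> R) : Prop :=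
  (forall k x, (k < 3)%N -> der (y k) x (y k.+1 x)) /\
  forall x, der (y 3%N) x (p x * y 0%N x).

Section Existence.
Variables (p : R -> R) (M x0 : R) (d : nat -> R).
Hypothesis pc : continuous p.
Hypothesis pM : forall x, `|p x| <= M.

Let M0 : 0 <= M. Proof. exact: le_trans (pM 0). Qed.
(** The Picard map [I0] unfolded one integration at a time. At a fixed point of [I0], the functions
    [I1], [I2], [I3] are its first three derivatives. *)
Let I3 y := fun x => d 3%N + prim (fun t => p t * y t) x0 x.
Let I2 y := fun x => d 2%N + prim (I3 y) x0 x.
Let I1 y := fun x => d 1%N + prim (I2 y) x0 x.
Let I0 y := fun x => d 0%N + prim (I1 y) x0 x.

Let addc_cont (c : R) f : continuous f -> continuous (fun x : R => c + f x).
Proof. by move=> cf x; apply: cvgD; [exact: cvg_cst|exact: cf]. Qed.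
Let py_cont y : continuous y -> continuous (fun x : R => p x * y x).
Proof. by move=> cy x; apply: cvgM; [exact: pc|exact: cy]. Qed.
Let c3 y : continuous y -> continuous (I3 y).
Proof. by move=> cy; apply: addc_cont; apply: prim_cont; apply: py_cont. Qed.
Let c2 y : continuous y -> continuous (I2 y).
Proof. by move=> cy; apply: addc_cont; apply: prim_cont; apply: c3. Qed.
Let c1 y : continuous y -> continuous (I1 y).
Proof. by move=> cy; apply: addc_cont; apply: prim_cont; apply: c2. Qed.
Let c0 y : continuous y -> continuous (I0 y).
Proof. by move=> cy; apply: addc_cont; apply: prim_cont; apply: c1. Qed.

Let K := 2 * M + 1.
Let K1 : 1 <= K. Proof. by have := M0; rewrite /K; lra. Qed.
Let w := weight K x0.

Let prim_contr f g C : 0 <= C -> continuous f -> continuous g ->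
  (forall x, `|f x - g x| <= C * w x) ->
  forall x, `|prim f x0 x - prim g x0 x| <= C / K * w x.
Proof.
move=> C0 cf cg fg.
have [f0 df] := primP x0 cf; have [g0 dg] := primP x0 cg.
apply: (weight_int K1 C0 (h := fun x => prim f x0 x - prim g x0 x)
  (e := fun x => f x - g x)) => //.
- by move=> x; apply: derB.
- by rewrite f0 g0 subrr.
Qed.

(** With [K = 2 M + 1] the innermost integration, which also carries the factor [M], contributes at
    most 1/2; the other three contribute at most 1 each because [1 <= K]. *)
Let I0_contr y z C : 0 <= C -> continuous y -> continuous z ->
  (forall x, `|y x - z x| <= C * w x) ->
  forall x, `|I0 y x - I0 z x| <= C / 2 * w x.
Proof.
move=> C0 cy cz yz.
have K0 : 0 < K by apply: lt_le_trans ltr01 K1.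
have Kle (D : R) : 0 <= D -> D / K <= D.
  by move=> D0; rewrite ler_pdivrMr// ler_peMr.
have e4 x : `|p x * y x - p x * z x| <= M * C * w x.
  rewrite -mulrBr normrM -mulrA; apply: ler_pM => //.
have e3 x : `|I3 y x - I3 z x| <= M * C / K * w x.
  rewrite /I3 opprD addrACA subrr add0r.
  by apply: prim_contr => //; [rewrite mulr_ge0|exact: py_cont|exact: py_cont].
have q3 : 0 <= M * C / K by rewrite divr_ge0 ?mulr_ge0// ltW.
have e2 x : `|I2 y x - I2 z x| <= M * C / K / K * w x.
  rewrite /I2 opprD addrACA subrr add0r.
  by apply: prim_contr => //; exact: c3.
have q2 : 0 <= M * C / K / K by rewrite divr_ge0// ltW.
have e1 x : `|I1 y x - I1 z x| <= M * C / K / K / K * w x.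
  rewrite /I1 opprD addrACA subrr add0r.
  by apply: prim_contr => //; exact: c2.
have q1 : 0 <= M * C / K / K / K by rewrite divr_ge0// ltW.
move=> x; rewrite /I0 opprD addrACA subrr add0r.
apply: le_trans (prim_contr q1 (c1 cy) (c1 cz) e1 x) _.
have w0 : 0 <= w x by by apply: (le_trans ler01); exact: weight_ge1.
rewrite ler_wpM2r//.
rewrite (le_trans (Kle _ q1))// (le_trans (Kle _ q2))// (le_trans (Kle _ q3))//.
by rewrite ler_pdivrMr// /K -subr_ge0 [X in 0 <= X](_ : _ = C / 2) ?divr_ge0//; field.
Qed.

Lemma sol_exists : exists2 y, sol p y & forall k, (k < 4)%N -> y k x0 = d k.
Proof.
pose Y n := iter n I0 (fun=> 0).
have cY n : continuous (Y n).
  by elim: n => [|n IH]; [move=> x; exact: cvg_cst|exact: c0].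
have K0 : 0 < K by apply: lt_le_trans ltr01 K1.
have w1 x : 1 <= w x by exact: weight_ge1.
have w0 x : 0 <= w x by exact: le_trans ler01 (w1 x).
have Kle (D : R) : 0 <= D -> D / K <= D.
  by move=> D0; rewrite ler_pdivrMr// ler_peMr.
have prim_bd c f C : 0 <= C -> continuous f -> (forall x, `|f x| <= C * w x) ->
    forall x, `|c + prim f x0 x| <= (`|c| + C) * w x.
  move=> C0 cf fC x.
  have [f0 df] := primP x0 cf.
  have := weight_int K1 C0 df f0 fC x => h.
  apply: le_trans (ler_normD _ _) _; rewrite mulrDl lerD//.
    by rewrite ler_peMr.
  by rewrite (le_trans h)// ler_wpM2r// Kle.
(* Nested like the Picard map, so that each application of [prim_bd] peels off one summand. *)
pose D := `|d 0%N| + (`|d 1%N| + (`|d 2%N| + (`|d 3%N| + 0))).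
have D0 : 0 <= D by rewrite /D !addr_ge0.
have Y1 x : `|Y 1%N x - Y 0%N x| <= D * w x.
  rewrite /Y /= subr0 /D /I0; apply: (prim_bd); [by rewrite !addr_ge0|exact: c1 (cY 0%N)|].
  apply: (prim_bd); [by rewrite !addr_ge0|exact: c2 (cY 0%N)|].
  apply: (prim_bd); [by rewrite !addr_ge0|exact: c3 (cY 0%N)|].
  apply: (prim_bd); [by []|exact: py_cont (cY 0%N)|].
  by move=> t; rewrite mulr0 normr0 mul0r.
have YS n x : `|Y n.+1 x - Y n x| <= D * 2^-1 ^+ n * w x.
  elim: n x => [|n IH] x; first by rewrite expr0 mulr1.
  rewrite exprS [D * _](_ : _ = D * 2^-1 ^+ n / 2); last by ring.
  by apply: (I0_contr _ (cY n.+1) (cY n) IH); rewrite mulr_ge0// exprn_ge0// invr_ge0.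
have lim x : exists l, forall n, `|l - Y n x| <= 2 * (D * w x) * 2^-1 ^+ n.
  apply: (@geometric_limit (fun n => Y n x)); first by rewrite mulr_ge0.
  by move=> n; rewrite mulrAC.
have [y yP] := choice lim.
have yY n x : `|y x - Y n x| <= 2 * D * 2^-1 ^+ n * w x.
  by have := yP x n; rewrite mulrA mulrAC.
have cy : continuous y.
  by apply: (@weight_lim K x0 y Y (2 * D)) => //; rewrite mulr_ge0.
have fix_y : I0 y = y.
  apply/funext => x; apply/eqP; rewrite -subr_eq0 -normr_le0.
  apply: (@le0_half_exp _ (2 * (D * w x))); first by rewrite !mulr_ge0.
  move=> n.
  have h1 : `|I0 y x - Y n.+1 x| <= 2 * D * 2^-1 ^+ n / 2 * w x.
    by apply: (I0_contr _ cy (cY n) (yY n)); rewrite !mulr_ge0// exprn_ge0// invr_ge0.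
  have h2 := yY n.+1 x; rewrite exprS in h2.
  have -> : I0 y x - y x = (I0 y x - Y n.+1 x) - (y x - Y n.+1 x) by ring.
  apply: le_trans (ler_normB _ _) _; apply: le_trans (lerD h1 h2) _.
  by rewrite le_eqVlt; apply/orP; left; apply/eqP; field.
exists (fun k => match k with 0%N => y | 1%N => I1 y | 2%N => I2 y | _ => I3 y end).
- split.
  + have dI c f x : continuous f -> der (fun x => c + prim f x0 x) x (f x).
      move=> cf; have [_ h] := primP x0 cf.
      by apply: der_eq (derD (derC _ _) (h x)) _; rewrite add0r.
    case=> [|[|[|]]]// x _.
    * by rewrite -[in X in der X]fix_y; apply: dI; exact: c1.
    * by apply: dI; exact: c2.
    * by apply: dI; exact: c3.
  + move=> x; have [_ h] := primP x0 (py_cont cy).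
    by apply: der_eq (derD (derC _ _) (h x)) _; rewrite add0r.
- have z f : continuous f -> prim f x0 x0 = 0 by move=> /(primP x0)[].
  case=> [|[|[|[|]]]]// _.
  + by rewrite -fix_y /I0 z ?addr0//; exact: c1.
  + by rewrite /I1 z ?addr0//; exact: c2.
  + by rewrite /I2 z ?addr0//; exact: c3.
  + by rewrite /I3 z ?addr0//; exact: py_cont.
Qed.

End Existence.
End Picard.

(** * The equation y'''' = p y *)

Section Solutions.
Variable R : realType.
Implicit Types (p q : R -> R) (y z : nat -> R -> R) (x : R).

(** Boundedness on the whole line makes every solution global, so that statements about solutions
    carry no domain. Coefficients given only on an interval are extended by [clamp]. *)
Definition bounded_coef p : Prop :=
  continuous p /\ exists M : R, forall x : R, `|p x| <= M.

Definition fund p x0 (k : nat) : nat -> R -> R :=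
  xget (fun _ _ => 0) [set y | sol p y /\ forall j, (j < 4)%N -> y j x0 = (j == k)%:R].

Lemma fundP p x0 k : bounded_coef p ->
  sol p (fund p x0 k) /\ forall j, (j < 4)%N -> fund p x0 k j x0 = (j == k)%:R.
Proof.
move=> [cp [M pM]]; rewrite /fund.
have [y sy y0] := sol_exists x0 (fun j => (j == k)%:R) cp pM.
exact: (@xgetPex _ (fun _ _ => 0)
  [set y | sol p y /\ forall j, (j < 4)%N -> y j x0 = (j == k)%:R]
  (ex_intro _ y (conj sy y0))).
Qed.

Lemma der_sum n (f : 'I_n -> R -> R) (l : 'I_n -> R) x :
  (forall i, der (f i) x (l i)) -> der (fun t => \sum_i f i t) x (\sum_i l i).
Proof.
elim: n f l => [|n IH] f l H.
  rewrite big_ord0 (_ : (fun t => \sum_i f i t) = fun=> 0); first exact: derC.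
  by apply/funext => t; rewrite big_ord0.
rewrite big_ord_recl (_ : (fun t => \sum_i f i t)
  = fun t => f ord0 t + \sum_(i < n) f (lift ord0 i) t).
  by apply: derD => //; apply: IH.
by apply/funext => t; rewrite big_ord_recl.
Qed.

Lemma sol_sum p n (c : 'I_n -> R) (y : 'I_n -> nat -> R -> R) :
  (forall i, sol p (y i)) -> sol p (fun k x => \sum_i c i * y i k x).
Proof.
move=> H; split=> [k x k3|x].
  by apply: der_sum => i; apply: derMl; have [h _] := H i; exact: h.
rewrite mulr_sumr; apply: der_sum => i; rewrite mulrCA.
by apply: derMl; have [_ h] := H i; exact: h.
Qed.

Lemma solZ p c y : sol p y -> sol p (fun k x => c * y k x).
Proof.
move=> [h1 h2]; split=> [k x k3|x]; first by apply: derMl; exact: h1.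
by rewrite mulrCA; apply: derMl; exact: h2.
Qed.

Lemma solD p y z : sol p y -> sol p z -> sol p (fun k x => y k x + z k x).
Proof.
move=> [h1 h2] [g1 g2]; split=> [k x k3|x]; first by apply: derD; [exact: h1|exact: g1].
by rewrite mulrDr; apply: derD.
Qed.

Lemma solB p y z : sol p y -> sol p z -> sol p (fun k x => y k x - z k x).
Proof.
move=> [h1 h2] [g1 g2]; split=> [k x k3|x]; first by apply: derB; [exact: h1|exact: g1].
by rewrite mulrBr; apply: derB.
Qed.

Lemma sol_cont p y k : sol p y -> (k < 4)%N -> continuous (y k).
Proof.
move=> [h1 h2]; case: k => [|[|[|[|]]]]// _ x.
- exact: der_cont (h1 0%N x isT).
- exact: der_cont (h1 1%N x isT).
- exact: der_cont (h1 2%N x isT).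
- exact: der_cont (h2 x).
Qed.

(* The difference solves an inhomogeneous equation with right-hand side (p - q) z. *)
Lemma sol_diff p q y z (M eta B del x0 x : R) :
  0 <= M -> 0 <= eta -> 0 <= B -> sol p y -> sol q z ->
  (forall t, Num.min x0 x <= t <= Num.max x0 x ->
     [/\ `|p t| <= M, `|p t - q t| <= eta & `|z 0%N t| <= B]) ->
  (forall k, (k < 4)%N -> `|y k x0 - z k x0| <= del) ->
  forall k, (k < 4)%N ->
    `|y k x - z k x| <= (2 * del + eta * B) * expR ((M + 4) * `|x - x0|).
Proof.
move=> M0 eta0 B0 [y1 y2] [z1 z2] H dl k k4.
apply: (@gronwall R (fun k x => y k x - z k x) (fun x => p x * y 0%N x - q x * z 0%N x)) => //.
  by rewrite mulr_ge0.
move=> t tI; have [pM pq zB] := H t tI; split.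
- by move=> i i3; apply: derB; [exact: y1|exact: z1].
- exact: derB.
- have -> : p t * y 0%N t - q t * z 0%N t
    = p t * (y 0%N t - z 0%N t) + (p t - q t) * z 0%N t by ring.
  apply: le_trans (ler_normD _ _) _; rewrite !normrM lerD//.
    by rewrite ler_wpM2r.
  by apply: ler_pM.
Qed.

Lemma sol0 p : sol p (fun _ _ => 0).
Proof. by split=> [k x _|x]; rewrite ?mulr0; exact: derC. Qed.

Lemma sol_bound p y (M del x0 x : R) : 0 <= M -> sol p y ->
  (forall t, Num.min x0 x <= t <= Num.max x0 x -> `|p t| <= M) ->
  (forall k, (k < 4)%N -> `|y k x0| <= del) ->
  forall k, (k < 4)%N -> `|y k x| <= 2 * del * expR ((M + 4) * `|x - x0|).
Proof.
move=> M0 sy pM yd k k4.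
have := @sol_diff p p y (fun _ _ => 0) M 0 0 del x0 x M0 (lexx 0) (lexx 0) sy (sol0 p) _ _ k k4.
rewrite subr0 mulr0 addr0; apply.
- by move=> t tI; rewrite subrr normr0; split => //; exact: pM.
- by move=> i i4; rewrite subr0; exact: yd.
Qed.

Lemma sol_unique p y z x0 : (exists M : R, forall x : R, `|p x| <= M) ->
  sol p y -> sol p z -> (forall k, (k < 4)%N -> y k x0 = z k x0) ->
  forall k x, (k < 4)%N -> y k x = z k x.
Proof.
move=> [M pM] sy sz yz k x k4.
apply/eqP; rewrite -subr_eq0 -normr_le0.
have M0 : 0 <= M by exact: le_trans (pM 0).
have := @sol_bound p _ M 0 x0 x M0 (solB sy sz) _ _ k k4.
rewrite mulr0 mul0r; apply => // i i4.
by rewrite yz// subrr normr0.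
Qed.

(** The solution of the equation with coefficient [p] whose jet at [x0] is [c]. *)
Definition comb (c : nat -> R) p x0 : nat -> R -> R :=
  fun j x => \sum_(k < 4) c k * fund p x0 k j x.

Lemma sol_comb c p x0 : bounded_coef p -> sol p (comb c p x0).
Proof.
move=> gp; apply: (@sol_sum p 4 (fun k => c k) (fun k : 'I_4 => fund p x0 k)) => i.
by have [] := fundP x0 i gp.
Qed.

Lemma comb_init c p x0 j : bounded_coef p -> (j < 4)%N -> comb c p x0 j x0 = c j.
Proof.
move=> gp j4; rewrite /comb (bigD1 (Ordinal j4))//= big1 ?addr0.
  by have [_ ->] := fundP x0 j gp; rewrite // eqxx mulr1.
move=> i ij; have [_ ->//] := fundP x0 i gp.
by move: ij; rewrite -val_eqE /= eq_sym => /negbTE ->; rewrite mulr0.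
Qed.

Lemma sol_expand p y x0 : bounded_coef p -> sol p y ->
  forall j x, (j < 4)%N -> y j x = comb (y ^~ x0) p x0 j x.
Proof.
move=> gp sy; apply: (@sol_unique p _ _ x0); [by case: gp|by []|exact: sol_comb|].
by move=> k k4; rewrite comb_init.
Qed.

(** Lagrange's bilinear form of the fourth derivative: differentiating it gives y'''' z - y z''''.
    It is constant when both functions solve the same equation, and otherwise its increment
    integrates the difference of the coefficients. The symmetry arguments below rest on it. *)
Definition wron y z x : R :=
  y 3%N x * z 0%N x - y 2%N x * z 1%N x + y 1%N x * z 2%N x - y 0%N x * z 3%N x.

Lemma der_wron p q y z x : sol p y -> sol q z ->
  der (wron y z) x ((p x - q x) * (y 0%N x * z 0%N x)).
Proof.
move=> [y1 y2] [z1 z2].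
apply: der_eq (derB (derD (derB (derM (y2 x) (z1 0%N x isT)) (derM (y1 2%N x isT) (z1 1%N x isT)))
  (derM (y1 1%N x isT) (z1 2%N x isT))) (derM (y1 0%N x isT) (z2 x))) _.
by ring.
Qed.

Lemma sol_lipschitz p y (M B c d : R) : 0 <= B -> sol p y ->
  (forall t, c <= t <= d -> `|p t| <= M /\ forall k, (k < 4)%N -> `|y k t| <= B) ->
  forall k x x', (k < 4)%N -> c <= x <= d -> c <= x' <= d ->
    `|y k x - y k x'| <= (B + M * B) * `|x - x'|.
Proof.
move=> B0 [y1 y2] H k x x' k4 xI x'I.
have M0 : 0 <= M by have [h _] := H x xI; exact: le_trans h.
have [k3|k3] := boolP (k < 3)%N.
  apply: (@mean_value_ineq R (y k) (y k.+1) (B + M * B) c d) => // t tI.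
    exact: y1.
  by have [_ h] := H t tI; rewrite (le_trans (h k.+1 _))// lerDl mulr_ge0.
have -> : k = 3%N by lia.
apply: (@mean_value_ineq R (y 3%N) (fun t => p t * y 0%N t) (B + M * B) c d) => // t tI.
have [h1 h2] := H t tI; rewrite normrM (le_trans (ler_pM _ _ h1 (h2 0%N isT)))//.
by rewrite lerDr.
Qed.

End Solutions.

(** * Bounded families that are Lipschitz in a parameter *)

Section LipschitzFamilies.
Variables (R : realType) (T : Type) (A : set T) (rho : T -> T -> R).
Hypothesis rho0 : forall t s, 0 <= rho t s.
Implicit Types (h g : T -> R).

(** One constant bounds both values and increments, so that the class is closed under products.
    [rho] is abstract because different distances are used near eps = 0 and near a positive eps. *)
Definition lip (C : R) h : Prop :=
  [/\ 0 <= C, forall t, A t -> `|h t| <= C &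
      forall t s, A t -> A s -> `|h t - h s| <= C * rho t s].

Definition lipc h : Prop := exists C, lip C h.

Lemma lip_le C D h : C <= D -> lip C h -> lip D h.
Proof.
move=> CD [C0 h1 h2]; split; first exact: le_trans CD.
- by move=> t At; exact: le_trans (h1 t At) CD.
- by move=> t s At As; apply: le_trans (h2 t s At As) _; rewrite ler_wpM2r.
Qed.

Lemma lip_eq C h g : (forall t, A t -> h t = g t) -> lip C h -> lip C g.
Proof.
move=> hg [C0 h1 h2]; split => //.
- by move=> t At; rewrite -hg// h1.
- by move=> t s At As; rewrite -!hg// h2.
Qed.

Lemma lipD C D h g : lip C h -> lip D g -> lip (C + D) (fun t => h t + g t).
Proof.
move=> [C0 h1 h2] [D0 g1 g2]; split; first exact: addr_ge0.
- by move=> t At; apply: le_trans (ler_normD _ _) _; rewrite lerD ?h1 ?g1.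
- move=> t s At As; rewrite opprD addrACA mulrDl.
  by apply: le_trans (ler_normD _ _) _; rewrite lerD ?h2 ?g2.
Qed.

Lemma lipM C D h g : lip C h -> lip D g -> lip (2 * (C * D)) (fun t => h t * g t).
Proof.
move=> [C0 h1 h2] [D0 g1 g2].
have CD : 0 <= C * D by rewrite mulr_ge0.
split; first by rewrite mulr_ge0.
- move=> t At; rewrite normrM; apply: le_trans (ler_pM _ _ (h1 t At) (g1 t At)) _ => //; lra.
- move=> t s At As.
  have -> : h t * g t - h s * g s = h t * (g t - g s) + (h t - h s) * g s by ring.
  apply: le_trans (ler_normD _ _) _; rewrite !normrM.
  have r1 := ler_pM (normr_ge0 _) (normr_ge0 _) (h1 t At) (g2 t s At As).
  have r2 := ler_pM (normr_ge0 _) (normr_ge0 _) (h2 t s At As) (g1 s As).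
  apply: le_trans (lerD r1 r2) _.
  by rewrite le_eqVlt; apply/orP; left; apply/eqP; ring.
Qed.

Lemma lip_cst c : lip `|c| (fun=> c).
Proof. by split => // t s _ _; rewrite subrr normr0 mulr_ge0. Qed.

Lemma lipN C h : lip C h -> lip C (fun t => - h t).
Proof.
move=> [C0 h1 h2]; split => //.
- by move=> t At; rewrite normrN h1.
- by move=> t s At As; rewrite -opprD normrN h2.
Qed.

Lemma lipV C c h : 0 < c -> (forall t, A t -> c <= `|h t|) -> lip C h ->
  lip (c^-1 + C / (c * c)) (fun t => (h t)^-1).
Proof.
move=> c0 hc [C0 h1 h2].
have q : 0 <= C / (c * c) by rewrite divr_ge0// mulr_ge0// ltW.
have ci : 0 <= c^-1 by rewrite invr_ge0 ltW.
have hn0 t : A t -> h t != 0.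
  by move=> At; rewrite -normr_gt0 (lt_le_trans c0)// hc.
have ic t : A t -> `|(h t)^-1| <= c^-1.
  by move=> At; rewrite normfV lef_pV2 ?posrE ?normr_gt0 ?hn0// hc.
split; first exact: addr_ge0.
- by move=> t At; rewrite (le_trans (ic t At))// lerDl.
- move=> t s At As.
  have -> : (h t)^-1 - (h s)^-1 = - (h t - h s) * ((h t)^-1 * (h s)^-1).
    by field; rewrite hn0//= hn0.
  rewrite !normrM normrN.
  apply: le_trans (ler_pM _ _ (h2 t s At As) (ler_pM _ _ (ic t At) (ic s As))) _ => //.
  have -> : C * rho t s * (c^-1 / c) = C / (c * c) * rho t s by rewrite invfM; ring.
  by rewrite ler_wpM2r// lerDr.
Qed.

Lemma lipc_eq h g : (forall t, A t -> h t = g t) -> lipc h -> lipc g.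
Proof. by move=> hg [C hC]; exists C; exact: lip_eq hC. Qed.

Lemma lipc_cst c : lipc (fun=> c).
Proof. by exists `|c|; exact: lip_cst. Qed.

Lemma lipcD h g : lipc h -> lipc g -> lipc (fun t => h t + g t).
Proof. by move=> [C hC] [D gD]; exists (C + D); exact: lipD. Qed.

Lemma lipcM h g : lipc h -> lipc g -> lipc (fun t => h t * g t).
Proof. by move=> [C hC] [D gD]; exists (2 * (C * D)); exact: lipM. Qed.

Lemma lipcV c h : 0 < c -> (forall t, A t -> c <= `|h t|) -> lipc h ->
  lipc (fun t => (h t)^-1).
Proof. by move=> c0 hc [C hC]; exists (c^-1 + C / (c * c)); exact: lipV hC. Qed.

Lemma lipc_sum (I : Type) (r : seq I) (P : pred I) (F : I -> T -> R) :
  (forall i, lipc (F i)) -> lipc (fun t => \sum_(i <- r | P i) F i t).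
Proof.
move=> H; elim: r => [|i r IH].
  by apply: lipc_eq (lipc_cst 0) => t _; rewrite big_nil.
case Pi : (P i).
  by apply: lipc_eq (lipcD (H i) IH) => t _; rewrite big_cons Pi.
by apply: lipc_eq IH => t _; rewrite big_cons Pi.
Qed.

Lemma lipc_prod (I : Type) (r : seq I) (P : pred I) (F : I -> T -> R) :
  (forall i, lipc (F i)) -> lipc (fun t => \prod_(i <- r | P i) F i t).
Proof.
move=> H; elim: r => [|i r IH].
  by apply: lipc_eq (lipc_cst 1) => t _; rewrite big_nil.
case Pi : (P i).
  by apply: lipc_eq (lipcM (H i) IH) => t _; rewrite big_cons Pi.
by apply: lipc_eq IH => t _; rewrite big_cons Pi.
Qed.

Lemma lipc_det n (F : T -> 'M[R]_n) : (forall i j, lipc (fun t => F t i j)) ->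
  lipc (fun t => \det (F t)).
Proof.
move=> H; apply: lipc_sum => s; apply: lipcM; first exact: lipc_cst.
by apply: lipc_prod => i; exact: H.
Qed.

Lemma lipc_adj n (F : T -> 'M[R]_n) : (forall i j, lipc (fun t => F t i j)) ->
  forall i j, lipc (fun t => (\adj (F t)) i j).
Proof.
move=> H i j; apply: (@lipc_eq (fun t => (-1) ^+ (j + i) * \det (row' j (col' i (F t))))).
  by move=> t _; rewrite mxE.
apply: lipcM; first exact: lipc_cst.
apply: lipc_det => k l; apply: (@lipc_eq (fun t => F t (lift j k) (lift i l))) => //.
by move=> t _; rewrite !mxE.
Qed.

(** Gronwall's estimate is used twice: for the fundamental solutions, bounded by [2 * e], and for
    the difference of two of them, which has zero initial data and an inhomogeneity of order
    [rho t s]. The exponent in [e] uses that two points of [-L, L] are at most [2 * L] apart. *)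
Lemma lip_fund (p : T -> R -> R) (M C L : R) : 0 <= M -> 0 <= C ->
  (forall t, A t -> bounded_coef (p t)) ->
  (forall t x, A t -> `|x| <= L -> `|p t x| <= M) ->
  (forall t s x, A t -> A s -> `|x| <= L -> `|p t x - p s x| <= C * rho t s) ->
  exists C', forall x0 x k j, `|x0| <= L -> `|x| <= L -> (k < 4)%N -> (j < 4)%N ->
    lip C' (fun t => fund (p t) x0 k j x).
Proof.
move=> M0 C0 gp pM pC.
pose e := expR ((M + 4) * (2 * L)).
have e0 : 0 <= e by exact: expR_ge0.
have tL x0 x t : `|x0| <= L -> `|x| <= L -> Num.min x0 x <= t <= Num.max x0 x -> `|t| <= L.
  rewrite !ler_norml => /andP[a1 a2] /andP[b1 b2] /andP[]; rewrite ge_min le_max.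
  by case/orP => ?; case/orP => ?; apply/andP; split; lra.
have ee x0 x : `|x0| <= L -> `|x| <= L -> expR ((M + 4) * `|x - x0|) <= e.
  move=> h1 h2; rewrite ler_expR ler_wpM2l ?addr_ge0//.
  by apply: le_trans (ler_normB _ _) _; lra.
have bd t x0 x k j : A t -> `|x0| <= L -> `|x| <= L -> (j < 4)%N ->
    `|fund (p t) x0 k j x| <= 2 * e.
  move=> At x0L xL j4; have [sf f0] := fundP x0 k (gp t At).
  have := @sol_bound R (p t) _ M 1 x0 x M0 sf _ _ j j4; rewrite mulr1 => h.
  apply: le_trans (h _ _) _.
  - by move=> s sI; apply: pM => //; exact: tL sI.
  - by move=> i i4; rewrite f0//; case: (i == k); rewrite ?normr1 ?normr0.
  - by rewrite ler_pM2l// ee.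
exists (2 * e + C * (2 * e) * e) => x0 x k j x0L xL k4 j4.
have q : 0 <= C * (2 * e) * e by rewrite !mulr_ge0.
split; first by rewrite addr_ge0// mulr_ge0.
- by move=> t At; rewrite (le_trans (bd _ _ _ _ _ At x0L xL j4))// lerDl.
- move=> t s At As.
  have [sf f0] := fundP x0 k (gp t At); have [sg g0] := fundP x0 k (gp s As).
  have Cr : 0 <= C * rho t s by rewrite mulr_ge0.
  have e2 : 0 <= 2 * e by rewrite mulr_ge0.
  have := @sol_diff R _ _ _ _ M (C * rho t s) (2 * e) 0 x0 x M0 Cr e2 sf sg _ _ j j4.
  rewrite mulr0 add0r => h; apply: le_trans (h _ _) _.
  + move=> u uI; have uL := tL _ _ _ x0L xL uI; split; [exact: pM|exact: pC|exact: bd].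
  + by move=> i i4; rewrite f0// g0// subrr normr0.
  + apply: le_trans (_ : C * rho t s * (2 * e) * e <= _).
      by rewrite ler_wpM2l ?ee// mulr_ge0.
    have -> : C * rho t s * (2 * e) * e = C * (2 * e) * e * rho t s by ring.
    by rewrite ler_wpM2r// lerDr.
Qed.

End LipschitzFamilies.

(** * Traces and weak solutions *)

Section Clamp.
Variable R : realType.

Definition clamp (c d x : R) : R := Num.max c (Num.min x d).

Lemma clamp_cont c d : continuous (clamp c d).
Proof.
move=> x; apply: (@continuous_max R R (fun=> c) (fun t => Num.min t d)); first exact: cvg_cst.
by apply: (@continuous_min R R (fun t => t) (fun=> d)); [exact: cvg_id|exact: cvg_cst].
Qed.

Lemma clamp_in c d x : c <= d -> c <= clamp c d x <= d.
Proof. by move=> cd; rewrite /clamp le_max lexx ge_max cd ge_min lexx orbT. Qed.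

Lemma clamp_id c d x : c <= x <= d -> clamp c d x = x.
Proof. by move=> /andP[cx xd]; rewrite /clamp min_l// max_r. Qed.

Lemma within_comp_cont (A : set R) (f g : R -> R) :
  {within A, continuous f} -> continuous g -> (forall t, A (g t)) ->
  continuous (fun t => f (g t)).
Proof.
move=> cf cg Ag x; have := cf (g x); rewrite /continuous_at /= => h.
apply/cvgrPdist_lt => e e0.
have /cvgrPdist_lt/(_ e e0) h' := h.
have H : within A (nbhs (g x)) [set t | `|f (g x) - f t| < e].
  by rewrite nbhs_subspace_in.
have H3 : \forall t \near x, A (g t) -> `|f (g x) - f (g t)| < e by exact: cg x _ H.
by near=> t; apply: (near H3 t).
Unshelve. all: by end_near. Qed.

Lemma continuous_clamp (f : R -> R) c d : c <= d -> {within `[c, d], continuous f} ->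
  bounded_coef (fun t => f (clamp c d t)).
Proof.
move=> cd cf; have cc : continuous (fun t => f (clamp c d t)).
  apply: (within_comp_cont cf); first exact: clamp_cont.
  by move=> t; rewrite /= in_itv/=; exact: clamp_in.
split => //.
have [x1 _ h1] := EVT_max cd cf; have [x2 _ h2] := EVT_min cd cf.
exists (`|f x1| + `|f x2|) => x.
have I : clamp c d x \in `[c, d] by rewrite in_itv/=; exact: clamp_in.
have := h1 _ I; have := h2 _ I.
have := ler_norm (f x1); have := ler_norm (- f x2); rewrite normrN.
have := normr_ge0 (f x1); have := normr_ge0 (f x2).
by move=> *; rewrite ler_norml; apply/andP; split; lra.
Qed.

Lemma int_primitive (f F : R -> R) x y : continuous f -> (forall t, der F t (f t)) ->
  x <= y -> \int[@lebesgue_measure R]_(t in `[x, y]) f t = F y - F x.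
Proof.
move=> cf dF; rewrite le_eqVlt => /orP[/eqP<-|xy].
  by rewrite subrr set_itv1 Rintegral_set1.
rewrite /Rintegral (@continuous_FTC2 _ f F)//.
- exact: continuous_subspaceT.
- split.
  + by move=> t _; exact: (@ex_derive _ _ _ _ _ _ _ (dF t)).
  + by apply: cvg_at_right_filter; exact: der_cont (dF x).
  + by apply: cvg_at_left_filter; exact: der_cont (dF y).
- by move=> t _; rewrite derive1E; exact: (@derive_val _ _ _ _ _ _ _ (dF t)).
Qed.

End Clamp.

Section Bridge.
Variable R : realType.
Implicit Types (p f g : R -> R) (y : nat -> R -> R) (c d x : R).

Lemma der_derive1 f x l : der f x l -> derivable f x 1 /\ derive1 f x = l.
Proof.
move=> h; split; first exact: (@ex_derive _ _ _ _ _ _ _ h).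
by rewrite derive1E; exact: (@derive_val _ _ _ _ _ _ _ h).
Qed.

Lemma derive1_der f x : derivable f x 1 -> der f x (derive1 f x).
Proof. by move=> h; rewrite derive1E; exact: derivableP. Qed.

Lemma derive1n_sol p y f c d : sol p y -> (forall x, c < x < d -> f x = y 0%N x) ->
  forall k, (k < 4)%N -> forall x, c < x < d -> derive1n k f x = y k x.
Proof.
move=> [y1 y2] fy; elim=> [_|k IH k4] x xI; first exact: fy.
rewrite derive1nS.
have h : der (y k) x (y k.+1 x) by apply: y1.
have := der_congr xI (fun t tI => esym (IH (ltnW k4) t tI)) h.
by move=> /der_derive1[].
Qed.

Lemma derivable1n_sol p y f c d : sol p y -> (forall x, c < x < d -> f x = y 0%N x) ->
  forall k, (k < 4)%N -> forall x, c < x < d -> derivable (derive1n k f) x 1.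
Proof.
move=> sy fy k k4 x xI.
have e := fun t tI => esym (derive1n_sol sy fy k4 (x := t) tI).
have [l h] : exists l, der (y k) x l.
  case: sy => y1 y2; have [k3|k3] := boolP (k < 3)%N; first by exists (y k.+1 x); exact: y1.
  have -> : k = 3%N by lia.
  by exists (p x * y 0%N x); exact: y2.
by have /der_derive1[] := der_congr xI e h.
Qed.

Lemma derive1n4_sol p y f c d : sol p y -> (forall x, c < x < d -> f x = y 0%N x) ->
  forall x, c < x < d -> derive1n 4 f x = p x * f x.
Proof.
move=> sy fy x xI; rewrite derive1nS fy//.
have e := fun t tI => esym (derive1n_sol sy fy (isT : (3 < 4)%N) (x := t) tI).
by case: (sy) => _ y2; have /der_derive1[] := der_congr xI e (y2 x).
Qed.

Lemma rtrace_sol p y f c d k : c < d -> sol p y -> (forall x, c < x < d -> f x = y 0%N x) ->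
  (k < 4)%N -> rtrace f k c = y k c.
Proof.
move=> cd sy fy k4; rewrite /rtrace; apply: cvg_lim => //.
have h : y k t @[t --> c^'+] --> y k c.
  by apply: cvg_at_right_filter; exact: sol_cont sy k4 c.
apply: cvg_trans h; apply: near_eq_cvg; near=> t.
apply: esym; apply: (derive1n_sol sy fy) => //; apply/andP; split.
- by near: t; exact: nbhs_right_gt.
- by near: t; exact: nbhs_right_lt.
Unshelve. all: by end_near. Qed.

Lemma ltrace_sol p y f c d k : c < d -> sol p y -> (forall x, c < x < d -> f x = y 0%N x) ->
  (k < 4)%N -> ltrace f k d = y k d.
Proof.
move=> cd sy fy k4; rewrite /ltrace; apply: cvg_lim => //.
have h : y k t @[t --> d^'-] --> y k d.
  by apply: cvg_at_left_filter; exact: sol_cont sy k4 d.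
apply: cvg_trans h; apply: near_eq_cvg; near=> t.
apply: esym; apply: (derive1n_sol sy fy) => //; apply/andP; split.
- by near: t; exact: nbhs_left_gt.
- by near: t; exact: nbhs_left_lt.
Unshelve. all: by end_near. Qed.

(** Nothing is known of [f] at the endpoints, so it is compared with the solution that shares its
    jet at the midpoint; Gronwall's estimate with zero data gives equality. *)
Lemma sol_of_classical p f c d : c < d -> bounded_coef p ->
  (forall k x, (k < 3)%N -> c < x < d -> derivable (derive1n k f) x 1) ->
  (forall x, c < x < d -> der (derive1n 3 f) x (p x * f x)) ->
  exists2 y, sol p y & forall x, c < x < d -> f x = y 0%N x.
Proof.
move=> cd gp fd f4; pose m := (c + d) / 2.
have mI : c < m < d by rewrite /m; apply/andP; split; lra.
pose y := comb (fun k => derive1n k f m) p m.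
have sy : sol p y by exact: sol_comb.
exists y => // x xI; apply/eqP; rewrite -subr_eq0 -normr_le0.
have [y1 y2] := sy; have [M pM] := gp.2.
have M0 : 0 <= M by exact: le_trans (pM 0).
have tI t : Num.min m x <= t <= Num.max m x -> c < t < d.
  move: mI xI => /andP[? ?] /andP[? ?] /andP[]; rewrite ge_min le_max.
  by move=> /orP[?|?] /orP[?|?]; apply/andP; split; lra.
have := @gronwall R (fun k x => derive1n k f x - y k x)
  (fun x => p x * f x - p x * y 0%N x) M 0 0 m x M0 (lexx 0) _ _ 0%N isT.
rewrite mulr0 addr0 mul0r; apply.
- move=> t /tI tI'; split.
  + by move=> k k3; apply: derB; [apply: derive1_der; exact: fd|exact: y1].
  + by apply: derB => //; exact: f4.
  + by rewrite -mulrBr normrM addr0 ler_wpM2r.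
- by move=> k k4; rewrite /y comb_init// subrr normr0.
Qed.

(** One-dimensional regularity: the weak fourth derivative agrees almost everywhere with the
    continuous function [p f]. The integral that represents f''' may therefore be taken of [p f],
    and the fundamental theorem of calculus applies at every point. *)
Lemma W24_classical p f g c d : bounded_coef p -> W24 c d f g ->
  {ae @lebesgue_measure R, forall x, `]c, d[%classic x -> g x = p x * f x} ->
  forall x, c < x < d -> der (derive1n 3 f) x (p x * f x).
Proof.
move=> gp [fd [mg _] f3] gae x /andP[cx xd].
(* [f] is known to be continuous only inside the open interval; clamping to a closed subinterval
   around [x] makes the integrand continuous on the whole line. *)
pose x1 := (c + x) / 2; pose x2 := (x + d) / 2.
have [cx1 x1x] : c < x1 /\ x1 < x by rewrite /x1; split; lra.
have [xx2 x2d] : x < x2 /\ x2 < d by rewrite /x2; split; lra.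
have fc t : c < t < d -> {for t, continuous f}.
  move=> tI; apply: differentiable_continuous; apply/derivable1_diffP.
  by apply: (fd 0%N); rewrite ?in_itv.
have x12 : x1 <= x2 by lra.
have cphi : continuous (fun t => p (clamp x1 x2 t) * f (clamp x1 x2 t)).
  move=> t; have /andP[h1 h2] := clamp_in t x12; have cc := @clamp_cont R x1 x2 t.
  apply: cvgM; first by apply: (@continuous_comp _ _ _ (clamp x1 x2) p) => //; exact: gp.1.
  by apply: (@continuous_comp _ _ _ (clamp x1 x2) f) => //; apply: fc; apply/andP; split; lra.
have [F F0 dF] := continuous_primitive x1 cphi.
have key s : x1 <= s <= x2 -> derive1n 3 f s = derive1n 3 f x1 + F s.
  move=> /andP[x1s sx2].
  have := f3 x1 s cx1 x1s (le_lt_trans sx2 x2d).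
  move=> /eqP; rewrite subr_eq addrC => /eqP ->; congr (_ + _).
  have := int_primitive cphi dF x1s; rewrite F0 subr0 => <-.
  rewrite /Rintegral; congr fine; apply: ae_eq_integral => //.
  - apply/measurable_EFinP; apply: measurable_funS mg => //.
    by move=> t /=; rewrite !in_itv/= => /andP[? ?]; apply/andP; split; lra.
  - apply/measurable_EFinP; apply: measurable_funS (continuous_measurable_fun cphi) => //.
  - case: gae => N [mN N0 sub]; exists N; split => // t nt; apply: sub => H; apply: nt.
    rewrite /= in_itv/= => /andP[? ?].
    rewrite clamp_id ?H//=; last by apply/andP; split; lra.
    by rewrite in_itv/=; apply/andP; split; lra.
apply: (@der_congr R (fun t => derive1n 3 f x1 + F t) _ x1 x2).
- by apply/andP; split; lra.
- by move=> t /andP[? ?]; rewrite [RHS]key//; apply/andP; split; lra.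
- apply: der_eq (derD (derC _ _) (dF x)) _; rewrite add0r clamp_id//.
  by apply/andP; split; lra.
Qed.

Lemma sol_of_W24 p f g c d : c < d -> bounded_coef p -> W24 c d f g ->
  {ae @lebesgue_measure R, forall x, `]c, d[%classic x -> g x = p x * f x} ->
  exists2 y, sol p y & forall x, c < x < d -> f x = y 0%N x.
Proof.
move=> cd gp Wf gae; apply: sol_of_classical => //.
- by move=> k x k3 xI; case: Wf => h _ _; apply: h => //; rewrite in_itv.
- exact: W24_classical Wf gae.
Qed.

Lemma W24_of_sol p y f g c d : bounded_coef p -> sol p y ->
  (forall x, c < x < d -> f x = y 0%N x) ->
  (forall x, c < x < d -> g x = p x * y 0%N x) -> W24 c d f g.
Proof.
move=> gp sy fy gy.
have cphi : continuous (fun t => p t * y 0%N t).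
  by move=> t; apply: cvgM; [exact: gp.1|exact: sol_cont sy _ t].
have e : {in `]c, d[%classic, (fun t => p t * y 0%N t) =1 g}.
  by move=> t; rewrite inE/= in_itv/= => tI; rewrite gy.
split.
- move=> k x k3; rewrite in_itv/= => xI; apply: (derivable1n_sol sy fy) => //; exact: ltnW.
- split.
    apply: eq_measurable_fun e _; apply: measurable_funS (continuous_measurable_fun cphi) => //.
  apply: (@eq_integrable _ _ R (@lebesgue_measure R) _ _ (EFin \o (fun t : R => (p t * y 0%N t) ^+ 2)) (EFin \o (fun x => g x ^+ 2))).
    by [].
    by move=> t tI /=; rewrite -e.
  have hI : (@lebesgue_measure R).-integrable `[c, d] (EFin \o (fun t : R => (p t * y 0%N t) ^+ 2)).
    apply: continuous_compact_integrable; first exact: segment_compact.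
    apply: continuous_subspaceT => t.
    apply: (@continuous_comp _ _ _ (fun t => p t * y 0%N t) (fun u => u ^+ 2)); first exact: cphi.
    exact: exprn_continuous.
  apply: integrableS hI => //.
  by move=> t /=; rewrite !in_itv/= => /andP[? ?]; apply/andP; split; exact: ltW.
- move=> x x' cx xx x'd.
  rewrite (derive1n_sol sy fy)//; last by apply/andP; split; lra.
  rewrite (derive1n_sol sy fy)//; last by apply/andP; split; lra.
  rewrite -(int_primitive cphi (sy.2) xx).
  apply: eq_Rintegral => t; rewrite inE/= in_itv/= => /andP[? ?]; rewrite gy//.
  by apply/andP; split; lra.
Qed.

End Bridge.

(** * From almost everywhere to everywhere *)

Section AlmostEverywhere.
Variable R : realType.
Local Notation mu := (@lebesgue_measure R).

Lemma ae_exists (P : R -> Prop) (D : set R) c d : c < d ->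
  (forall x, c < x < d -> D x) -> {ae mu, forall x, D x -> P x} ->
  exists2 x, c < x < d & P x.
Proof.
move=> cd cD [N [mN N0 sub]]; apply: contrapT => H.
have cN : `]c, d[%classic `<=` N.
  move=> x /=; rewrite in_itv/= => xI; apply: sub => h; apply: H.
  by exists x => //; apply: h; exact: cD.
have e : mu `]c, d[%classic = (d - c)%:E by rewrite lebesgue_measure_itv/= lte_fin cd.
have : (mu `]c, d[%classic <= 0)%E.
  rewrite -N0; apply: le_measure => //; rewrite inE//; exact: measurable_itv.
by rewrite e lee_fin; lra.
Qed.

Lemma ae_mono (P Q : R -> Prop) : (forall x, P x -> Q x) ->
  {ae mu, forall x, P x} -> {ae mu, forall x, Q x}.
Proof.
by move=> PQ [N [mN N0 sub]]; exists N; split => // x nQ; apply: sub => /PQ.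
Qed.

Lemma ae_and (P Q : R -> Prop) : {ae mu, forall x, P x} -> {ae mu, forall x, Q x} ->
  {ae mu, forall x, P x /\ Q x}.
Proof.
move=> p q; apply: negligibleS (negligibleU p q) => x /= /not_andP[?|?]; by [left|right].
Qed.

Lemma ae_forall n (P : 'I_n -> R -> Prop) : (forall i, {ae mu, forall x, P i x}) ->
  {ae mu, forall x, forall i, P i x}.
Proof.
elim: n P => [|n IH] P H.
  by exists set0; split; [exact: measurable0|exact: measure0|move=> x; case => -[]].
apply: ae_mono (ae_and (H ord0) (IH _ (fun i => H (lift ord0 i)))) => x [h0 h] i.
by case: (unliftP ord0 i) => [j ->|->].
Qed.

Lemma continuous_ae0 (f : R -> R) (D : set R) c d : continuous f ->
  (forall x, c < x < d -> D x) -> {ae mu, forall x, D x -> f x = 0} ->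
  forall x, c < x < d -> f x = 0.
Proof.
move=> cf cD f0 x /andP[cx xd]; apply/eqP/negP => /negP fx.
have fx0 : 0 < `|f x| by rewrite normr_gt0.
have /cvgrPdist_lt/(_ _ fx0)[r /= r0 H] := cf x.
pose c' := Num.max c (x - r); pose d' := Num.min d (x + r).
have [] := @ae_exists (fun x => f x = 0) D c' d' _ _ f0.
- by rewrite /c' /d' gt_max !lt_min -andbA; apply/and4P; split; lra.
- move=> t; rewrite /c' /d' gt_max lt_min => /andP[/andP[? ?] /andP[? ?]].
  by apply: cD; apply/andP; split.
- move=> t; rewrite /c' /d' gt_max lt_min => /andP[/andP[? ?] /andP[? ?]] ft.
  suff /(H t) : `|x - t| < r by rewrite /= ft subr0 ltxx.
  by rewrite ltr_norml; apply/andP; split; lra.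
Qed.

(** The whole jet vanishes at the midpoint together with the function, and uniqueness spreads this
    to the line. *)
Lemma sol_eq0 (p : R -> R) (z : nat -> R -> R) c d : bounded_coef p -> sol p z -> c < d ->
  (forall x, c < x < d -> z 0%N x = 0) -> forall k x, (k < 4)%N -> z k x = 0.
Proof.
move=> gp sz cd z0 k x k4; pose m := (c + d) / 2.
have mI : c < m < d by rewrite /m; apply/andP; split; lra.
apply: (@sol_unique R p z (fun _ _ => 0) m) => //; [exact: gp.2|exact: sol0|].
move=> i i4.
rewrite -(@derive1n_sol R p (fun _ _ => 0) (z 0%N) c d (sol0 p) z0 i i4 m mI).
by rewrite (@derive1n_sol R p z (z 0%N) c d).
Qed.

End AlmostEverywhere.

(** * Dimension modulo null sets, real and complex *)

Section Dimension.
Variables (R : realType).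
Local Notation mu := (@lebesgue_measure R).

(** Expanding each basis in the other gives matrices with [MA *m MB = 1%:M], which forces the
    inequality. Only finitely many almost everywhere identities are combined, so the exceptional
    sets stay null. *)
Lemma has_dim_le (K : fieldType) (D : set R) (V : set (R -> K)) m n :
  has_dim D V m -> has_dim D V n -> (m <= n)%N.
Proof.
move=> [e [Ve ie se]] [e' [Ve' ie' se']].
have [A AP] := choice (fun i => se' _ (Ve i)).
have [B BP] := choice (fun j => se _ (Ve' j)).
pose MA := \matrix_(i < m, j < n) A i j; pose MB := \matrix_(i < n, j < m) B i j.
have AB : MA *m MB = 1%:M.
  apply/matrixP => i k; rewrite !mxE.
  pose c k := (\sum_j A i j * B j k) - (i == k)%:R.
  suff c0 : forall k, c k = 0.
    have /eqP := c0 k; rewrite subr_eq0 => /eqP <-.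
    by apply: eq_bigr => j _; rewrite !mxE.
  apply: ie.
  have AB : {ae mu, forall x j, D x -> e' j x = \sum_i B j i * e i x}.
    by apply: ae_mono (ae_forall BP) => x h j Dx; exact: h.
  apply: ae_mono (ae_and (AP i) AB) => x [h1 h2] Dx.
  rewrite (eq_bigr (fun k => \sum_j A i j * (B j k * e k x) - (i == k)%:R * e k x)); last first.
    move=> l _; rewrite mulrBl mulr_suml; congr (_ - _).
    by apply: eq_bigr => j _; rewrite mulrA.
  rewrite sumrB exchange_big /=.
  rewrite (bigD1 i)//= eqxx mul1r [X in _ - (_ + X)]big1 ?addr0; last first.
    by move=> l; rewrite eq_sym => /negbTE ->; rewrite mul0r.
  apply/eqP; rewrite subr_eq0 h1//; apply/eqP/eq_bigr => j _.
  by rewrite -mulr_sumr h2.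
by have := mulmx1_min AB.
Qed.

Lemma has_dim_unique (K : fieldType) (D : set R) (V : set (R -> K)) m n :
  has_dim D V m -> has_dim D V n -> m = n.
Proof. by move=> h1 h2; apply/eqP; rewrite eqn_leq !(@has_dim_le K D V). Qed.

Lemma Re_sum n (F : 'I_n -> R[i]) : complex.Re (\sum_i F i) = \sum_i complex.Re (F i).
Proof. by apply: (@big_morph _ _ (@complex.Re R) 0 +%R 0 +%R) => // [[a b] [c d]]. Qed.

Lemma Im_sum n (F : 'I_n -> R[i]) : complex.Im (\sum_i F i) = \sum_i complex.Im (F i).
Proof. by apply: (@big_morph _ _ (@complex.Im R) 0 +%R 0 +%R) => // [[a b] [c d]]. Qed.

Lemma Re_mulr (z : R[i]) (x : R) : complex.Re (z * (x%:C)%C) = complex.Re z * x.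
Proof. by case: z => u w /=; rewrite mulr0 subr0. Qed.

Lemma Im_mulr (z : R[i]) (x : R) : complex.Im (z * (x%:C)%C) = complex.Im z * x.
Proof. by case: z => u w /=; rewrite mulr0 add0r. Qed.

Lemma complex_eq (z w : R[i]) : complex.Re z = complex.Re w -> complex.Im z = complex.Im w -> z = w.
Proof. by case: z w => a b [c d] /= -> ->. Qed.

(** A real basis remains a basis over the complex numbers, since real and imaginary parts of the
    coefficients separate. The zero function has to be in [V] as the imaginary part of the real
    basis vectors. *)
Lemma has_dim_complexify (D : set R) (V : set (R -> R)) n :
  V (fun=> 0) -> has_dim D V n ->
  has_dim D [set f : R -> R[i] | V (fun x => complex.Re (f x)) /\ V (fun x => complex.Im (f x))] n.
Proof.
move=> V0 [e [Ve ie se]]; exists (fun i x => ((e i x)%:C)%C); split.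
- by move=> i; split => /=; [exact: Ve|exact: V0].
- move=> c h i; apply: complex_eq => /=.
  + apply: (ie (fun i => complex.Re (c i))); apply: ae_mono h => x H Dx.
    have := congr1 (@complex.Re R) (H Dx); rewrite Re_sum /= => h0; rewrite -[RHS]h0.
    by apply: eq_bigr => j _; rewrite Re_mulr.
  + apply: (ie (fun i => complex.Im (c i))); apply: ae_mono h => x H Dx.
    have := congr1 (@complex.Im R) (H Dx); rewrite Im_sum /= => h0; rewrite -[RHS]h0.
    by apply: eq_bigr => j _; rewrite Im_mulr.
- move=> f [/se[c1 h1] /se[c2 h2]]; exists (fun i => (c1 i +i* c2 i)%C).
  apply: ae_mono (ae_and h1 h2) => x [H1 H2] Dx; apply: complex_eq.
  + by rewrite Re_sum H1//; apply: eq_bigr => j _; rewrite Re_mulr.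
  + by rewrite Im_sum H2//; apply: eq_bigr => j _; rewrite Im_mulr.
Qed.

End Dimension.

(** * Test functions as coefficients *)

Section TestFunctions.
Variable R : realType.
Implicit Types f : R -> R.

(** Beyond the interval this is the support condition; at the endpoints -1 and 1 it follows from
    continuity. *)
Lemma test_out f x : test_function f -> 1 <= `|x| -> f x = 0.
Proof.
move=> [fd fs].
have cf : continuous f.
  by move=> t; apply: differentiable_continuous; apply/derivable1_diffP; exact: (fd 0%N t).
have out t : 1 < `|t| -> f t = 0.
  move=> t1; apply/eqP; apply: contraT => ft.
  have : `[-1, 1]%classic t by apply: fs; apply: subset_closure.
  by rewrite /= in_itv/= => h; move: t1; rewrite ltNge ler_norml h.
rewrite le_eqVlt => /orP[/eqP x1|]; last exact: out.
apply/eqP/negP => /negP fx.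
have fx0 : 0 < `|f x| by rewrite normr_gt0.
have /cvgrPdist_lt/(_ _ fx0)[r /= r0 H] := cf x.
have [t xt t1] : exists2 t, `|x - t| < r & 1 < `|t|.
  have [x0|x0] := leP 0 x.
  - have -> : x = 1 by move: x1; rewrite ger0_norm.
    exists (1 + r / 2); last by rewrite ger0_norm; lra.
    by rewrite opprD addrA subrr add0r normrN ger0_norm; lra.
  - have -> : x = -1 by move: x1; rewrite ltr0_norm//; lra.
    exists (-1 - r / 2); last by rewrite ler0_norm; lra.
    by rewrite opprD addrA subrr add0r opprK ger0_norm; lra.
by have := H t xt; rewrite /= (out t)// subr0 ltxx.
Qed.

Lemma test_cont f : test_function f -> continuous f.
Proof.
move=> [fd _] x; apply: differentiable_continuous; apply/derivable1_diffP.
exact: (fd 0%N x).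
Qed.

Lemma test_clamp f x : test_function f -> f x = f (clamp (-1) 1 x).
Proof.
move=> tf; have [/andP[h1 h2]|h] := boolP (-1 <= x <= 1).
  by rewrite clamp_id// h1.
have x1 : 1 <= `|x| by move: h; rewrite -ler_norml -ltNge => /ltW.
rewrite (test_out tf x1); apply/esym/(test_out tf).
rewrite /clamp; have [xle|xgt] := leP x 1.
- have xm : x <= -1 by rewrite leNgt; apply/negP => xm; move: h; rewrite xle (ltW xm).
  by rewrite max_l// normrN1.
- by rewrite max_r ?normr1//; lra.
Qed.

Lemma test_bounded f : test_function f -> exists C, forall x, `|f x| <= C.
Proof.
move=> tf; have m1 : -1 <= 1 :> R by lra.
have [_ [C HC]] := @continuous_clamp R f (-1) 1 m1 (continuous_subspaceT (test_cont tf)).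
by exists C => x; rewrite (test_clamp x tf); exact: HC.
Qed.

(** The derivative is bounded on [-1, 1] by compactness and vanishes outside. *)
Lemma test_lipschitz f : test_function f ->
  exists2 C, 0 <= C & forall x y, `|f x - f y| <= C * `|x - y|.
Proof.
move=> tf; have m1 : -1 <= 1 :> R by lra.
have cf' : continuous (derive1 f).
  move=> t; apply: differentiable_continuous; apply/derivable1_diffP.
  by case: tf => fd _; exact: (fd 1%N t).
have [_ [C HC]] := @continuous_clamp R (derive1 f) (-1) 1 m1 (continuous_subspaceT cf').
exists C; first exact: le_trans (HC 0).
have fd x : der f x (derive1 f x) by apply: derive1_der; case: tf => h _; exact: (h 0%N x).
have fC t : `|derive1 f t| <= C.
  have C0 : 0 <= C by exact: le_trans (HC 0).
  have d0 c d : c < t < d -> (forall s, c < s < d -> 1 <= `|s|) -> `|derive1 f t| <= C.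
    move=> tI h; have e s : c < s < d -> 0 = f s by move=> sI; rewrite (test_out tf (h s sI)).
    by have [_ ->] := der_derive1 (der_congr tI e (derC 0 t)); rewrite normr0.
  have [t1|t1] := leP t (-1); last first.
    have [t2|t2] := leP t 1; last first.
      apply: (d0 1 (t + 1)); first by apply/andP; split; lra.
      by move=> s /andP[s1 _]; rewrite ger0_norm; lra.
    have tI : -1 <= t <= 1 by rewrite t2 ltW.
    by rewrite -(clamp_id tI).
  move: t1; rewrite le_eqVlt => /orP[/eqP tm|t1].
    have tI : -1 <= t <= 1 by rewrite tm; apply/andP; split; lra.
    by rewrite -(clamp_id tI).
  apply: (d0 (t - 1) (-1)); first by apply/andP; split; lra.
  by move=> s /andP[_ s1]; rewrite ler0_norm; lra.
move=> x y; apply: (@mean_value_ineq R f (derive1 f) C (Num.min x y) (Num.max x y)).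
- by move=> t _; exact: fd.
- by move=> t _; exact: fC.
- by rewrite ge_min le_max lexx.
- by rewrite ge_min le_max lexx !orbT.
Qed.

Lemma bounded_coefD (p q : R -> R) : bounded_coef p -> bounded_coef q ->
  bounded_coef (fun x => p x + q x).
Proof.
move=> [cp [M pM]] [cq [N qN]]; split; first by move=> x; apply: cvgD; [exact: cp|exact: cq].
by exists (M + N) => x; apply: le_trans (ler_normD _ _) _; rewrite lerD.
Qed.

Lemma bounded_coefZ (c : R) (p : R -> R) : bounded_coef p -> bounded_coef (fun x => c * p x).
Proof.
move=> [cp [M pM]]; split; first by move=> x; apply: cvgM; [exact: cvg_cst|exact: cp].
by exists (`|c| * M) => x; rewrite normrM ler_wpM2l.
Qed.

Lemma bounded_coef_cst (c : R) : bounded_coef (fun _ : R => c).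
Proof. by split; [move=> x; exact: cvg_cst|exists `|c|]. Qed.

Lemma bounded_coef_scale (c : R) (p : R -> R) : bounded_coef p -> bounded_coef (fun x => p (c * x)).
Proof.
move=> [cp [M pM]]; split; last by exists M => x.
move=> x; apply: (@continuous_comp _ _ _ (fun x => c * x) p); last exact: cp.
by apply: cvgM; [exact: cvg_cst|exact: cvg_id].
Qed.

Lemma test_bounded_coef f : test_function f -> bounded_coef f.
Proof. by move=> tf; split; [exact: test_cont|exact: test_bounded]. Qed.

End TestFunctions.

(** * Eigenfunctions as solutions *)

Section Spectrum.
Variables (R : realType) (a b : R) (U : R -> R).
Hypotheses (a_lt0 : a < 0) (b_gt0 : 0 < b) (U_smooth : smooth_on a b U).
Local Notation mu_L := (@lebesgue_measure R).

Let ab : a < b. Proof. exact: lt_trans b_gt0. Qed.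

Definition outer (mu x : R) : R := mu - U (clamp a b x).

Lemma outer_coef mu : bounded_coef (outer mu).
Proof.
have [D [DU Dc]] := U_smooth; have [cD _] := Dc 0%N.
apply: bounded_coefD; first exact: bounded_coef_cst.
have -> : (fun x => - U (clamp a b x)) = (fun x => (-1) * D 0%N (clamp a b x)).
  by apply/funext => x; rewrite mulN1r DU// in_itv/= clamp_in// ltW.
by apply: bounded_coefZ; apply: continuous_clamp => //; exact: ltW.
Qed.

Lemma outer_in mu x : a < x < b -> outer mu x = mu - U x.
Proof. by move=> /andP[ax xb]; rewrite /outer clamp_id// !ltW. Qed.

Definition eigfun p (y : nat -> R -> R) : Prop :=
  [/\ sol p y, y 0%N a = 0, y 1%N a = 0, y 0%N b = 0 & y 1%N b = 0].

Definition real_eig p : set (R -> R) :=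
  [set f | exists2 y, eigfun p y & forall x, a < x < b -> f x = y 0%N x].

(** One solution near each end is allowed, so that the lemma also serves the limit operator, whose
    functions consist of two pieces. *)
Lemma clamped_sol p q f y z : sol p y -> sol q z ->
  forall c d, a < c -> d < b ->
  (forall x, a < x < c -> f x = y 0%N x) -> (forall x, d < x < b -> f x = z 0%N x) ->
  clamped a b f <-> [/\ y 0%N a = 0, y 1%N a = 0, z 0%N b = 0 & z 1%N b = 0].
Proof.
move=> sy sz c d ac db fy fz; rewrite /clamped.
by rewrite !(rtrace_sol ac sy fy)// !(ltrace_sol db sz fz).
Qed.

Lemma eigfunZ p c y : eigfun p y -> eigfun p (fun k x => c * y k x).
Proof. by move=> [s h1 h2 h3 h4]; split; rewrite ?h1 ?h2 ?h3 ?h4 ?mulr0//; exact: solZ. Qed.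

Lemma eigfun_sum p n (c : 'I_n -> R) (y : 'I_n -> nat -> R -> R) :
  (forall i, eigfun p (y i)) -> eigfun p (fun k x => \sum_i c i * y i k x).
Proof.
move=> H; split; first by apply: sol_sum => i; case: (H i).
all: by apply: big1 => i _; case: (H i) => _ h1 h2 h3 h4; rewrite ?h1 ?h2 ?h3 ?h4 mulr0.
Qed.

(** Solutions are continuous and determined by their values on any interval. Almost everywhere
    relations between eigenfunctions are therefore relations between jets, and the dimension can be
    computed there. *)
Lemma eig_dim p n (e : 'I_n -> nat -> R -> R) : bounded_coef p ->
  (forall i, eigfun p (e i)) ->
  (forall c : 'I_n -> R, (forall k x, (k < 4)%N -> \sum_i c i * e i k x = 0) -> forall i, c i = 0) ->
  (forall y, eigfun p y -> exists c : 'I_n -> R, forall x, y 0%N x = \sum_i c i * e i 0%N x) ->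
  has_dim `]a, b[%classic (real_eig p) n.
Proof.
move=> gp eE ie se; exists (fun i => e i 0%N); split.
- by move=> i; exists (e i).
- move=> c h; apply: ie.
  have [s _ _ _ _] := eigfun_sum c eE.
  apply: (sol_eq0 gp s ab) => x xI.
  apply: (@continuous_ae0 R _ `]a, b[%classic a b _ _ h) => //; first exact: sol_cont s _.
- move=> f [y ey fy]; have [c cP] := se y ey; exists c.
  by apply: aeW => x; rewrite /= in_itv/= => xI; rewrite fy.
Qed.

Lemma eig_dim0 p : bounded_coef p ->
  (forall y, eigfun p y -> forall x, y 0%N x = 0) -> has_dim `]a, b[%classic (real_eig p) 0.
Proof.
move=> gp H; apply: (@eig_dim p 0 (fun _ _ _ => 0)) => //; [by case|by move=> c _ []|].
by move=> y ey; exists (fun=> 0) => x; rewrite big_ord0 H.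
Qed.

Lemma eig_dim1 p y0 : bounded_coef p -> eigfun p y0 -> ~ (forall k x, (k < 4)%N -> y0 k x = 0) ->
  (forall y, eigfun p y -> exists c, forall x, y 0%N x = c * y0 0%N x) ->
  has_dim `]a, b[%classic (real_eig p) 1.
Proof.
move=> gp e0 n0 H; apply: (@eig_dim p 1 (fun=> y0)) => //.
- move=> c h i; rewrite (ord1 i); apply/eqP; apply: contraT => c0; case: n0 => k x k4.
  have := h k x k4; rewrite big_ord_recl big_ord0 addr0 => /eqP.
  by rewrite mulf_eq0 (negbTE c0) => /eqP.
- move=> y ey; have [c cP] := H y ey; exists (fun=> c) => x.
  by rewrite big_ord_recl big_ord0 addr0.
Qed.

Lemma fund_clamped p y : bounded_coef p -> sol p y -> y 0%N a = 0 -> y 1%N a = 0 ->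
  forall k x, (k < 4)%N -> y k x = y 2%N a * fund p a 2 k x + y 3%N a * fund p a 3 k x.
Proof.
move=> gp sy y0 y1 k x k4; rewrite (sol_expand a gp sy)// /comb.
by rewrite !big_ord_recl big_ord0 /= y0 y1 !mul0r !add0r addr0.
Qed.

Lemma eig_dim2 p : bounded_coef p -> eigfun p (fund p a 2) -> eigfun p (fund p a 3) ->
  has_dim `]a, b[%classic (real_eig p) 2.
Proof.
move=> gp e2 e3.
apply: (@eig_dim p 2 (fun i => fund p a (2 + i))) => //.
- by move=> i; case: i => [[|[|]]].
- move=> c h i; have [_ f2] := fundP a 2 gp; have [_ f3] := fundP a 3 gp.
  have := h 2%N a isT; have := h 3%N a isT.
  rewrite !big_ord_recl !big_ord0 /= !addr0 !f2// !f3//= !mulr0 !mulr1 addr0 add0r => h1 h0.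
  by case: i => [[|[|]]]// il; [rewrite -[RHS]h0|rewrite -[RHS]h1]; congr (c _); exact: val_inj.
- move=> y [sy y0 y1 _ _]; exists (fun i => y (2 + i)%N a) => x.
  by rewrite (fund_clamped gp sy)// !big_ord_recl big_ord0 addr0.
Qed.

Section Perturbed.
Variables (alpha beta gamma1 gamma2 : R) (Psi Phi Ups1 Ups2 : R -> R).
Hypotheses (Psi_test : test_function Psi) (Phi_test : test_function Phi)
  (Ups1_test : test_function Ups1) (Ups2_test : test_function Ups2).

Let Seps eps := S_eps a b U alpha beta gamma1 gamma2 Psi Phi Ups1 Ups2 eps.
Let Pe := Psi_eps alpha beta gamma1 gamma2 Psi Phi Ups1 Ups2.

Definition full (eps mu x : R) : R :=
  outer mu x - Psi_eps alpha beta gamma1 gamma2 Psi Phi Ups1 Ups2 eps x.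

(** The coefficient after the scaling x = eps xi, multiplied out so that no negative power of eps
    remains; hence it makes sense at eps = 0, where it is - alpha Psi. *)
Definition inner (eps mu x : R) : R :=
  eps ^+ 4 * outer mu (eps * x)
  - (alpha * Psi x + eps * beta * Phi x + eps ^+ 2 * gamma1 * Ups1 x + eps ^+ 3 * gamma2 * Ups2 x).

Lemma Psi_eps_coef eps : bounded_coef (Pe eps).
Proof.
rewrite /Pe /Psi_eps.
have h f : test_function f -> bounded_coef (fun x => f (x / eps)).
  move=> tf; have -> : (fun x => f (x / eps)) = (fun x => f (eps^-1 * x)).
    by apply/funext => x; rewrite mulrC.
  by apply: bounded_coef_scale; exact: test_bounded_coef.
by apply: bounded_coefD; [apply: bounded_coefD; [apply: bounded_coefD|]|];
  apply: bounded_coefZ; exact: h.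
Qed.

Lemma full_coef eps mu : bounded_coef (full eps mu).
Proof.
apply: bounded_coefD; first exact: outer_coef.
have -> : (fun x => - Psi_eps alpha beta gamma1 gamma2 Psi Phi Ups1 Ups2 eps x)
    = (fun x => (-1) * Pe eps x) by apply/funext => x; rewrite mulN1r.
by apply: bounded_coefZ; exact: Psi_eps_coef.
Qed.

Lemma inner_coef eps mu : bounded_coef (inner eps mu).
Proof.
apply: bounded_coefD.
  by apply: bounded_coefZ; apply: bounded_coef_scale; exact: outer_coef.
rewrite (_ : (fun x => - _) = (fun x => (-1) * (alpha * Psi x + eps * beta * Phi x
   + eps ^+ 2 * gamma1 * Ups1 x + eps ^+ 3 * gamma2 * Ups2 x))); last first.
  by apply/funext => x; rewrite mulN1r.
apply: bounded_coefZ.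
by apply: bounded_coefD; [apply: bounded_coefD; [apply: bounded_coefD|]|];
  apply: bounded_coefZ; exact: test_bounded_coef.
Qed.

Lemma inner_full eps mu x : eps != 0 -> inner eps mu x = eps ^+ 4 * full eps mu (eps * x).
Proof.
by move=> e0; rewrite /inner /full /Psi_eps [eps * x / eps]mulrC mulKf//; field.
Qed.

Lemma full_outer eps mu x : 0 < eps -> eps <= `|x| -> full eps mu x = outer mu x.
Proof.
move=> e0 ex; rewrite /full /Psi_eps.
have x1 : 1 <= `|x / eps| by rewrite normrM normfV [`|eps|]gtr0_norm// ler_pdivlMr// mul1r.
by rewrite (test_out Psi_test x1) (test_out Phi_test x1) (test_out Ups1_test x1)
  (test_out Ups2_test x1) !mulr0 !addr0 subr0.
Qed.

Lemma S_eps_real_eig eps mu f :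
  Seps eps f (fun x => mu * f x) <-> real_eig (full eps mu) f.
Proof.
have gp := full_coef eps mu.
split.
- move=> [g [Wf cf hg]].
  have [|y sy fy] := sol_of_W24 ab gp Wf.
    apply: ae_mono hg => x H xI; have := H xI; rewrite /full outer_in.
      by rewrite !mulrBl => ->; ring.
    by move: xI; rewrite /= in_itv.
  exists y => //; have := (clamped_sol sy sy ab ab fy fy).1 cf.
  by case=> *; split.
- move=> [y [sy y1 y2 y3 y4] fy].
  exists (fun x => full eps mu x * f x); split.
  + by apply: (W24_of_sol gp sy fy) => x xI; rewrite fy.
  + by apply/(clamped_sol sy sy ab ab fy fy).
  + by apply: aeW => x; rewrite /= in_itv/= => xI; rewrite /full outer_in//; ring.
Qed.

Lemma eps_eigenspaceE eps mu : op_eigenspace (Seps eps) mu =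
  [set f : R -> R[i] | real_eig (full eps mu) (fun x => complex.Re (f x)) /\
                       real_eig (full eps mu) (fun x => complex.Im (f x))].
Proof. by apply/seteqP; split=> f [/S_eps_real_eig h1 /S_eps_real_eig h2]. Qed.

Lemma eps_has_dim eps mu n : has_dim `]a, b[%classic (real_eig (full eps mu)) n ->
  has_dim `]a, b[%classic (op_eigenspace (Seps eps) mu) n.
Proof.
rewrite eps_eigenspaceE; apply: has_dim_complexify.
exists (fun _ _ => 0) => //; split => //; exact: sol0.
Qed.

End Perturbed.
End Spectrum.

(** * Inner problem and limit operator in terms of solutions *)

Section Limit.
Variables (R : realType) (a b : R) (U : R -> R).
Hypotheses (a_lt0 : a < 0) (b_gt0 : 0 < b) (U_smooth : smooth_on a b U).
Variables (alpha beta : R) (Psi Phi : R -> R).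
Hypotheses (Psi_test : test_function Psi) (Phi_test : test_function Phi).

Let coef0 (x : R) : R := - (alpha * Psi x).

Lemma inner_solutionsP w : inner_solutions Psi alpha w <->
  exists y, [/\ sol coef0 y, forall x, -1 < x < 1 -> w x = y 0%N x,
    y 2%N (-1) = 0 /\ y 3%N (-1) = 0 & y 2%N 1 = 0 /\ y 3%N 1 = 0].
Proof.
have gp : bounded_coef coef0.
  rewrite /coef0 (_ : (fun x => _) = (fun x => (- alpha) * Psi x)).
    by apply: bounded_coefZ; exact: test_bounded_coef.
  by apply/funext => x; rewrite mulNr.
have m1 : -1 < 1 :> R by lra.
split.
- move=> [wd w4 tl tr].
  have [||y sy wy] := @sol_of_classical R coef0 w (-1) 1 m1 gp.
  + by move=> k x k3 xI; apply: wd; [exact: ltnW|rewrite in_itv].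
  + move=> x xI; have := derive1_der (wd 3%N x isT _); rewrite in_itv/= => /(_ xI) h.
    have xI' : x \in `]-1, 1[ by rewrite in_itv.
    apply: der_eq h _; have := w4 x xI'; rewrite derive1nS /coef0 mulNr => /eqP.
    by rewrite addr_eq0 => /eqP.
  exists y; split => //.
  + by move: tl; rewrite !(rtrace_sol m1 sy wy).
  + by move: tr; rewrite !(ltrace_sol m1 sy wy).
- move=> [y [sy wy tl tr]]; split.
  + by move=> k x k4; rewrite in_itv/= => xI; exact: (derivable1n_sol sy wy).
  + move=> x xI'; have xI : -1 < x < 1 by move: xI'; rewrite in_itv.
    by rewrite (derive1n4_sol sy wy)// /coef0 mulNr addNr.
  + by rewrite !(rtrace_sol m1 sy wy).
  + by rewrite !(ltrace_sol m1 sy wy).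
Qed.

(** The interface conditions as a relation between two jets, [l] at -0 and [r] at +0, free of
    traces; it is the set to which the pairs of inner jets converge. *)
Definition interface (l r : nat -> R) : Prop :=
  (~ resonant_set Psi alpha ->
     [/\ l 0%N = 0, r 0%N = 0, l 1%N = 0 & r 1%N = 0]) /\
  (resonant_set Psi alpha ->
     [/\ l 0%N = 0, r 0%N = 0, r 1%N - theta Psi alpha * l 1%N = 0 &
         theta Psi alpha * r 2%N - l 2%N - beta * kappa Psi Phi alpha * l 1%N = 0]).

Definition limit_eig mu (yL yR : nat -> R -> R) : Prop :=
  [/\ sol (outer a b U mu) yL, sol (outer a b U mu) yR,
      [/\ yL 0%N a = 0, yL 1%N a = 0, yR 0%N b = 0 & yR 1%N b = 0] &
      interface (yL ^~ 0) (yR ^~ 0)].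

Lemma S_limit_eig mu f :
  S_limit a b U alpha beta Psi Phi f (fun x => mu * f x) <->
  exists yL yR, [/\ limit_eig mu yL yR, forall x, a < x < 0 -> f x = yL 0%N x &
    forall x, 0 < x < b -> f x = yR 0%N x].
Proof.
have ab : a < b by exact: lt_trans b_gt0.
have gp := outer_coef a_lt0 b_gt0 U_smooth mu.
split.
- move=> [g [[WL WR] cf ic hg]].
  have [|yL sL fL] := sol_of_W24 a_lt0 gp WL.
    apply: ae_mono hg => x H /=; rewrite in_itv/= => /andP[x1 x2].
    have xI : a < x < b by rewrite x1 (lt_trans x2).
    by have := H _; rewrite /= in_itv/= outer_in// => /(_ xI); rewrite mulrBl => ->; ring.
  have [|yR sR fR] := sol_of_W24 b_gt0 gp WR.
    apply: ae_mono hg => x H /=; rewrite in_itv/= => /andP[x1 x2].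
    have xI : a < x < b by rewrite x2 (lt_trans _ x1).
    by have := H _; rewrite /= in_itv/= outer_in// => /(_ xI); rewrite mulrBl => ->; ring.
  exists yL, yR; split => //; split => //.
    exact: ((clamped_sol sL sR a_lt0 b_gt0 fL fR).1 cf).
  by move: ic; rewrite /interface_conditions !(rtrace_sol b_gt0 sR fR)// !(ltrace_sol a_lt0 sL fL).
- move=> [yL [yR [[sL sR bc ic] fL fR]]].
  exists (fun x => outer a b U mu x * f x); split.
  + split; first by apply: (W24_of_sol gp sL fL) => x xI; rewrite fL.
    by apply: (W24_of_sol gp sR fR) => x xI; rewrite fR.
  + by apply/(clamped_sol sL sR a_lt0 b_gt0 fL fR).
  + by rewrite /interface_conditions !(rtrace_sol b_gt0 sR fR)// !(ltrace_sol a_lt0 sL fL).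
  + by apply: aeW => x; rewrite /= in_itv/= => xI; rewrite outer_in//; ring.
Qed.

End Limit.

(** * Local eigenvalue branches *)

Section Integral.
Variables (R : realType) (a b : R).
Hypothesis ab : a < b.

Definition Int (f : R -> R) : R := prim f a b.

(** This is the mean value inequality for [F] minus a primitive of [f]. The error [eta] is what
    later allows integrals at varying parameters to be compared with one fixed Gram matrix. *)
Lemma Int_approx (f F F' : R -> R) eta : continuous f ->
  (forall x, a <= x <= b -> der F x (F' x)) ->
  (forall x, a <= x <= b -> `|F' x - f x| <= eta) ->
  `|F b - F a - Int f| <= eta * (b - a).
Proof.
move=> cf dF H; have [p0 pd] := primP a cf.
have aI : a <= a <= b by rewrite lexx ltW.
have bI : a <= b <= b by rewrite lexx ltW.
have := @mean_value_ineq R (fun x => F x - prim f a x) (fun x => F' x - f x) eta a b _ H _ _ bI aI.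
have ba : 0 <= b - a by rewrite subr_ge0 ltW.
rewrite p0 subr0 (ger0_norm ba) /Int => h.
by rewrite (_ : _ - _ - _ = F b - prim f a b - F a); [apply: h => x xI; apply: derB => //; exact: dF|ring].
Qed.

Lemma Int_eq (f F : R -> R) : continuous f ->
  (forall x, a <= x <= b -> der F x (f x)) -> Int f = F b - F a.
Proof.
move=> cf dF; apply/eqP; rewrite eq_sym -subr_eq0 -normr_le0.
have := @Int_approx f F f 0 cf dF; rewrite mul0r; apply=> x _.
by rewrite subrr normr0.
Qed.

Lemma Int_comb2 (f g h : R -> R) u v w : continuous f -> continuous g -> continuous h ->
  Int (fun x => u * f x + v * g x + w * h x) = u * Int f + v * Int g + w * Int h.
Proof.
move=> cf cg ch.
have [f0 df] := primP a cf; have [g0 dg] := primP a cg; have [h0 dh] := primP a ch.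
have cc : continuous (fun x => u * f x + v * g x + w * h x).
  by move=> x; apply: cvgD; [apply: cvgD|]; apply: cvgM; [exact: cvg_cst|exact: cf
    |exact: cvg_cst|exact: cg|exact: cvg_cst|exact: ch].
rewrite (@Int_eq (fun x => u * f x + v * g x + w * h x) (fun x => u * prim f a x + v * prim g a x + w * prim h a x))//.
  by rewrite f0 g0 h0 !mulr0 !addr0 subr0.
by move=> x _; apply: derD; [apply: derD|]; apply: derMl.
Qed.

(** If the integral were zero, the nondecreasing primitive of the square would be constant on the
    interval, so the solution would vanish there and hence everywhere. *)
Lemma Int_sqr_gt0 p z : bounded_coef p -> sol p z ->
  ~ (forall k x, (k < 4)%N -> z k x = 0) -> 0 < Int (fun x => z 0%N x * z 0%N x).
Proof.
move=> gp sz nz.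
have cz : continuous (fun x => z 0%N x * z 0%N x).
  by move=> x; apply: cvgM; exact: sol_cont sz _ x.
have [p0 pd] := primP a cz.
have mono x y : x <= y -> prim (fun x => z 0%N x * z 0%N x) a x <= prim (fun x => z 0%N x * z 0%N x) a y.
  by move=> xy; apply: (der_le xy (fun t _ => pd t)) => t _; rewrite -expr2 sqr_ge0.
rewrite lt0r; apply/andP; split; last by rewrite /Int -[leLHS]p0; apply: mono; exact: ltW.
apply/negP => /eqP I0; apply: nz; apply: (sol_eq0 gp sz ab) => x xI.
have e t : a < t < b -> 0 = prim (fun x => z 0%N x * z 0%N x) a t.
  move=> /andP[/ltW/mono h1 /ltW/mono h2].
  by apply/eqP; rewrite eq_le -{1}p0 h1/= -I0.
have := der_congr xI e (derC 0 x) => /der_derive1[_].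
have [_ ->] := der_derive1 (pd x).
by move=> /eqP; rewrite mulf_eq0 orbb => /eqP.
Qed.

End Integral.

(** * Eigenvalues of symmetric 2 x 2 matrices *)

Section SymmetricMatrices.
Variable R : realType.
Implicit Types x y z : R.

Definition norm2 x y : R := Num.sqrt (x ^+ 2 + y ^+ 2).

Let sq_ge0 x y : 0 <= x ^+ 2 + y ^+ 2.
Proof. by rewrite addr_ge0 ?sqr_ge0. Qed.

Lemma norm2_ge0 x y : 0 <= norm2 x y. Proof. exact: sqrtr_ge0. Qed.

Lemma norm2_sqr x y : norm2 x y ^+ 2 = x ^+ 2 + y ^+ 2.
Proof. by rewrite sqr_sqrtr. Qed.

Lemma norm2_triangle x y x' y' : norm2 (x + x') (y + y') <= norm2 x y + norm2 x' y'.
Proof.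
rewrite -(@ler_pXn2r _ 2)// ?nnegrE ?addr_ge0 ?norm2_ge0// sqrrD !norm2_sqr.
have h : x * x' + y * y' <= norm2 x y * norm2 x' y'.
  apply: le_trans (ler_norm _) _.
  rewrite -(@ler_pXn2r _ 2)// ?nnegrE ?mulr_ge0 ?norm2_ge0// exprMn !norm2_sqr real_normK ?num_real//.
  by rewrite -subr_ge0 [X in 0 <= X](_ : _ = (x * y' - y * x') ^+ 2) ?sqr_ge0//; ring.
by rewrite mulr2n; nra.
Qed.

Lemma norm2_le x y : norm2 x y <= `|x| + `|y|.
Proof.
rewrite -(@ler_pXn2r _ 2)// ?nnegrE ?addr_ge0 ?norm2_ge0// norm2_sqr sqrrD !real_normK ?num_real//.
by rewrite -subr_ge0 [X in 0 <= X](_ : _ = 2 * (`|x| * `|y|)) ?mulr_ge0//; ring.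
Qed.

Lemma norm2_dist x y x' y' : `|norm2 x y - norm2 x' y'| <= norm2 (x - x') (y - y').
Proof.
have h1 := norm2_triangle (x - x') (y - y') x' y'.
have h2 := norm2_triangle (x' - x) (y' - y) x y.
have e : norm2 (x' - x) (y' - y) = norm2 (x - x') (y - y').
  by rewrite /norm2 -[x' - x]opprB -[y' - y]opprB !sqrrN.
rewrite !subrK e in h1 h2; rewrite ler_norml; apply/andP; split; lra.
Qed.

(* The eigenvalues of the symmetric matrix with entries x, y, y, z are
   [eigS 1 x y z] and [eigS (-1) x y z]. *)
Definition eigS (s x y z : R) : R := (x + z + s * norm2 (x - z) (2 * y)) / 2.

Lemma eigS_prod x y z : eigS 1 x y z * eigS (-1) x y z = x * z - y ^+ 2.
Proof.
have := norm2_sqr (x - z) (2 * y); rewrite /eigS; set n := norm2 _ _ => h.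
have -> : (x + z + 1 * n) / 2 * ((x + z + -1 * n) / 2) = ((x + z) ^+ 2 - n ^+ 2) / 4 by field.
by rewrite h; field.
Qed.

Lemma eigS_both x y z : eigS 1 x y z = 0 -> eigS (-1) x y z = 0 -> [/\ x = 0, y = 0 & z = 0].
Proof.
rewrite /eigS; have := norm2_sqr (x - z) (2 * y); set n := norm2 _ _ => h h1 h2.
have n0 : n = 0 by lra.
have xz : x + z = 0 by lra.
rewrite n0 expr0n /= in h.
have s1 := sqr_ge0 (x - z); have s2 := sqr_ge0 (2 * y).
have e1 : (x - z) ^+ 2 = 0 by lra.
have e2 : (2 * y) ^+ 2 = 0 by lra.
by move: e1 e2 => /eqP; rewrite sqrf_eq0 => /eqP ? /eqP; rewrite sqrf_eq0 => /eqP ?; split; lra.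
Qed.

(** The increment is positive definite. It moves the vector (x - z, 2 y) by less than it raises the
    trace, because (dx - dz)^2 + 4 dy^2 < (dx + dz)^2 amounts to dy^2 < dx dz; so the trace plus or
    minus the norm still grows. *)
Lemma eigS_mono s x y z x' y' z' : `|s| = 1 -> x < x' -> z < z' ->
  (y' - y) ^+ 2 < (x' - x) * (z' - z) -> eigS s x y z < eigS s x' y' z'.
Proof.
move=> s1 xx zz yy; rewrite /eigS ltr_pM2r//.
have h := norm2_dist (x' - z') (2 * y') (x - z) (2 * y).
have n_lt : norm2 (x' - z' - (x - z)) (2 * y' - 2 * y) < (x' - x) + (z' - z).
  rewrite -(@ltr_pXn2r _ 2)// ?nnegrE ?norm2_ge0//; last by lra.
  rewrite norm2_sqr -subr_gt0.
  rewrite [X in 0 < X](_ : _ = 4 * ((x' - x) * (z' - z) - (y' - y) ^+ 2)); last by ring.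
  by rewrite mulr_gt0// subr_gt0.
have h' : `|s * (norm2 (x' - z') (2 * y') - norm2 (x - z) (2 * y))| < (x' - x) + (z' - z).
  by rewrite normrM s1 mul1r; exact: le_lt_trans n_lt.
by move: h'; rewrite mulrBr ltr_norml => /andP[]; lra.
Qed.

Lemma eigS_dist s x y z x' y' z' : `|s| = 1 ->
  `|eigS s x y z - eigS s x' y' z'| <= `|x - x'| + `|z - z'| + `|y - y'|.
Proof.
move=> s1.
have h := le_trans (norm2_dist (x - z) (2 * y) (x' - z') (2 * y')) (norm2_le _ _).
have e1 : `|x - z - (x' - z')| <= `|x - x'| + `|z - z'|.
  by rewrite (_ : _ - _ - _ = (x - x') - (z - z')); [exact: ler_normB|ring].
have e2 : `|2 * y - 2 * y'| = 2 * `|y - y'| by rewrite -mulrBr normrM ger0_norm.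
rewrite /eigS -mulrBl normrM [`|2^-1|]ger0_norm ?invr_ge0// ler_pdivrMr//.
rewrite (_ : _ - _ = (x - x') + (z - z') + s * (norm2 (x - z) (2 * y) - norm2 (x' - z') (2 * y'))); last by ring.
apply: le_trans (ler_normD _ _) _; rewrite normrM s1 mul1r.
by have := ler_normD (x - x') (z - z'); lra.
Qed.

End SymmetricMatrices.

Lemma itv_norm_le (R : realType) (a b L x : R) :
  a <= x -> x <= b -> `|a| <= L -> `|b| <= L -> `|x| <= L.
Proof.
move=> ax xb; rewrite !ler_norml => /andP[h3 _] /andP[_ h6].
by rewrite (le_trans h3 ax) (le_trans xb h6).
Qed.

Section Branches.
Variables (R : realType) (a b : R).
Hypotheses (a_lt0 : a < 0) (b_gt0 : 0 < b).
Let ab : a < b. Proof. exact: lt_trans b_gt0. Qed.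

Lemma lip_sub (T : Type) (A B : set T) (rho : T -> T -> R) C h :
  B `<=` A -> lip A rho C h -> lip B rho C h.
Proof.
move=> BA [C0 h1 h2]; split => //; first by move=> t /BA; exact: h1.
by move=> t s /BA tA /BA; exact: h2.
Qed.

Section Robin.
Variable p : R -> R.
Hypothesis gp : bounded_coef p.
Let u k := fund p a 2 k b.
Let w k := fund p a 3 k b.

(** Determinant of the Robin data - y''' + tau y and y'' + tau y' at [b] on the solutions clamped at
    [a]: the data are coordinates on these solutions exactly when it is nonzero. For every tau they
    are compatible with Lagrange's form, in which the tau terms cancel. *)
Definition robin_det tau : R :=
  (- u 3%N + tau * u 0%N) * (w 2%N + tau * w 1%N)
  - (- w 3%N + tau * w 0%N) * (u 2%N + tau * u 1%N).

(* The 2 x 2 minors of the two jets at b satisfy the Pluecker relation; together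
   with the symmetry of the boundary form it forces some Robin determinant
   to be nonzero. *)
Lemma robin_exists : exists tau : R, robin_det tau != 0.
Proof.
apply: contrapT => /forallNP H.
have d tau : robin_det tau = 0 by apply/eqP; have /negP := H tau; rewrite negbK.
have [su u0] := fundP a 2 gp; have [sw w0] := fundP a 3 gp.
have wr : u 3%N * w 0%N - u 2%N * w 1%N + u 1%N * w 2%N - u 0%N * w 3%N = 0.
  have aI : a <= a <= b by rewrite lexx ltW.
  have bI : a <= b <= b by rewrite lexx ltW.
  rewrite -[LHS]/(wron (fund p a 2) (fund p a 3) b).
  rewrite (@der0_cst R _ a b _ b a)//.
    by rewrite /wron !u0// !w0//=; ring.
  by move=> t _; apply: der_eq (der_wron t su sw) _; rewrite subrr mul0r.
have d0 := d 0; have d1 := d 1; have dm := d (-1).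
rewrite /robin_det in d0 d1 dm.
pose m i j := u i * w j - u j * w i.
have m01 : m 0%N 1%N = 0 by rewrite /m; lra.
have m23 : m 2%N 3%N = 0 by rewrite /m; lra.
have m0213 : m 0%N 2%N = - m 1%N 3%N by rewrite /m; lra.
have m0312 : m 0%N 3%N = m 1%N 2%N by rewrite /m; lra.
have pl : m 0%N 1%N * m 2%N 3%N - m 0%N 2%N * m 1%N 3%N + m 0%N 3%N * m 1%N 2%N = 0 by rewrite /m; ring.
have s2 : m 1%N 3%N ^+ 2 + m 1%N 2%N ^+ 2 = 0.
  by move: pl; rewrite m01 m0213 m0312 !expr2 => h; rewrite -[RHS]h; ring.
have h1 := sqr_ge0 (m 1%N 3%N); have h2 := sqr_ge0 (m 1%N 2%N).
have m13 : m 1%N 3%N = 0 by apply/eqP; rewrite -sqrf_eq0; apply/eqP; lra.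
have m12 : m 1%N 2%N = 0 by apply/eqP; rewrite -sqrf_eq0; apply/eqP; lra.
have m02 : m 0%N 2%N = 0 by rewrite m0213 m13 oppr0.
have m03 : m 0%N 3%N = 0 by rewrite m0312.
have mi i j : (i < 4)%N -> (j < 4)%N -> w i * u j - u i * w j = 0.
  rewrite /m in m01 m02 m03 m12 m13 m23.
  by clear - m01 m02 m03 m12 m13 m23; case: i => [|[|[|[|]]]]// _; case: j => [|[|[|[|]]]]// _; lra.
have wi i : (i < 4)%N -> w i = 0.
  move=> i4.
  have s : sol p (fun k x => w i * fund p a 2 k x - u i * fund p a 3 k x).
    by apply: solB; apply: solZ.
  have := @sol_unique R p _ _ b gp.2 s (sol0 p) (fun k k4 => mi i k i4 k4) 2%N a isT.
  by rewrite u0// w0//= mulr1 mulr0 subr0.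
have := @sol_unique R p _ _ b gp.2 sw (sol0 p) (fun k k4 => wi k k4) 3%N a isT.
by rewrite w0//= => /eqP; rewrite oner_eq0.
Qed.

End Robin.

(** The kernel is spanned by (-y, x), or by (1, 0) if [x = 0], when the vanishing determinant forces
    [y = 0] and only [z] is left. *)
Lemma kernel2 (x y z : R) : x * z - y ^+ 2 = 0 -> ~ [/\ x = 0, y = 0 & z = 0] ->
  exists k1 k2 : R, [/\ k1 * x + k2 * y = 0, k1 * y + k2 * z = 0, ~ (k1 = 0 /\ k2 = 0) &
    forall c1 c2 : R, c1 * x + c2 * y = 0 -> c1 * y + c2 * z = 0 ->
      exists s : R, c1 = s * k1 /\ c2 = s * k2].
Proof.
move=> d nz; have [x0|x0] := eqVneq x 0.
- have y0 : y = 0 by apply/eqP; rewrite -sqrf_eq0; apply/eqP; move: d; rewrite x0; lra.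
  have z0 : z != 0 by apply/eqP => z0; exact: nz.
  exists 1, 0; split; rewrite ?x0 ?y0 ?mulr0 ?mul0r ?addr0//.
    by case=> /eqP; rewrite oner_eq0.
  move=> c1 c2 _; rewrite mulr0 add0r => /eqP; rewrite mulf_eq0 (negbTE z0) orbF => /eqP ->.
  by exists c1; rewrite mulr1 mulr0.
- exists (- y), x; split; first by ring.
  + by rewrite -[RHS]d; ring.
  + by case=> _ /eqP; rewrite (negbTE x0).
  + move=> c1 c2 h _; exists (c2 / x); split; last by rewrite divfK.
    apply: (mulIf x0); rewrite (_ : c2 / x * - y * x = - (c2 * y)); last by field.
    by apply/eqP; rewrite -addr_eq0 h.
Qed.

Section Local.
Variables (v : R -> R -> R) (e0 m0 r0 C L : R).
Hypotheses (r0_gt0 : 0 < r0) (C0 : 0 <= C) (aL : `|a| <= L) (bL : `|b| <= L).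
Hypothesis v_coef : forall e : R, `|e - e0| < r0 -> bounded_coef (v e).
Hypothesis v_lip : forall e e' x : R, `|e - e0| < r0 -> `|e' - e0| < r0 -> `|x| <= L ->
  `|v e x - v e' x| <= C * `|e - e'|.

Let p (t : R * R) (x : R) : R := t.2 - v t.1 x.
Let t0 : R * R := (e0, m0).
Let A : set (R * R) := [set t | `|t.1 - e0| < r0 /\ `|t.2 - m0| < 1].
Let rho (t s : R * R) : R := `|t.1 - s.1| + `|t.2 - s.2|.

Let rho0 t s : 0 <= rho t s. Proof. by rewrite addr_ge0. Qed.
Let At0 : A t0. Proof. by split => /=; rewrite subrr normr0. Qed.
Let p_coef t : A t -> bounded_coef (p t).
Proof.
move=> [h _]; apply: bounded_coefD; first exact: bounded_coef_cst.
rewrite (_ : (fun x => - v t.1 x) = fun x => -1 * v t.1 x); last first.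
  by apply/funext => x; rewrite mulN1r.
by apply: bounded_coefZ; exact: v_coef.
Qed.

Let fund_lip : exists K : R, forall (x : R) k j, `|x| <= L -> (k < 4)%N -> (j < 4)%N ->
  lip A rho K (fun t => fund (p t) a k j x).
Proof.
have e0r : `|e0 - e0| < r0 by rewrite subrr normr0.
have [_ [B vB]] := v_coef e0r.
have B0 : 0 <= B by exact: le_trans (vB 0).
pose M := `|m0| + 1 + B + C * r0.
have M0 : 0 <= M by rewrite /M !addr_ge0// mulr_ge0// ltW.
have [|||K HK] := @lip_fund R (R * R)%type A rho rho0 p M (C + 1) L M0 _ p_coef.
- by rewrite addr_ge0.
- move=> t x [t1 t2] xL; rewrite /p /M.
  have h1 := v_lip t1 e0r xL.
  have h2 : C * `|t.1 - e0| <= C * r0 by rewrite ler_wpM2l// ltW.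
  rewrite (_ : _ - _ = (t.2 - m0) + m0 - (v t.1 x - v e0 x) - v e0 x); last by ring.
  apply: le_trans (ler_normB _ _) _.
  apply: le_trans (lerD (ler_normB _ _) (lexx _)) _.
  apply: le_trans (lerD (lerD (ler_normD _ _) (lexx _)) (lexx _)) _.
  have := vB x; lra.
- move=> t s x [t1 t2] [s1 s2] xL; rewrite /p /rho.
  have h1 := v_lip t1 s1 xL.
  rewrite (_ : _ - _ - _ = (t.2 - s.2) - (v t.1 x - v s.1 x)); last by ring.
  apply: le_trans (ler_normB _ _) _.
  have := mulr_ge0 C0 (normr_ge0 (t.2 - s.2)); have := normr_ge0 (t.1 - s.1); lra.
by exists K => x k j xL k4 j4; exact: HK.
Qed.

(* With the Robin data at b as coordinates, the map from the solutions clamped at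
   a to their Dirichlet data at b is a symmetric 2 x 2 matrix that increases with
   the spectral parameter; the branches are its eigenvalues. *)
Lemma local_branches : exists (r : R) (m1 m2 : R -> R -> R) (D : R),
  [/\ 0 < r, r <= r0,
    forall e mu : R, `|e - e0| < r -> `|mu - m0| < r ->
      has_dim `]a, b[%classic (real_eig a b (fun x => mu - v e x)) ((m1 e mu == 0%R) + (m2 e mu == 0%R))%N,
    forall e mu mu', `|e - e0| < r -> `|mu - m0| < r -> `|mu' - m0| < r -> mu < mu' ->
      m1 e mu < m1 e mu' /\ m2 e mu < m2 e mu' &
    forall e mu e' mu', `|e - e0| < r -> `|mu - m0| < r -> `|e' - e0| < r -> `|mu' - m0| < r ->
      `|m1 e mu - m1 e' mu'| <= D * (`|e - e'| + `|mu - mu'|) /\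
      `|m2 e mu - m2 e' mu'| <= D * (`|e - e'| + `|mu - mu'|)].
Proof.
have [K HK] := fund_lip.
have [tau dtau] := robin_exists (p_coef At0).
pose Y t i := fund (p t) a i.
pose q11 t := - Y t 2%N 3%N b + tau * Y t 2%N 0%N b.
pose q12 t := - Y t 3%N 3%N b + tau * Y t 3%N 0%N b.
pose q21 t := Y t 2%N 2%N b + tau * Y t 2%N 1%N b.
pose q22 t := Y t 3%N 2%N b + tau * Y t 3%N 1%N b.
pose dt t := q11 t * q22 t - q12 t * q21 t.
have lY k j : (k < 4)%N -> (j < 4)%N -> lip A rho K (fun t => Y t k j b).
  by move=> k4 j4; exact: HK.
pose cT := lip_cst A (rho := rho) rho0 tau.
have [Q Q0] : exists Q : R, [/\ lip A rho Q q11, lip A rho Q q12, lip A rho Q q21 & lip A rho Q q22].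
  exists (K + 2 * (`|tau| * K)); split.
  - exact: lipD (lipN (lY 2%N 3%N isT isT)) (lipM cT (lY 2%N 0%N isT isT)).
  - exact: lipD (lipN (lY 3%N 3%N isT isT)) (lipM cT (lY 3%N 0%N isT isT)).
  - exact: lipD (lY 2%N 2%N isT isT) (lipM cT (lY 2%N 1%N isT isT)).
  - exact: lipD (lY 3%N 2%N isT isT) (lipM cT (lY 3%N 1%N isT isT)).
have [l11 l12 l21 l22] := Q0.
have [Dd ldt] : exists Dd : R, lip A rho Dd dt.
  by eexists; exact: lipD (lipM l11 l22) (lipN (lipM l12 l21)).
have dt0 : 0 < `|dt t0| by rewrite normr_gt0; exact: dtau.
have [Dd0 _ dtl] := ldt.
pose c : R := `|dt t0| / 2.
have c_gt0 : 0 < c by rewrite divr_gt0.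
(* Within this distance of [t0] the determinant [dt] keeps at least half of its modulus. *)
pose r1 : R := c / (Dd + 1).
have Dd1 : 0 < Dd + 1 by rewrite ltr_wpDl.
have r1_gt0 : 0 < r1 by rewrite divr_gt0.
pose A1 : set (R * R) := [set t | A t /\ rho t t0 < r1].
have A1A : A1 `<=` A by move=> t [].
have rho00 : rho t0 t0 = 0 by rewrite /rho !subrr normr0 addr0.
have A1t0 : A1 t0 by split => //; rewrite rho00.
have dtc t : A1 t -> c <= `|dt t|.
  move=> [At rt].
  have h1 := dtl t t0 At At0.
  have h2 : Dd * rho t t0 <= c.
    apply: le_trans (_ : (Dd + 1) * rho t t0 <= _); first by rewrite ler_wpM2r// lerDl.
    by rewrite mulrC -ler_pdivlMr// ltW.
  have h3 := ler_normB (dt t) (dt t - dt t0).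
  rewrite (_ : dt t - (dt t - dt t0) = dt t0) in h3; last by ring.
  by rewrite /c in h2 *; lra.
have dtn t : A1 t -> dt t != 0 by move=> /dtc h; rewrite -normr_gt0; exact: lt_le_trans h.
have ldV := lipV rho0 c_gt0 dtc (lip_sub A1A ldt).
(* Cramer's rule: [psi1] and [psi2] are the clamped solutions with Robin data (1, 0) and (0, 1) at
   [b]. *)
pose psi1 t j x := (dt t)^-1 * (q22 t * Y t 2%N j x + - (q21 t * Y t 3%N j x)).
pose psi2 t j x := (dt t)^-1 * (q11 t * Y t 3%N j x + - (q12 t * Y t 2%N j x)).
have [E HE] : exists E : R, forall j (x : R), (j < 4)%N -> `|x| <= L ->
    lip A1 rho E (fun t => psi1 t j x) /\ lip A1 rho E (fun t => psi2 t j x).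
  eexists => j x j4 xL; split.
  - exact: (lipM ldV (lipD (lipM (lip_sub A1A l22) (lip_sub A1A (HK x 2%N j xL isT j4)))
      (lipN (lipM (lip_sub A1A l21) (lip_sub A1A (HK x 3%N j xL isT j4)))))).
  - exact: (lipM ldV (lipD (lipM (lip_sub A1A l11) (lip_sub A1A (HK x 3%N j xL isT j4)))
      (lipN (lipM (lip_sub A1A l12) (lip_sub A1A (HK x 2%N j xL isT j4)))))).
have sY t i : A t -> sol (p t) (Y t i) by move=> At; have [] := fundP a i (p_coef At).
have Y0 t i j : A t -> (j < 4)%N -> Y t i j a = (j == i)%:R.
  by move=> At j4; rewrite /Y; have [_ ->] := fundP a i (p_coef At).
have s1 t : A t -> sol (p t) (psi1 t).
  move=> At; apply: solZ; apply: solD; first by apply: solZ; exact: sY.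
  have := solZ (- q21 t) (sY t 3%N At); congr sol.
  by apply/funext => k; apply/funext => x; rewrite mulNr.
have s2 t : A t -> sol (p t) (psi2 t).
  move=> At; apply: solZ; apply: solD; first by apply: solZ; exact: sY.
  have := solZ (- q12 t) (sY t 2%N At); congr sol.
  by apply/funext => k; apply/funext => x; rewrite mulNr.
have p1a t j : A t -> (j < 2)%N -> psi1 t j a = 0.
  move=> At j2; rewrite /psi1 !Y0//; try exact: leq_trans j2 _.
  by case: j j2 => [|[|]]//= _; rewrite !mulr0 oppr0 addr0 mulr0.
have p2a t j : A t -> (j < 2)%N -> psi2 t j a = 0.
  move=> At j2; rewrite /psi2 !Y0//; try exact: leq_trans j2 _.
  by case: j j2 => [|[|]]//= _; rewrite !mulr0 oppr0 addr0 mulr0.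
have r11 t : A1 t -> - psi1 t 3%N b + tau * psi1 t 0%N b = 1.
  move=> /dtn h; rewrite -[RHS](mulVf h).
  by rewrite /psi1 /dt /q11 /q12; ring.
have r12 t : A1 t -> psi1 t 2%N b + tau * psi1 t 1%N b = 0.
  by move=> /dtn h; rewrite /psi1 /q21 /q22; ring.
have r21 t : A1 t -> - psi2 t 3%N b + tau * psi2 t 0%N b = 0.
  by move=> /dtn h; rewrite /psi2 /q11 /q12; ring.
have r22 t : A1 t -> psi2 t 2%N b + tau * psi2 t 1%N b = 1.
  move=> /dtn h; rewrite -[RHS](mulVf h).
  by rewrite /psi2 /dt /q21 /q22; ring.
(* Green's formula in terms of the Robin data at b *)
have green (t s : R * R) (y z : nat -> R -> R) : sol (p t) y -> sol (p s) z ->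
    (forall j, (j < 2)%N -> y j a = 0) -> (forall j, (j < 2)%N -> z j a = 0) -> t.1 = s.1 ->
    forall (f : R -> R) (eta : R), continuous f -> (forall x, a <= x <= b -> `|y 0%N x * z 0%N x - f x| <= eta) ->
    `| (y 0%N b * (- z 3%N b + tau * z 0%N b) + y 1%N b * (z 2%N b + tau * z 1%N b)
      - (- y 3%N b + tau * y 0%N b) * z 0%N b - (y 2%N b + tau * y 1%N b) * z 1%N b)
      - (t.2 - s.2) * Int a b f | <= `|t.2 - s.2| * eta * (b - a).
  move=> sy sz ya za ts f eta cf H.
  have cf' : continuous (fun x => (t.2 - s.2) * f x).
    by move=> x; apply: cvgM; [exact: cvg_cst|exact: cf].
  have -> : (t.2 - s.2) * Int a b f = Int a b (fun x => (t.2 - s.2) * f x).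
    have [f0 df] := primP a cf.
    rewrite (@Int_eq R a b ab (fun x => (t.2 - s.2) * f x) (fun x => (t.2 - s.2) * prim f a x))//.
      by rewrite f0 mulr0 subr0.
    by move=> x _; exact: derMl.
  have := @Int_approx R a b ab _ (wron y z) _ (`|t.2 - s.2| * eta) cf' (fun x _ => der_wron x sy sz) _.
  rewrite (_ : wron y z b - wron y z a = y 0%N b * (- z 3%N b + tau * z 0%N b) + y 1%N b * (z 2%N b + tau * z 1%N b)
      - (- y 3%N b + tau * y 0%N b) * z 0%N b - (y 2%N b + tau * y 1%N b) * z 1%N b); last first.
    by rewrite /wron (ya 0%N)// (ya 1%N)// (za 0%N)// (za 1%N)//; ring.
  apply=> x xI; rewrite /p ts (_ : _ - _ = (t.2 - s.2) * (y 0%N x * z 0%N x - f x)); last by ring.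
  by rewrite normrM ler_wpM2l// H.
pose f11 x := psi1 t0 0%N x * psi1 t0 0%N x.
pose f12 x := psi1 t0 0%N x * psi2 t0 0%N x.
pose f22 x := psi2 t0 0%N x * psi2 t0 0%N x.
have cp1 : continuous (psi1 t0 0%N) by exact: sol_cont (s1 t0 At0) _.
have cp2 : continuous (psi2 t0 0%N) by exact: sol_cont (s2 t0 At0) _.
have cf11 : continuous f11 by move=> x; apply: cvgM; exact: cp1.
have cf12 : continuous f12 by move=> x; apply: cvgM; [exact: cp1|exact: cp2].
have cf22 : continuous f22 by move=> x; apply: cvgM; exact: cp2.
(* The Gram matrix at the centre [t0]; it is the derivative there, in the spectral parameter, of the
   Dirichlet matrix introduced below. *)
pose k11 := Int a b f11; pose k12 := Int a b f12; pose k22 := Int a b f22.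
have indep t (c1 c2 : R) : A1 t ->
    (forall k x, (k < 4)%N -> c1 * psi1 t k x + c2 * psi2 t k x = 0) -> c1 = 0 /\ c2 = 0.
  move=> B1 H; have H0 := H 0%N b isT; have H1 := H 1%N b isT.
  have H2 := H 2%N b isT; have H3 := H 3%N b isT.
  have e1 := r11 t B1; have e2 := r12 t B1; have e3 := r21 t B1; have e4 := r22 t B1.
  split.
  - rewrite -[LHS]mulr1 -e1; apply: (@eq_trans _ _ (- (c1 * psi1 t 3%N b + c2 * psi2 t 3%N b)
      + tau * (c1 * psi1 t 0%N b + c2 * psi2 t 0%N b) - c2 * (- psi2 t 3%N b + tau * psi2 t 0%N b))); first by ring.
    by rewrite H3 H0 e3 !mulr0 oppr0 !addr0.
  - rewrite -[LHS]mulr1 -e4; apply: (@eq_trans _ _ ((c1 * psi1 t 2%N b + c2 * psi2 t 2%N b)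
      + tau * (c1 * psi1 t 1%N b + c2 * psi2 t 1%N b) - c1 * (psi1 t 2%N b + tau * psi1 t 1%N b))); first by ring.
    by rewrite H2 H1 e2 !mulr0 oppr0 !addr0.
have kpos (c1 c2 : R) : ~ (c1 = 0 /\ c2 = 0) -> 0 < c1 ^+ 2 * k11 + 2 * c1 * c2 * k12 + c2 ^+ 2 * k22.
  move=> cn.
  rewrite -(Int_comb2 ab _ _ _ cf11 cf12 cf22).
  have s : sol (p t0) (fun k x => c1 * psi1 t0 k x + c2 * psi2 t0 k x).
    by apply: solD; apply: solZ; [exact: s1|exact: s2].
  have := Int_sqr_gt0 ab (p_coef At0) s; rewrite (_ : (fun x => _ * _) =
    (fun x => c1 ^+ 2 * f11 x + 2 * c1 * c2 * f12 x + c2 ^+ 2 * f22 x)).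
    by apply=> h; apply: cn; exact: indep h.
  by apply/funext => x; rewrite /f11 /f12 /f22; ring.
have k11_gt0 : 0 < k11.
  by have := kpos 1 0; rewrite !mulr0 !mul0r expr1n expr0n /= mul1r mul0r !addr0; apply; case=> /eqP; rewrite oner_eq0.
have k22_gt0 : 0 < k22.
  by have := kpos 0 1; rewrite !mulr0 !mul0r expr1n expr0n /= mul1r !mul0r !add0r; apply; case=> _ /eqP; rewrite oner_eq0.
have d_gt0 : 0 < k11 * k22 - k12 ^+ 2.
  have := kpos (- k12) k11; rewrite (_ : _ + _ = k11 * (k11 * k22 - k12 ^+ 2)); last by ring.
  by rewrite pmulr_rgt0//; apply; case=> _ h; rewrite h ltxx in k11_gt0.
(* Lowering both diagonal entries by [h] and raising the modulus of the off-diagonal one by [h]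
   lowers the determinant by exactly [h * S]. The [h] chosen below is thus an entrywise margin under
   which the Gram matrix stays positive definite. *)
pose S := k11 + k22 + 2 * `|k12|.
have S_gt0 : 0 < S by have := normr_ge0 k12; rewrite /S; lra.
pose h := (k11 * k22 - k12 ^+ 2) / S / 2.
have h_gt0 : 0 < h by rewrite !divr_gt0.
have hS : h * S < k11 * k22 - k12 ^+ 2.
  by rewrite /h (_ : _ * S = (k11 * k22 - k12 ^+ 2) / 2); [lra|field; rewrite gt_eqF].
have hk11 : h < k11.
  rewrite -(@ltr_pM2r _ S)//; apply: lt_le_trans hS _; rewrite /S.
  have := sqr_ge0 k12; have := mulr_gt0 k11_gt0 k11_gt0; have := mulr_ge0 (ltW k11_gt0) (normr_ge0 k12).
  by rewrite !mulrDr; lra.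
have hk22 : h < k22.
  rewrite -(@ltr_pM2r _ S)//; apply: lt_le_trans hS _; rewrite /S.
  have := sqr_ge0 k12; have := mulr_gt0 k22_gt0 k22_gt0; have := mulr_ge0 (ltW k22_gt0) (normr_ge0 k12).
  by rewrite !mulrDr [k22 * k11]mulrC; lra.
have E0 : 0 <= E by have [[]] := HE 0%N a isT aL.
have ba0 : 0 < b - a by rewrite subr_gt0.
have den_gt0 : 0 < 4 * (E * E) * (b - a) + 1 by rewrite ltr_wpDl// !mulr_ge0// ltW.
(* The four bounds keep the box within reach of [v_lip], within the unit window in [mu], where [dt]
   is away from zero, and where products of the [psi] vary by at most [h / (b - a)]. *)
pose mn : R := Num.min (Num.min r0 1) (Num.min (r1 / 2) (h / (4 * (E * E) * (b - a) + 1))).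
have mn_gt0 : 0 < mn by rewrite /mn !lt_min r0_gt0 ltr01 !divr_gt0.
have mn1 : mn <= r0 by rewrite /mn !ge_min lexx.
have mn2 : mn <= 1 by rewrite /mn !ge_min lexx orbT.
have mn3 : mn <= r1 / 2 by rewrite /mn !ge_min lexx !orbT.
have mn4 : mn <= h / (4 * (E * E) * (b - a) + 1) by rewrite /mn !ge_min lexx !orbT.
pose r : R := mn / 2.
have r_gt0 : 0 < r by rewrite /r; clear - mn_gt0; lra.
have r_r0 : r < r0 by rewrite /r; clear - mn_gt0 mn1; lra.
have r_1 : r < 1 by rewrite /r; clear - mn_gt0 mn2; lra.
have r_r1 : 2 * r <= r1 / 2 by rewrite /r mulrC divfK.
have r_h : 2 * r <= h / (4 * (E * E) * (b - a) + 1) by rewrite /r mulrC divfK.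
pose box (e mu : R) := `|e - e0| < r /\ `|mu - m0| < r.
have boxA1 e mu : box e mu -> A1 (e, mu) /\ rho (e, mu) t0 < 2 * r.
  move=> [h1 h2]; have hr : rho (e, mu) t0 < 2 * r by rewrite /rho /= mulr_natl mulr2n ltrD.
  by split => //; split; [split => /=; [exact: lt_trans r_r0|exact: lt_trans r_1]|rewrite (lt_le_trans hr)// (le_trans r_r1)// ler_pdivrMr// ler_peMr ?ler1n// ltW].
have close (e mu mu' x : R) (P P' : R * R -> nat -> R -> R) : box e mu -> box e mu' ->
    lip A1 rho E (fun t => P t 0%N x) -> lip A1 rho E (fun t => P' t 0%N x) ->
    `|P (e, mu) 0%N x * P' (e, mu') 0%N x - P t0 0%N x * P' t0 0%N x| <= h / (b - a).
  move=> /boxA1[B1 R1] /boxA1[B2 R2] [_ b1 g1] [_ b2 g2].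
  rewrite (_ : _ - _ = P (e, mu) 0%N x * (P' (e, mu') 0%N x - P' t0 0%N x)
    + (P (e, mu) 0%N x - P t0 0%N x) * P' t0 0%N x); last by ring.
  apply: le_trans (ler_normD _ _) _; rewrite !normrM.
  have u1 := ler_pM (normr_ge0 _) (normr_ge0 _) (b1 _ B1) (g2 _ _ B2 A1t0).
  have u2 := ler_pM (normr_ge0 _) (normr_ge0 _) (g1 _ _ B1 A1t0) (b2 _ A1t0).
  apply: le_trans (lerD u1 u2) _.
  have EE : 0 <= E * E by rewrite mulr_ge0.
  apply: le_trans (_ : 4 * (E * E) * r <= _).
    rewrite (_ : 4 * (E * E) * r = E * (E * (2 * r)) + E * (2 * r) * E); last by ring.
    by apply: lerD; [rewrite !ler_wpM2l// ltW|rewrite ler_wpM2r// ler_wpM2l// ltW].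
  rewrite ler_pdivlMr//; apply: le_trans (_ : (4 * (E * E) * (b - a) + 1) * r <= _).
    rewrite -subr_ge0 (_ : _ - _ = r); last by ring.
    exact: ltW.
  by rewrite mulrC -ler_pdivlMr//; apply: le_trans r_h; rewrite ler_peMl ?ler1n// ltW.
have xL (x : R) : a <= x <= b -> `|x| <= L.
  by move=> /andP[h1 h2]; exact: itv_norm_le h1 h2 aL bL.
(* The matrix from Robin to Dirichlet data at [b]; its kernel consists of the coordinates of the
   eigenfunctions. *)
pose M11 e mu := psi1 (e, mu) 0%N b.
pose M21 e mu := psi1 (e, mu) 1%N b.
pose M12 e mu := psi2 (e, mu) 0%N b.
pose M22 e mu := psi2 (e, mu) 1%N b.
have sym e mu : box e mu -> M12 e mu = M21 e mu.
  move=> Bx; have [B1 _] := boxA1 _ _ Bx; have At := A1A _ B1.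
  have := green (e, mu) (e, mu) (psi1 (e, mu)) (psi2 (e, mu)) (s1 _ At) (s2 _ At)
    (fun j j2 => p1a _ j At j2) (fun j j2 => p2a _ j At j2) erefl f12 (h / (b - a)) cf12.
  rewrite r11// r12// r21// r22// /= !subrr normr0 !mul0r => H.
  have {H} := H (fun x xI => close _ _ _ _ psi1 psi2 Bx Bx (HE 0%N x isT (xL x xI)).1 (HE 0%N x isT (xL x xI)).2).
  by rewrite normr_le0 mulr0 mulr1 mul1r add0r !subr0 subr_eq0 => /eqP.
have hba : h / (b - a) * (b - a) = h by rewrite divfK// gt_eqF.
(* Green's formula at one eps and two spectral parameters: the increment of the matrix is [mu' - mu]
   times a Gram matrix, which differs from the one at the centre by at most the margin [h]. *)
have incr e mu mu' : box e mu -> box e mu' ->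
   [/\ `|(M11 e mu' - M11 e mu) - (mu' - mu) * k11| <= `|mu' - mu| * h,
        `|(M21 e mu' - M21 e mu) - (mu' - mu) * k12| <= `|mu' - mu| * h &
        `|(M22 e mu' - M22 e mu) - (mu' - mu) * k22| <= `|mu' - mu| * h].
  move=> Bx Bx'; have [B1 _] := boxA1 _ _ Bx; have At := A1A _ B1.
  have [B1' _] := boxA1 _ _ Bx'; have At' := A1A _ B1'.
  split.
  - have := green (e, mu') (e, mu) (psi1 (e, mu')) (psi1 (e, mu)) (s1 _ At') (s1 _ At)
      (fun j j2 => p1a _ j At' j2) (fun j j2 => p1a _ j At j2) erefl f11 (h / (b - a)) cf11
      (fun x xI => close _ _ _ _ psi1 psi1 Bx' Bx (HE 0%N x isT (xL x xI)).1 (HE 0%N x isT (xL x xI)).1).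
    by rewrite r11// r12// r11// r12// /= -mulrA hba mulr1 mulr0 addr0 mul1r mul0r subr0.
  - have := green (e, mu') (e, mu) (psi1 (e, mu')) (psi2 (e, mu)) (s1 _ At') (s2 _ At)
      (fun j j2 => p1a _ j At' j2) (fun j j2 => p2a _ j At j2) erefl f12 (h / (b - a)) cf12
      (fun x xI => close _ _ _ _ psi1 psi2 Bx' Bx (HE 0%N x isT (xL x xI)).1 (HE 0%N x isT (xL x xI)).2).
    by rewrite r11// r12// r21// r22// /= -mulrA hba mulr1 mulr0 add0r mul1r mul0r subr0 -/(M12 e mu) sym.
  - have := green (e, mu') (e, mu) (psi2 (e, mu')) (psi2 (e, mu)) (s2 _ At') (s2 _ At)
      (fun j j2 => p2a _ j At' j2) (fun j j2 => p2a _ j At j2) erefl f22 (h / (b - a)) cf22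
      (fun x xI => close _ _ _ _ psi2 psi2 Bx' Bx (HE 0%N x isT (xL x xI)).2 (HE 0%N x isT (xL x xI)).2).
    by rewrite r21// r22// r21// r22// /= -mulrA hba mulr1 mulr0 add0r mul1r mul0r subr0.
exists r, (fun e mu => eigS 1 (M11 e mu) (M21 e mu) (M22 e mu)),
  (fun e mu => eigS (-1) (M11 e mu) (M21 e mu) (M22 e mu)), (3 * E); split => //; first exact: ltW.
- move=> e mu h1 h2; have Bx : box e mu by split.
  have [B1 _] := boxA1 _ _ Bx; have At := A1A _ B1; have gp := p_coef At.
  rewrite -[(fun x => mu - v e x)]/(p (e, mu)).
  pose t := (e, mu).
  have dn := dtn _ B1.
  have YE k x : Y t 2%N k x = q11 t * psi1 t k x + q21 t * psi2 t k x
     /\ Y t 3%N k x = q12 t * psi1 t k x + q22 t * psi2 t k x.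
    by rewrite /psi1 /psi2; split; apply: (mulfI dn); rewrite /dt; field.
  have span y : eigfun a b (p t) y -> exists c1 c2 : R, [/\ forall x : R, y 0%N x = c1 * psi1 t 0%N x + c2 * psi2 t 0%N x,
      c1 * M11 e mu + c2 * M21 e mu = 0 & c1 * M21 e mu + c2 * M22 e mu = 0].
    move=> [sy y0 y1 y0b y1b].
    have ye := fund_clamped gp sy y0 y1.
    exists (y 2%N a * q11 t + y 3%N a * q12 t), (y 2%N a * q21 t + y 3%N a * q22 t).
    have yy k x : (k < 4)%N -> y k x = (y 2%N a * q11 t + y 3%N a * q12 t) * psi1 t k x
        + (y 2%N a * q21 t + y 3%N a * q22 t) * psi2 t k x.
      move=> k4; rewrite ye//; have [y2E y3E] := YE k x; rewrite -/(Y t 2%N k x) -/(Y t 3%N k x) y2E y3E; ring.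
    split => [x| |]; first exact: yy.
    + by rewrite -(sym e mu Bx); exact: (etrans (esym (yy 0%N b isT)) y0b).
    + exact: (etrans (esym (yy 1%N b isT)) y1b).
  have eig c1 c2 : c1 * M11 e mu + c2 * M21 e mu = 0 -> c1 * M21 e mu + c2 * M22 e mu = 0 ->
      eigfun a b (p t) (fun k x => c1 * psi1 t k x + c2 * psi2 t k x).
    move=> g1 g2; split.
    + by apply: solD; apply: solZ; [exact: s1|exact: s2].
    + by rewrite p1a// p2a// !mulr0 addr0.
    + by rewrite p1a// p2a// !mulr0 addr0.
    + by move: g1; rewrite -(sym e mu Bx).
    + exact: g2.
  have prd := eigS_prod (M11 e mu) (M21 e mu) (M22 e mu).
  have both := @eigS_both R (M11 e mu) (M21 e mu) (M22 e mu).
  set z1 := eigS 1 _ _ _ in prd both *; set z2 := eigS (-1) _ _ _ in prd both *.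
  have one : M11 e mu * M22 e mu - M21 e mu ^+ 2 = 0 -> ~ [/\ M11 e mu = 0, M21 e mu = 0 & M22 e mu = 0] ->
      has_dim `]a, b[%classic (real_eig a b (p (e, mu))) 1.
    move=> dz nz.
    have [k1 [k2 [g1 g2 g3 g4]]] := kernel2 dz nz.
    apply: (eig_dim1 a_lt0 b_gt0 gp (eig _ _ g1 g2)).
    * by move=> H; apply: g3; exact: indep H.
    * move=> y /span[c1 [c2 [yE e1 e2]]]; have [s [c1E c2E]] := g4 _ _ e1 e2.
      by exists s => x; rewrite yE c1E c2E; ring.
  have nz : ~ (z1 = 0 /\ z2 = 0) -> ~ [/\ M11 e mu = 0, M21 e mu = 0 & M22 e mu = 0].
    move=> n [x0 y0 z0]; apply: n; rewrite /z1 /z2 x0 y0 z0 /eigS /norm2.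
    by rewrite subrr mulr0 expr0n /= addr0 sqrtr0 !mulr0 !addr0 mul0r.
  have [z10|z10] := eqVneq z1 0; have [z20|z20] := eqVneq z2 0 => /=.
  + have [x0 y0 z0] := both z10 z20.
    have eY i c1 c2 : (forall k x, Y t i k x = c1 * psi1 t k x + c2 * psi2 t k x) -> eigfun a b (p t) (Y t i).
      move=> YY; rewrite (_ : Y t i = fun k x => c1 * psi1 t k x + c2 * psi2 t k x).
        by apply: eig; rewrite ?x0 ?y0 ?z0 !mulr0 addr0.
      by apply/funext => k; apply/funext => x.
    apply: (eig_dim2 a_lt0 b_gt0 gp); first by apply: (eY 2%N (q11 t) (q21 t)) => k x; have [] := YE k x.
    by apply: (eY 3%N (q12 t) (q22 t)) => k x; have [] := YE k x.
  + apply: (one); first by rewrite -prd z10 mul0r.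
    by apply: nz => -[_ /eqP]; rewrite (negbTE z20).
  + apply: (one); first by rewrite -prd z20 mulr0.
    by apply: nz => -[/eqP]; rewrite (negbTE z10).
  + apply: (eig_dim0 a_lt0 b_gt0 gp) => y /span[c1 [c2 [yE e1 e2]]] x.
    have dn0 : M11 e mu * M22 e mu - M21 e mu ^+ 2 != 0 by rewrite -prd mulf_neq0.
    have d1 : c1 * (M11 e mu * M22 e mu - M21 e mu ^+ 2) = 0.
      rewrite (_ : c1 * _ = (c1 * M11 e mu + c2 * M21 e mu) * M22 e mu
        - (c1 * M21 e mu + c2 * M22 e mu) * M21 e mu); last by ring.
      by rewrite e1 e2 !mul0r subrr.
    have d2 : c2 * (M11 e mu * M22 e mu - M21 e mu ^+ 2) = 0.
      rewrite (_ : c2 * _ = (c1 * M21 e mu + c2 * M22 e mu) * M11 e mu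
        - (c1 * M11 e mu + c2 * M21 e mu) * M21 e mu); last by ring.
      by rewrite e1 e2 !mul0r subrr.
    have c10 : c1 = 0 by apply/eqP; move/eqP: d1; rewrite mulf_eq0 (negbTE dn0) orbF.
    have c20 : c2 = 0 by apply/eqP; move/eqP: d2; rewrite mulf_eq0 (negbTE dn0) orbF.
    by rewrite yE c10 c20 !mul0r addr0.
- move=> e mu mu' h1 h2 h3 lt_mu.
  have [i1 i2 i3] := incr e mu mu' (conj h1 h2) (conj h1 h3).
  have d0 : 0 < mu' - mu by rewrite subr_gt0.
  rewrite (gtr0_norm d0) in i1 i2 i3; set del := mu' - mu in d0 i1 i2 i3.
  set d1 := M11 e mu' - M11 e mu in i1; set d2 := M21 e mu' - M21 e mu in i2.
  set d3 := M22 e mu' - M22 e mu in i3.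
  have g1 : del * (k11 - h) <= d1 by move: i1; rewrite mulrBr ler_distl => /andP[].
  have g3 : del * (k22 - h) <= d3 by move: i3; rewrite mulrBr ler_distl => /andP[].
  have g2 : `|d2| <= del * (`|k12| + h).
    have := ler_normD (d2 - del * k12) (del * k12); rewrite subrK normrM (gtr0_norm d0) => /le_trans; apply.
    by rewrite mulrDr addrC lerD2l.
  have u1 : 0 < del * (k11 - h) by rewrite mulr_gt0// subr_gt0.
  have u3 : 0 < del * (k22 - h) by rewrite mulr_gt0// subr_gt0.
  have p1 : 0 < d1 by exact: lt_le_trans g1.
  have p3 : 0 < d3 by exact: lt_le_trans g3.
  have p2 : d2 ^+ 2 < d1 * d3.
    apply: lt_le_trans (ler_pM (ltW u1) (ltW u3) g1 g3).
    rewrite -real_normK ?num_real//.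
    apply: le_lt_trans (_ : (del * (`|k12| + h)) ^+ 2 < _).
      by rewrite lerXn2r ?nnegrE//; apply: le_trans g2.
    rewrite (_ : _ * _ * _ = del ^+ 2 * ((k11 - h) * (k22 - h))); last by ring.
    rewrite exprMn ltr_pM2l ?exprn_gt0//.
    have n2 : `|k12| ^+ 2 = k12 ^+ 2 by rewrite real_normK ?num_real.
    rewrite -subr_gt0 (_ : _ - _ = k11 * k22 - `|k12| ^+ 2 - h * S); last by rewrite /S; ring.
    by rewrite subr_gt0 n2.
  have q1 : M11 e mu < M11 e mu' by rewrite -subr_gt0.
  have q3 : M22 e mu < M22 e mu' by rewrite -subr_gt0.
  by split; [exact: eigS_mono (normr1 R) q1 q3 p2|exact: eigS_mono (normrN1 R) q1 q3 p2].
- move=> e mu e' mu' h1 h2 h3 h4.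
  have [B1 _] := boxA1 e mu (conj h1 h2); have [B2 _] := boxA1 e' mu' (conj h3 h4).
  have [[_ _ w11] _] := HE 0%N b isT bL.
  have [[_ _ w21] [_ _ w22]] := HE 1%N b isT bL.
  have W : `|M11 e mu - M11 e' mu'| + `|M22 e mu - M22 e' mu'| + `|M21 e mu - M21 e' mu'|
      <= 3 * E * (`|e - e'| + `|mu - mu'|).
    apply: le_trans (lerD (lerD (w11 _ _ B1 B2) (w22 _ _ B1 B2)) (w21 _ _ B1 B2)) _.
    by rewrite /rho /= le_eqVlt; apply/orP; left; apply/eqP; ring.
  by split; [exact: le_trans (eigS_dist _ _ _ _ _ _ (normr1 R)) W
            |exact: le_trans (eigS_dist _ _ _ _ _ _ (normrN1 R)) W].
Qed.

End Local.
End Branches.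

(** * Counting eigenvalues *)

Section Counting.
Variable R : realType.

Lemma card_list (B : set nat) m : (B #= `I_m)%card ->
  exists s : seq nat, [/\ uniq s, size s = m & forall k, B k <-> k \in s].
Proof.
rewrite card_eq_sym => /card_set_bijP[f [ff fi fs]].
pose g : nat -> nat := f.
exists (map g (iota 0 m)); split; last 1 first.
- move=> k; split.
  + move=> /fs[i /= im <-]; apply: (map_f g); by rewrite mem_iota.
  + move=> h; have [i im ->] := elimT (@seq.mapP _ _ g (iota 0 m) k) h.
    by apply: ff; move: im; rewrite mem_iota /= add0n.
- rewrite map_inj_in_uniq ?iota_uniq// => i j; rewrite !mem_iota /= !add0n => im jm.
  by apply: fi; rewrite inE.
- by rewrite size_map size_iota.
Qed.

(** Indices start at 0, so [n] is at once the number of terms less than [s] and the index of the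
    first term that is not. *)
Definition below (l : nat -> R) (s : R) (n : nat) : Prop :=
  forall k, (l k < s) = (k < n)%N.

Lemma below_unique l s n m : below l s n -> below l s m -> n = m.
Proof.
move=> h1 h2; apply/eqP; rewrite eqn_leq; apply/andP; split; rewrite leqNgt; apply/negP => h.
- by have := h1 m; rewrite h2 ltnn h.
- by have := h2 n; rewrite h1 ltnn h.
Qed.

(** By monotonicity the indices with values in [s, t) form a run that starts at [n]; comparing [L]
    with segments of [iota], once by each inclusion, identifies its length. *)
Lemma below_seg l s t n (L : seq nat) : {homo l : j k / (j <= k)%N >-> j <= k} ->
  s <= t -> below l s n -> uniq L -> (forall k, (s <= l k < t) <-> k \in L) ->
  below l t (n + size L).
Proof.
move=> hl st bs uL HL k; apply/idP/idP.
- move=> kt; have [kn|nk] := ltnP k n; first exact: ltn_addr.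
  have sub : {subset iota n (k - n).+1 <= L}.
    move=> i; rewrite mem_iota => /andP[ni ik]; apply/HL; apply/andP; split.
      by rewrite leNgt bs -leqNgt.
    by apply: le_lt_trans kt; apply: hl; lia.
  have := uniq_leq_size (iota_uniq _ _) sub; rewrite size_iota => h.
  by rewrite -(subnKC nk) ltn_add2l.
- move=> km; rewrite ltNge; apply/negP => tk.
  have nk : (n <= k)%N by rewrite leqNgt -bs -leNgt (le_trans st).
  have sub : {subset L <= iota n (k - n)}.
    move=> i /HL/andP[si it]; rewrite mem_iota; apply/andP; split.
      by rewrite leqNgt -bs -leNgt.
    rewrite subnKC// ltnNge; apply/negP => ki.
    by have := le_lt_trans (le_trans tk (hl _ _ ki)) it; rewrite ltxx.
  have := uniq_leq_size uL sub; rewrite size_iota leqNgt => /negP; apply.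
  by rewrite ltn_subLR.
Qed.

Lemma lipschitz_continuous (f : R -> R) D : (forall x y, `|f x - f y| <= D * `|x - y|) ->
  continuous f.
Proof.
move=> fD x; apply/cvgrPdist_lt => e e0.
have D1 : 0 < `|D| + 1 by rewrite ltr_wpDl.
have dr : 0 < e / (`|D| + 1) by rewrite divr_gt0.
exists (e / (`|D| + 1)) => //= t xt.
apply: le_lt_trans (fD x t) _; apply: le_lt_trans (_ : (`|D| + 1) * `|x - t| < _).
  by rewrite ler_wpM2r//; have := ler_norm D; lra.
by rewrite mulrC -ltr_pdivlMr.
Qed.

Lemma lipschitz_IVT (f : R -> R) (D s t : R) :
  (forall x y, s <= x <= t -> s <= y <= t -> `|f x - f y| <= D * `|x - y|) ->
  s < t -> f s < 0 -> 0 < f t -> exists2 c : R, s < c < t & f c = 0.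
Proof.
move=> fD st fs ft.
have D0 : 0 <= D.
  have sI : s <= s <= t by rewrite lexx ltW.
  have tI : s <= t <= t by rewrite lexx ltW.
  have := le_trans (normr_ge0 _) (fD _ _ sI tI).
  by rewrite pmulr_lge0// normr_gt0 subr_eq0 lt_eqF.
have cl x y : `|clamp s t x - clamp s t y| <= `|x - y|.
  wlog xy : x y / x <= y.
    by move=> H; have [/H//|/ltW/H] := leP x y; rewrite distrC [`|y - x|]distrC.
  rewrite [X in _ <= X]distrC [`|y - x|]ger0_norm ?subr_ge0// ler_norml /clamp.
  have mx u w : u <= w -> 0 <= Num.max s w - Num.max s u <= w - u.
    by move=> uw; case: (leP s u) => ?; case: (leP s w) => ?; apply/andP; split; lra.
  have mn u w : u <= w -> 0 <= Num.min w t - Num.min u t <= w - u.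
    by move=> uw; case: (leP u t) => ?; case: (leP w t) => ?; apply/andP; split; lra.
  have /andP[a1 a2] := mn x y xy; rewrite subr_ge0 in a1.
  by have /andP[a3 a4] := mx _ _ a1; apply/andP; split; lra.
have cg : continuous (fun x => f (clamp s t x)).
  apply: (@lipschitz_continuous _ D) => x y; apply: le_trans (fD _ _ _ _) _.
  - exact/clamp_in/ltW.
  - exact/clamp_in/ltW.
  - by rewrite ler_wpM2l.
have [c cI c0] : exists2 c, c \in `[s, t] & f (clamp s t c) = 0.
  apply: IVT; [exact: ltW|exact: continuous_subspaceT|].
  have es : clamp s t s = s by apply: clamp_id; rewrite lexx ltW.
  have et : clamp s t t = t by apply: clamp_id; rewrite lexx ltW.
  by rewrite es et ge_min le_max (ltW fs) (ltW ft) orbT.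
move: cI; rewrite in_itv/= => cI; rewrite clamp_id// in c0.
exists c => //; case/andP: cI; rewrite !le_eqVlt => /orP[/eqP sc|->] /orP[/eqP ct|->]//.
- by move: st; rewrite sc ct ltxx.
- by move: fs; rewrite sc c0 ltxx.
- by move: ft; rewrite -{1}ct c0 ltxx.
Qed.

(** An increasing branch that is nonzero at both ends has one zero in between if it changes sign,
    and none otherwise. Since multiplicities count vanishing branches, the number of eigenvalues
    passed is read off from signs at [s] and [t], which are stable under small perturbations. *)
Lemma below_step (l : nat -> R) (m1 m2 : R -> R) (D s t : R) n :
  {homo l : j k / (j <= k)%N >-> j <= k} -> s < t ->
  (forall x y, s <= x <= t -> s <= y <= t -> `|m1 x - m1 y| <= D * `|x - y|) ->
  (forall x y, s <= x <= t -> s <= y <= t -> `|m2 x - m2 y| <= D * `|x - y|) ->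
  (forall x y, s <= x -> x < y -> y <= t -> m1 x < m1 y /\ m2 x < m2 y) ->
  (forall mu, s <= mu <= t -> ([set k | l k = mu] #= `I_((m1 mu == 0%R) + (m2 mu == 0%R))%N)%card) ->
  m1 s != 0 -> m2 s != 0 -> m1 t != 0 -> m2 t != 0 -> below l s n ->
  below l t (n + ((m1 s < 0%R < m1 t)%R + (m2 s < 0%R < m2 t)%R))%N.
Proof.
move=> hl st l1 l2 mono mult s1 s2 t1 t2 bs.
have monoi (m : R -> R) : (m = m1 \/ m = m2) -> forall x y, s <= x -> x < y -> y <= t -> m x < m y.
  by case=> -> x y sx xy yt; have [] := mono x y sx xy yt.
have zero (m : R -> R) : (m = m1 \/ m = m2) -> m s != 0 -> m t != 0 ->
    if (m s < 0 < m t) then exists2 c, s < c < t & forall x, s <= x <= t -> (m x == 0) = (x == c)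
    else forall x, s <= x <= t -> (m x == 0) = false.
  move=> mi ms mt; have mo := monoi m mi; case: ifPn => [/andP[h1 h2]|h].
  - have [c cI mc] : exists2 c, s < c < t & m c = 0.
      by case: mi => mE; rewrite mE in h1 h2 *; apply: (@lipschitz_IVT _ D).
    exists c => // x /andP[sx xt]; apply/idP/idP => [/eqP mx|/eqP ->]; last by rewrite mc.
    case/andP: cI => sc ct; have [xc|cx|//] := ltgtP x c.
    + by have := mo x c sx xc (ltW ct); rewrite mx mc ltxx.
    + by have := mo c x (ltW sc) cx xt; rewrite mx mc ltxx.
  - move=> x /andP[sx xt]; apply/negP => /eqP mx; move: h; apply/negP; rewrite negbK.
    have hs : s != x by apply: contraNneq ms => ->; rewrite mx.
    have ht : x != t by apply: contraNneq mt => <-; rewrite mx.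
    have lsx : s < x by rewrite lt_neqAle hs.
    have lxt : x < t by rewrite lt_neqAle ht.
    by have h1 := mo s x (lexx s) lsx xt; have h2 := mo x t sx lxt (lexx t); rewrite mx in h1 h2; rewrite h1.
suff [L [uL sL HL]] : exists L : seq nat, [/\ uniq L,
    size L = ((m1 s < 0%R < m1 t)%R + (m2 s < 0%R < m2 t)%R)%N & forall k, (s <= l k < t) <-> k \in L].
  by rewrite -sL; exact: below_seg (ltW st) bs uL HL.
have nt k : (s <= l k < t) -> (m1 (l k) == 0) || (m2 (l k) == 0).
  move=> /andP[sk kt]; have kI : s <= l k <= t by rewrite sk ltW.
  have [L [_ sL HL]] := card_list (mult _ kI).
  have kL : k \in L by apply/HL.
  by move: sL kL; case: (_ == 0); case: (_ == 0) => //; case: L {HL}.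
have z1 := zero m1 (or_introl erefl) s1 t1.
have z2 := zero m2 (or_intror erefl) s2 t2.
have inI k : (s <= l k < t) -> (s <= l k <= t) by move=> /andP[-> /ltW].
have oo c : s < c < t -> s <= c <= t by move=> /andP[/ltW-> /ltW].
have oc c : s < c < t -> s <= c < t by move=> /andP[/ltW-> ->].
case: ifP z1 => [b1 [c1 c1I z1]|b1 z1]; case: ifP z2 => [b2 [c2 c2I z2]|b2 z2] /=.
(* A common zero is one eigenvalue of multiplicity two; distinct zeros give two disjoint lists of
   indices. *)
- have [e|ne] := eqVneq c1 c2.
  + have := mult c1 (oo _ c1I); rewrite (z1 _ (oo _ c1I)) (z2 _ (oo _ c1I)) e eqxx /= -e.
    move=> /card_list[L [uL sL HL]]; exists L; split => // k; split.
    * move=> kI; apply/HL; have := nt k kI; rewrite (z1 _ (inI _ kI)) (z2 _ (inI _ kI)) e orbb.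
      by move=> /eqP.
    * by move=> /HL ->; exact: oc.
  + have := mult c1 (oo _ c1I); rewrite (z1 _ (oo _ c1I)) (z2 _ (oo _ c1I)) eqxx (negbTE ne) /=.
    move=> /card_list[L1 [u1 sz1 H1]].
    have := mult c2 (oo _ c2I); rewrite (z1 _ (oo _ c2I)) (z2 _ (oo _ c2I)) eqxx eq_sym (negbTE ne) /=.
    move=> /card_list[L2 [u2 sz2 H2]].
    exists (L1 ++ L2); split.
    * rewrite cat_uniq u1 u2 andbT; apply/hasPn => k /H2 k2; apply/negP => /H1 k1.
      by move: ne; rewrite -k1 -k2 eqxx.
    * by rewrite size_cat sz1 sz2.
    * move=> k; rewrite mem_cat; split.
      - move=> kI; have := nt k kI; rewrite (z1 _ (inI _ kI)) (z2 _ (inI _ kI)).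
        by move=> /orP[] /eqP h; apply/orP; [left; apply/H1|right; apply/H2].
      - by move=> /orP[/H1 ->|/H2 ->]; exact: oc.
- have := mult c1 (oo _ c1I); rewrite (z1 _ (oo _ c1I)) (z2 _ (oo _ c1I)) eqxx /=.
  move=> /card_list[L [uL sL HL]]; exists L; split => // k; split.
  + move=> kI; apply/HL; have := nt k kI; rewrite (z1 _ (inI _ kI)) (z2 _ (inI _ kI)) orbF.
    by move=> /eqP.
  + by move=> /HL ->; exact: oc.
- have := mult c2 (oo _ c2I); rewrite (z1 _ (oo _ c2I)) (z2 _ (oo _ c2I)) eqxx /=.
  move=> /card_list[L [uL sL HL]]; exists L; split => // k; split.
  + move=> kI; apply/HL; have := nt k kI; rewrite (z1 _ (inI _ kI)) (z2 _ (inI _ kI)) /=.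
    by move=> /eqP.
  + by move=> /HL ->; exact: oc.
- exists [::]; split => // k; split => // kI.
  by have := nt k kI; rewrite (z1 _ (inI _ kI)) (z2 _ (inI _ kI)).
Qed.

(** Connectedness of a segment for a property that is propagated only between good points. Near the
    supremum of the good points reached, either [y] itself is in range, or density supplies a good
    point beyond the supremum, a contradiction. *)
Lemma chain (P good : R -> Prop) (x y : R) : x <= y ->
  (forall z : R, x <= z <= y -> exists2 r : R, 0 < r & forall s t : R, good s -> good t ->
     z - r < s -> s < t -> t < z + r -> x <= s -> t <= y -> P s -> P t) ->
  (forall z r : R, x <= z <= y -> 0 < r -> exists2 t : R, z < t < z + r & good t) ->
  good x -> good y -> P x -> P y.
Proof.
move=> xy loc dense gx gy Px.
pose E := [set s | [/\ x <= s <= y, good s & P s]].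
have Ex : E x by split => //; rewrite lexx xy.
have E0 : E !=set0 by exists x.
have ubE : ubound E y by move=> s [/andP[]].
have hsup : has_sup E by split => //; exists y.
set T := sup E.
have xT : x <= T by apply: ub_le_sup => //; exists y.
have Ty : T <= y by exact: ge_sup.
have TI : x <= T <= y by rewrite xT Ty.
have [r r0 H] := loc T TI.
have [s [/andP[xs sy] gs Ps] Trs] := sup_adherent r0 hsup.
have sT : s <= T by apply: ub_le_sup; [exists y|split => //; rewrite xs sy].
have [->//|sny] := eqVneq y s.
have sly : s < y by rewrite lt_neqAle eq_sym sny.
have [yT|Try] := ltP y (T + r); first exact: (H s y).
have [t /andP[Tt tTr] gt] := dense T r TI r0.
have Pt : P t.
  apply: (H s t) => //; [exact: le_lt_trans Tt|exact: ltW (lt_le_trans tTr Try)].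
have : t <= T.
  apply: ub_le_sup; first by exists y.
  by split => //; rewrite (le_trans xT (ltW Tt)) (ltW (lt_le_trans tTr Try)).
by rewrite leNgt Tt.
Qed.

End Counting.

Lemma three_points (R : realType) (z r r' : R) : 0 < r -> 0 < r' ->
  exists d, [/\ z + d < z + 2 * d, z + 2 * d < z + 3 * d, `|z + d - z| < r',
    `|z + 2 * d - z| < r' & `|z + 3 * d - z| < r'] /\
    [/\ z < z + d < z + r, z < z + 2 * d < z + r & z < z + 3 * d < z + r].
Proof.
move=> r0 r'0; pose d : R := Num.min r r' / 4.
have d0 : 0 < d by rewrite /d divr_gt0// lt_min r0.
have dr : 4 * d <= r by rewrite /d mulrC divfK// ge_min lexx.
have dr' : 4 * d <= r' by rewrite /d mulrC divfK// ge_min lexx orbT.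
by exists d; clearbody d; split; split; rewrite ?ltr_norml; try (apply/andP; split); lra.
Qed.

(** Two increasing functions have at most one zero each, so of three points one avoids both. With
    [three_points] this makes the levels that are not eigenvalues dense. *)
Lemma two_zeros (R : realType) (x1 x2 x3 y1 y2 y3 : R) : x1 < x2 -> x2 < x3 -> y1 < y2 -> y2 < y3 ->
  x1 == 0 \/ y1 == 0 -> x2 == 0 \/ y2 == 0 -> x3 != 0 /\ y3 != 0.
Proof.
move=> h1 h2 h3 h4 c1 c2.
by split; apply/eqP => e; case: c1 c2 => /eqP c1 [] /eqP c2; lra.
Qed.

Section CountConstant.
Variables (R : realType) (a b : R).
Hypotheses (a_lt0 : a < 0) (b_gt0 : 0 < b).
Let ab : a < b. Proof. exact: lt_trans b_gt0. Qed.

(** Integration by parts: [H] vanishes at both ends while its derivative y''^2 - p y^2 is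
    nonnegative, so both terms are zero. This bounds the spectrum from below. *)
Lemma eigfun_coef_lt0 p y : bounded_coef p -> (forall x, a <= x <= b -> p x < 0) ->
  eigfun a b p y -> forall x, y 0%N x = 0.
Proof.
move=> gp pneg [sy y0 y1 y0b y1b] x.
have [d1 d2] := sy.
pose H t := y 2%N t * y 1%N t - y 3%N t * y 0%N t.
have dH t : der H t (y 2%N t * y 2%N t - p t * (y 0%N t * y 0%N t)).
  apply: der_eq (derB (derM (d1 2%N t isT) (d1 1%N t isT)) (derM (d2 t) (d1 0%N t isT))) _.
  by ring.
have sq (u : R) : 0 <= u * u by rewrite -expr2 sqr_ge0.
have dH0 t : a <= t <= b -> 0 <= y 2%N t * y 2%N t - p t * (y 0%N t * y 0%N t).
  move=> tI; have := mulr_ge0_le0 (sq (y 0%N t)) (ltW (pneg t tI)); have := sq (y 2%N t).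
  by rewrite [p t * _]mulrC; lra.
have Ha : H a = 0 by rewrite /H y0 y1 !mulr0 subrr.
have Hb : H b = 0 by rewrite /H y0b y1b !mulr0 subrr.
have H0 t : a < t < b -> 0 = H t.
  move=> /andP[/ltW at_ /ltW tb].
  have h1 : H a <= H t.
    apply: (der_le at_ (fun s _ => dH s)) => s /andP[? st]; apply: dH0.
    by apply/andP; split => //; exact: le_trans tb.
  have h2 : H t <= H b.
    apply: (der_le tb (fun s _ => dH s)) => s /andP[ts ?]; apply: dH0.
    by apply/andP; split => //; exact: le_trans ts.
  by apply/eqP; rewrite eq_le -{1}Ha h1/= -Hb.
apply: (sol_eq0 gp sy ab) => // t tI.
have := der_congr tI H0 (derC 0 t) => /der_derive1[_].
have [_ ->] := der_derive1 (dH t) => e.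
have tI' : a <= t <= b by case/andP: tI => /ltW -> /ltW ->.
have pt := pneg t tI'.
have k1 := sq (y 2%N t); have k2 := mulr_ge0_le0 (sq (y 0%N t)) (ltW pt).
have : y 0%N t * y 0%N t * p t = 0 by rewrite [p t * _]mulrC in e; lra.
by move=> /eqP; rewrite mulf_eq0 (lt_eqF pt) orbF mulf_eq0 orbb => /eqP.
Qed.

Variables (v : R -> R -> R) (L : R) (lam : R -> nat -> R).
Hypotheses (aL : `|a| <= L) (bL : `|b| <= L).
Hypothesis v_coef : forall e : R, 0 < e -> e < 1 -> bounded_coef (v e).
Hypothesis v_lip : forall e0 : R, 0 < e0 -> e0 < 1 -> exists r C : R, [/\ 0 < r, 0 <= C,
  forall e : R, `|e - e0| < r -> 0 < e < 1 &
  forall e e' x : R, `|e - e0| < r -> `|e' - e0| < r -> `|x| <= L ->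
    `|v e x - v e' x| <= C * `|e - e'|].
Hypothesis lam_homo : forall e : R, 0 < e -> e < 1 -> {homo lam e : j k / (j <= k)%N >-> j <= k}.
Hypothesis lam_mult : forall (e mu : R) n, 0 < e -> e < 1 ->
  has_dim `]a, b[%classic (real_eig a b (fun x => mu - v e x)) n ->
  ([set k | lam e k = mu] #= `I_n)%card.

(** The level is raised by [chain] from one below the spectrum up to [s0]. Inside a window of local
    branches the signs at two good levels do not change for [e] close to [e0], so neither does the
    number of eigenvalues between them. *)
Lemma count_locally_constant (e0 s0 : R) : 0 < e0 -> e0 < 1 -> (forall k, lam e0 k != s0) ->
  exists n (r : R), 0 < r /\ forall e : R, `|e - e0| < r -> below (lam e) s0 n.
Proof.
move=> e0_gt0 e0_lt1 ns0.
have [r0 [C [r0_gt0 C0 rI vl]]] := v_lip e0_gt0 e0_lt1.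
have vc e : `|e - e0| < r0 -> bounded_coef (v e).
  by move=> /rI/andP[? ?]; exact: v_coef.
have br mu := @local_branches R a b a_lt0 b_gt0 v e0 mu r0 C L r0_gt0 C0 aL bL vc vl.
pose good (mu : R) := forall k, lam e0 k != mu.
pose P (mu : R) := exists n (r : R), 0 < r /\ forall e : R, `|e - e0| < r -> below (lam e) mu n.
have e00 : `|e0 - e0| < r0 by rewrite subrr normr0.
have [_ [B vB]] := vc e0 e00.
(* Up to this level [mu - v e] is negative on [a, b] for all [e] within [r0] of [e0], as
   [B + C * r0] bounds [v e] there; the term [s0 - 1] ensures [s1 <= s0]. *)
pose s1 : R := Num.min (s0 - 1) (- B - C * r0 - 1).
have low (e : R) k : `|e - e0| < r0 -> s1 < lam e k.
  move=> er; have /andP[e_gt0 e_lt1] := rI e er; rewrite ltNge; apply/negP => ks.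
  have gp : bounded_coef (fun x => lam e k - v e x).
    apply: bounded_coefD; first exact: bounded_coef_cst.
    rewrite (_ : (fun x => - v e x) = fun x => -1 * v e x); last first.
      by apply/funext => x; rewrite mulN1r.
    by apply: bounded_coefZ; exact: vc.
  have d0 := eig_dim0 a_lt0 b_gt0 gp (fun y ey => eigfun_coef_lt0 gp _ ey).
  have {}d0 : has_dim `]a, b[%classic (real_eig a b (fun x => lam e k - v e x)) 0.
    apply: d0 => x /andP[ax xb].
    have xL : `|x| <= L.
      exact: itv_norm_le ax xb aL bL.
    have h1 := vl e e0 x er e00 xL; have h2 := vB x.
    have h3 : C * `|e - e0| <= C * r0 by rewrite ler_wpM2l// ltW.
    have h4 : s1 <= - B - C * r0 - 1 by rewrite /s1 ge_min lexx orbT.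
    move: h1 h2; rewrite !ler_norml => /andP[? ?] /andP[? ?]; lra.
  have h0 := lam_mult e_gt0 e_lt1 d0.
  have h1 := card_list h0.
  have [S [_ sS HS]] := h1.
  by have := (HS k).1 erefl; rewrite (size0nil sS).
have s1s0 : s1 <= s0 by rewrite /s1 ge_min; apply/orP; left; lra.
apply: (@chain R P good s1 s0 s1s0).
- move=> z _; have [r [m1 [m2 [D [r_gt0 rr0 dim mono lp]]]]] := br z.
  exists r => // s t gs gt zs st tz _ _ [n [rn [rn0 Hn]]].
  have sz : `|s - z| < r by rewrite ltr_distl zs (lt_trans st tz).
  have tz' : `|t - z| < r by rewrite ltr_distl (lt_trans zs st) tz.
  have e0r : `|e0 - e0| < r by rewrite subrr normr0.
  have nz (u : R) : good u -> `|u - z| < r -> m1 e0 u != 0 /\ m2 e0 u != 0.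
    move=> gu uz; have := lam_mult e0_gt0 e0_lt1 (dim e0 u e0r uz) => /card_list[S [_ sS HS]].
    have SE : S = [::].
      by case: S sS HS => // k S _ /(_ k)[_]; rewrite mem_head => /(_ isT) h; have := gu k; rewrite h eqxx.
    by move: sS; rewrite SE; case: (m1 e0 u == 0%R); case: (m2 e0 u == 0%R).
  have [s1n s2n] := nz s gs sz; have [t1n t2n] := nz t gt tz'.
  have D0 : 0 <= D.
    have [h _] := lp e0 s e0 t e0r sz e0r tz'.
    have := le_trans (normr_ge0 _) h; rewrite subrr normr0 add0r pmulr_lge0//.
    by rewrite normr_gt0 subr_eq0 lt_eqF.
  pose mm : R := Num.min (Num.min `|m1 e0 s| `|m2 e0 s|) (Num.min `|m1 e0 t| `|m2 e0 t|).
  have mm0 : 0 < mm by rewrite /mm !lt_min !normr_gt0 s1n s2n t1n t2n.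
  (* Within this radius the branches at [s] and [t] move by less than [mm], their smallest modulus
     at [e0], so none of them changes sign. *)
  pose r2 : R := Num.min (Num.min r rn) (mm / (D + 1)).
  have D1 : 0 < D + 1 by rewrite ltr_wpDl.
  have r20 : 0 < r2 by rewrite /r2 !lt_min r_gt0 rn0 divr_gt0.
  exists (n + ((m1 e0 s < 0%R < m1 e0 t)%R + (m2 e0 s < 0%R < m2 e0 t)%R))%N, r2; split => // e er2.
  have er : `|e - e0| < r by apply: lt_le_trans er2 _; rewrite /r2 !ge_min lexx.
  have ern : `|e - e0| < rn by apply: lt_le_trans er2 _; rewrite /r2 !ge_min lexx orbT.
  have emm : D * `|e - e0| < mm.
    apply: le_lt_trans (_ : (D + 1) * `|e - e0| < _); first by rewrite ler_wpM2r// lerDl.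
    rewrite mulrC -ltr_pdivlMr//; apply: lt_le_trans er2 _.
    by rewrite /r2 ge_min lexx orbT.
  have /andP[e_gt0 e_lt1] := rI e (lt_le_trans er rr0).
  have sgn (x y : R) : `|x - y| <= D * `|e - e0| -> mm <= `|y| ->
      ((x < 0) = (y < 0)) /\ ((0 < x) = (0 < y)) /\ x != 0.
    move=> h1 h2; have : `|x - y| < `|y| by apply: le_lt_trans h1 _; exact: lt_le_trans h2.
    have [y0|y0] := leP 0 y.
      rewrite (ger0_norm y0) ltr_norml => /andP[h3 h4].
      have x0 : 0 < x by move: h3; rewrite ltrBrDr addNr.
      have y00 : 0 < y.
        by rewrite lt0r y0 andbT; apply/eqP => yE; move: (lt_trans h3 h4); rewrite yE oppr0 ltxx.
      by rewrite x0 y00 (gt_eqF x0) ltNge (ltW x0).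
    rewrite (ltr0_norm y0) ltr_norml => /andP[h3 h4].
    have x0 : x < 0 by move: h4; rewrite ltrBlDr addNr.
    by rewrite x0 (lt_eqF x0) [0 < x]ltNge [0 < y]ltNge (ltW x0) (ltW y0).
  have [ls1 ls2] := lp e s e0 s er sz e0r sz; rewrite subrr normr0 addr0 in ls1 ls2.
  have [lt1 lt2] := lp e t e0 t er tz' e0r tz'; rewrite subrr normr0 addr0 in lt1 lt2.
  have b1 : mm <= `|m1 e0 s| by rewrite /mm !ge_min lexx.
  have b2 : mm <= `|m2 e0 s| by rewrite /mm !ge_min lexx orbT.
  have b3 : mm <= `|m1 e0 t| by rewrite /mm !ge_min lexx !orbT.
  have b4 : mm <= `|m2 e0 t| by rewrite /mm !ge_min lexx !orbT.
  have [q1 [_ w1]] := sgn _ _ ls1 b1.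
  have [q2 [_ w2]] := sgn _ _ ls2 b2.
  have [_ [q3 w3]] := sgn _ _ lt1 b3.
  have [_ [q4 w4]] := sgn _ _ lt2 b4.
  have inr (x : R) : s <= x <= t -> `|x - z| < r.
    by move=> /andP[h1 h2]; rewrite ltr_distl (lt_le_trans zs h1) (le_lt_trans h2 tz).
  rewrite -q1 -q2 -q3 -q4.
  apply: (@below_step R (lam e) (m1 e) (m2 e) D) => //.
  + exact: lam_homo.
  + move=> x y xI yI; have [h _] := lp e x e y er (inr _ xI) er (inr _ yI).
    by rewrite subrr normr0 add0r in h.
  + move=> x y xI yI; have [_ h] := lp e x e y er (inr _ xI) er (inr _ yI).
    by rewrite subrr normr0 add0r in h.
  + move=> x y sx xy yt; apply: mono => //; apply: inr; rewrite ?sx ?yt ?(le_trans sx (ltW xy)) ?(le_trans (ltW xy) yt)//.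
  + by move=> mu muI; apply: lam_mult => //; exact: dim er (inr _ muI).
  + by apply: Hn.
- move=> z r _ r_gt0; have [r' [m1 [m2 [D [r'_gt0 _ dim mono _]]]]] := br z.
  have e0r : `|e0 - e0| < r' by rewrite subrr normr0.
  have [d [[d1 d2 b1 b2 b3] [t1 t2 t3]]] := three_points z r_gt0 r'_gt0.
  have gd (u : R) : `|u - z| < r' -> m1 e0 u != 0 -> m2 e0 u != 0 -> good u.
    move=> uz u1 u2 k; have := lam_mult e0_gt0 e0_lt1 (dim e0 u e0r uz).
    rewrite (negbTE u1) (negbTE u2) => /card_list[S [_ sS HS]].
    by apply/eqP => h; have := (HS k).1 h; rewrite (size0nil sS).
  have [M1 M2] := mono e0 _ _ e0r b1 b2 d1.
  have [M3 M4] := mono e0 _ _ e0r b2 b3 d2.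
  have [n1|/nandP n1] := boolP ((m1 e0 (z + d) != 0) && (m2 e0 (z + d) != 0)).
    by case/andP: n1 => ? ?; exists (z + d) => //; exact: gd.
  have [n2|/nandP n2] := boolP ((m1 e0 (z + 2 * d) != 0) && (m2 e0 (z + 2 * d) != 0)).
    by case/andP: n2 => ? ?; exists (z + 2 * d) => //; exact: gd.
  rewrite !negbK in n1 n2.
  have [u1 u2] := two_zeros M1 M3 M2 M4 n1 n2.
  by exists (z + 3 * d) => //; exact: gd.
- by move=> k; rewrite gt_eqF// low.
- exact: ns0.
- exists 0%N, r0; split => // e er k; rewrite ltn0; apply/negbTE.
  by rewrite -leNgt ltW// low.
Qed.

(** A locally constant count on an interval is constant: [chain] is run in the variable [e], with
    every point good, between [e1 / 2] and any other point. *)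
Lemma count_constant (e1 s0 : R) : 0 < e1 -> e1 <= 1 ->
  (forall e : R, 0 < e -> e < e1 -> forall k, lam e k != s0) ->
  exists n, forall e : R, 0 < e -> e < e1 -> below (lam e) s0 n.
Proof.
move=> e1_gt0 e1_le1 ns.
have loc (e : R) : 0 < e -> e < e1 -> exists n (r : R), 0 < r /\ forall e' : R, `|e' - e| < r -> below (lam e') s0 n.
  by move=> e_gt0 e_lt; apply: count_locally_constant => //; [exact: lt_le_trans e1_le1|exact: ns].
have step n (x y : R) : 0 < x -> x <= y -> y < e1 -> below (lam x) s0 n -> below (lam y) s0 n.
  move=> x_gt0 xy ye1.
  apply: (@chain R (fun e => below (lam e) s0 n) (fun=> True)) => //.
  - move=> z /andP[xz zy]; have [m [r [r0 H]]] := loc z (lt_le_trans x_gt0 xz) (le_lt_trans zy ye1).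
    exists r => // s t _ _ h1 h2 h3 _ _ bs.
    have bs' : below (lam s) s0 m by apply: H; rewrite ltr_norml; apply/andP; split; lra.
    rewrite (below_unique bs bs'); apply: H; rewrite ltr_norml; apply/andP; split; lra.
  - move=> z r _ r0; exists (z + r / 2) => //; apply/andP; split; lra.
pose e2 : R := e1 / 2.
have e2_gt0 : 0 < e2 by rewrite divr_gt0.
have e2_lt : e2 < e1 by rewrite /e2; lra.
have [n [r [r0 H]]] := loc e2 e2_gt0 e2_lt.
have b2 : below (lam e2) s0 n by apply: H; rewrite subrr normr0.
exists n => e e_gt0 e_lt; have [h|/ltW h] := leP e2 e; first exact: (step n e2 e).
have [m [r' [r'0 H']]] := loc e e_gt0 e_lt.
have be : below (lam e) s0 m by apply: H'; rewrite subrr normr0.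
by rewrite (below_unique b2 (step m e e2 e_gt0 h e2_lt be)).
Qed.

End CountConstant.

(** * Dual bases of the inner problem *)

Section ParameterDistance.
Variables (R : realType) (lam : R).

(* Families depending on (eps, mu) converge as eps -> 0 at rate O(eps), while no
   continuity in eps is available uniformly near 0; being Lipschitz for this
   distance expresses exactly that. *)
Definition pdist (t s : R * R) : R :=
  (if t.1 == s.1 then 0 else `|t.1| + `|s.1|) + `|t.2 - s.2|.

Definition pbox (e1 : R) : set (R * R) :=
  [set t | 0 <= t.1 <= e1 /\ `|t.2 - lam| <= 1].

Lemma pdist_ge0 t s : 0 <= pdist t s.
Proof. by rewrite /pdist addr_ge0//; case: ifP => // _; rewrite addr_ge0. Qed.

Lemma pbox_le e1 e2 : e1 <= e2 -> pbox e1 `<=` pbox e2.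
Proof. by move=> e12 t [/andP[h1 h2] h3]; split => //; rewrite h1 (le_trans h2). Qed.

Lemma pbox0 e1 t : 0 <= e1 -> pbox e1 t -> pbox e1 (0, t.2).
Proof. by move=> e10 [_ h]; split => //=; rewrite lexx. Qed.

Lemma pbox_limit e1 : 0 <= e1 -> pbox e1 (0, lam).
Proof. by move=> e10; split; rewrite /= ?lexx// subrr normr0. Qed.

Lemma pdist0 e1 t : pbox e1 t -> pdist t (0, t.2) <= t.1.
Proof.
move=> [/andP[h1 _] _]; rewrite /pdist /= subrr normr0 !addr0.
by case: ifP => // _; rewrite ger0_norm.
Qed.

Lemma pdist_same e mu mu' : pdist (e, mu) (e, mu') = `|mu - mu'|.
Proof. by rewrite /pdist eqxx add0r. Qed.

(** Two different values of eps are compared through eps = 0, at the cost of their sum, which is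
    just what [pdist] charges. *)
Lemma lip_criterion e1 C (h : R * R -> R) : 0 <= e1 -> 0 <= C ->
  (forall t, pbox e1 t -> `|h t| <= C) ->
  (forall e mu mu', pbox e1 (e, mu) -> pbox e1 (e, mu') -> `|h (e, mu) - h (e, mu')| <= C * `|mu - mu'|) ->
  (forall t, pbox e1 t -> `|h t - h (0, t.2)| <= C * t.1) ->
  lip (pbox e1) pdist C h.
Proof.
move=> e10 C0 h1 h2 h3; split => // -[e mu] [e' mu'] At As; rewrite /pdist /=.
have [ee|ee] := eqVneq e e'; first by rewrite add0r; rewrite -ee in As *; exact: h2.
have d1 := h3 _ At; have d2 := h3 _ As; rewrite /= in d1 d2.
have d3 := h2 0 mu mu' (pbox0 e10 At) (pbox0 e10 As).
rewrite (_ : _ - _ = (h (e, mu) - h (0, mu)) + (h (0, mu) - h (0, mu'))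
  - (h (e', mu') - h (0, mu'))); last by ring.
apply: le_trans (ler_normB _ _) _; apply: le_trans (lerD (ler_normD _ _) (lexx _)) _.
have [[/andP[/= n1 _] _] [/andP[/= n2 _] _]] := (At, As).
apply: le_trans (lerD (lerD d1 d3) d2) _.
by rewrite (ger0_norm n1) (ger0_norm n2) le_eqVlt; apply/orP; left; apply/eqP; ring.
Qed.

Lemma lip_eps e1 : 0 <= e1 -> lip (pbox e1) pdist (e1 + 1) (fun t => t.1).
Proof.
move=> e10; apply: lip_criterion => //; first by rewrite addr_ge0.
- by move=> t [/andP[h1 h2] _]; rewrite ger0_norm// (le_trans h2)// lerDl.
- by move=> e mu mu' _ _; rewrite /= subrr normr0 mulr_ge0// addr_ge0.
- move=> t [/andP[h1 _] _] /=; rewrite subr0 ger0_norm//.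
  by rewrite ler_peMl// lerDr.
Qed.

(** The constant is uniform in [x], as is needed for integrals in [x] and for bounds at points that
    depend on eps. *)
Definition ulip (A : set (R * R)) (S : Type) (X : set S) (h : S -> R * R -> R) : Prop :=
  exists C, forall x, X x -> lip A pdist C (h x).

Variable A : set (R * R).

Lemma ulip_cst (S : Type) (X : set S) h : lipc A pdist h -> ulip A X (fun=> h).
Proof. by move=> [C hC]; exists C. Qed.

Lemma ulip_fun (S : Type) (X : set S) (f : S -> R) B : (forall x, X x -> `|f x| <= B) ->
  ulip A X (fun x _ => f x).
Proof.
move=> fB; exists B => x /fB xB.
by apply: (lip_le pdist_ge0 xB); exact: (lip_cst A (rho := pdist) pdist_ge0 (f x)).
Qed.

Lemma ulip_lipc (S : Type) (X : set S) h x : X x -> ulip A X h -> lipc A pdist (h x).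
Proof. by move=> Xx [C hC]; exists C; exact: hC. Qed.

Lemma ulipD (S : Type) (X : set S) h g : ulip A X h -> ulip A X g ->
  ulip A X (fun x t => h x t + g x t).
Proof. by move=> [C hC] [D gD]; exists (C + D) => x Xx; apply: lipD; [exact: hC|exact: gD]. Qed.

Lemma ulipM (S : Type) (X : set S) h g : ulip A X h -> ulip A X g ->
  ulip A X (fun x t => h x t * g x t).
Proof.
move=> [C hC] [D gD]; exists (2 * (C * D)) => x Xx.
by apply: lipM; [exact: hC|exact: gD].
Qed.

Lemma ulip_sum (S : Type) (X : set S) n (h : 'I_n -> S -> R * R -> R) :
  (forall i, ulip A X (h i)) -> ulip A X (fun x t => \sum_i h i x t).
Proof.
elim: n h => [|n IH] h H.
  exists 0 => x _; apply: (@lip_eq _ _ _ _ _ (fun=> 0)) => [t _|]; first by rewrite big_ord0.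
  by split => // *; rewrite ?normr0 ?mul0r// subrr normr0.
have [C hC] := ulipD (H ord0) (IH _ (fun i => H (lift ord0 i))).
by exists C => x Xx; apply: lip_eq (hC x Xx) => t _; rewrite big_ord_recl.
Qed.

Lemma ulip_eq (S : Type) (X : set S) h g : (forall x t, X x -> A t -> h x t = g x t) ->
  ulip A X h -> ulip A X g.
Proof. by move=> hg [C hC]; exists C => x Xx; apply: lip_eq (hC x Xx) => t; exact: hg. Qed.

Lemma ulip_sub (S : Type) (X : set S) (B : set (R * R)) h : B `<=` A -> ulip A X h -> ulip B X h.
Proof. by move=> BA [C hC]; exists C => x Xx; exact: lip_sub BA (hC x Xx). Qed.

Lemma lipc_sub (B : set (R * R)) h : B `<=` A -> lipc A pdist h -> lipc B pdist h.
Proof. by move=> BA [C hC]; exists C; exact: lip_sub BA hC. Qed.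

Lemma lipcX n h : lipc A pdist h -> lipc A pdist (fun t => h t ^+ n).
Proof.
move=> hl; elim: n => [|n IH]; first exact: lipc_cst pdist_ge0 1.
by apply: lipc_eq (lipcM hl IH) => t _; rewrite exprS.
Qed.

Lemma lipc_Int c d (h : R -> R * R -> R) : c < d ->
  (forall t, A t -> continuous (h ^~ t)) ->
  ulip A [set x | c <= x <= d] h -> lipc A pdist (fun t => Int c d (h ^~ t)).
Proof.
move=> cd ch [C hC]; exists (C * (d - c)).
have cI : c <= c <= d by rewrite lexx ltW.
have dc : 0 <= d - c by rewrite subr_ge0 ltW.
have [C0 _ _] := hC c cI.
have d0 t : A t -> Int c d (h ^~ t) = prim (h ^~ t) c d - prim (h ^~ t) c c.
  by move=> At; rewrite /Int (primP c (ch t At)).1 subr0.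
split; first by rewrite mulr_ge0.
- move=> t At; have := @Int_approx R c d cd (h ^~ t) (fun=> 0) (fun=> 0) C (ch t At).
  rewrite subrr sub0r normrN; apply; first by move=> x _; exact: derC.
  by move=> x xI; rewrite sub0r normrN; have [_ hb _] := hC x xI; exact: hb.
- move=> t s At As; rewrite (d0 t At).
  have := @Int_approx R c d cd (h ^~ s) (prim (h ^~ t) c) (h ^~ t) (C * pdist t s) (ch s As).
  rewrite (mulrAC C); apply; first by move=> x _; have [_ e] := primP c (ch t At); exact: e.
  by move=> x xI; have [_ _ hl] := hC x xI; exact: hl.
Qed.

Lemma lipc_near h (eta : R) : 0 < eta -> lipc A pdist h ->
  exists2 r : R, 0 < r & forall t s, A t -> A s -> pdist t s <= r -> `|h t - h s| <= eta.
Proof.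
move=> eta0 [C [C0 _ hl]]; have C1 : 0 < C + 1 by rewrite ltr_wpDl.
exists (eta / (C + 1)) => [|t s At As]; first by rewrite divr_gt0.
rewrite ler_pdivlMr// mulrDr mulr1 mulrC => tr.
by have := hl t s At As; have := pdist_ge0 t s; lra.
Qed.

Lemma lipc_away h (c : R) : 0 < c -> lipc A pdist h ->
  exists2 r : R, 0 < r & forall t s, A t -> A s -> pdist t s <= r -> c <= `|h s| -> c / 2 <= `|h t|.
Proof.
move=> c0 /(@lipc_near _ (c / 2))[|r r0 H]; first by rewrite divr_gt0.
exists r => // t s At As tr cs; have := H t s At As tr.
by have := ler_normB (h t) (h t - h s); rewrite opprB addrC subrK; lra.
Qed.

End ParameterDistance.

Section DualBasis.
Variables (R : realType) (lam : R) (q : R * R -> R -> R).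
Hypotheses (q_coef : forall t, bounded_coef (q t))
  (q_lip : ulip (pbox lam 1) [set: R] (fun x t => q t x))
  (q_limit : forall mu, q (0, mu) = q (0, lam)).

(* The four data at -1 and 1 by which solutions on [-1, 1] are parametrized; the
   order [sg] of the first one is 1 in the resonant case and 2 otherwise. *)
Definition dord (sg i : nat) : nat := nth 0%N [:: sg; 3; 2; 3]%N i.
Definition dpt (i : nat) : R := if (i < 2)%N then -1 else 1.
Definition datum sg (i : nat) (y : nat -> R -> R) : R := y (dord sg i) (dpt i).

Let seg : set R := [set x | -1 <= x <= 1].

Lemma dpt_seg i : seg (dpt i).
Proof. by rewrite /seg /dpt /=; case: ifP => _; apply/andP; split; lra. Qed.

Lemma dord_lt4 sg (i : 'I_4) : (sg < 4)%N -> (dord sg i < 4)%N.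
Proof. by case: i => [[|[|[|[|]]]]]. Qed.

Lemma fund_ulip k j : (k < 4)%N -> (j < 4)%N ->
  ulip (pbox lam 1) seg (fun x t => fund (q t) (-1) k j x).
Proof.
move=> k4 j4; have [C HC] := q_lip.
have [C0 _ _] := HC 0 I.
have [||C' HC'] := @lip_fund R _ (pbox lam 1) _ (@pdist_ge0 R) q C C 1 C0 C0 (fun t _ => q_coef t).
- by move=> t x At _; have [_ h _] := HC x I; exact: h.
- by move=> t s x At As _; have [_ _ h] := HC x I; exact: h.
exists C' => x xI; apply: HC' => //; first by rewrite normrN1.
by rewrite ler_norml.
Qed.

Variable sg : nat.
Hypothesis sg4 : (sg < 4)%N.
Hypothesis limit_nondeg : forall y, sol (q (0, lam)) y ->
  (forall i : 'I_4, datum sg i y = 0) -> forall k x, (k < 4)%N -> y k x = 0.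

Let H t : 'M[R]_4 := \matrix_(i, k) datum sg i (fund (q t) (-1) k).

Let H_lip (i k : 'I_4) : lipc (pbox lam 1) (@pdist R) (fun t => H t i k).
Proof.
have h := fund_ulip (ltn_ord k) (dord_lt4 i sg4).
have := ulip_lipc (dpt_seg i) h.
by apply: lipc_eq => t _; rewrite mxE.
Qed.

Let H_limit : \det (H (0, lam)) != 0.
Proof.
apply/negP; rewrite -det_tr => /det0P[c c0 cH]; move/negP: c0; apply.
pose y : nat -> R -> R := fun j x => \sum_(k < 4) c 0 k * fund (q (0, lam)) (-1) k j x.
have sy : sol (q (0, lam)) y by apply: sol_sum => k; exact: (fundP (-1) k (q_coef (0, lam))).1.
have y0 := limit_nondeg sy _.
apply/eqP/rowP => k; rewrite mxE -(y0 _ k (-1)) ?ltn_ord//.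
  rewrite /y (bigD1 k)//= big1 ?addr0.
    by rewrite (fundP (-1) k (q_coef (0, lam))).2// eqxx mulr1.
  move=> i ik; rewrite (fundP (-1) i (q_coef (0, lam))).2//.
  by rewrite eq_sym val_eqE (negbTE ik) mulr0.
move=> i; have := congr1 (fun M : 'rV_4 => M 0 i) cH; rewrite !mxE => h; rewrite -[RHS]h.
by rewrite /y /datum; apply: eq_bigr => m _; rewrite !mxE.
Qed.

(** The matrix [H] of the data on the fundamental system is invertible at eps = 0 by [limit_nondeg],
    and there it does not depend on [mu]. Its determinant is Lipschitz for [pdist], so it stays away
    from 0 for small eps uniformly in [mu]; the columns of the inverse give the basis. *)
Lemma dual_basis : exists (e1 : R) (om : R * R -> 'I_4 -> nat -> R -> R),
  [/\ 0 < e1 <= 1,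
    forall t k, pbox lam e1 t -> sol (q t) (om t k),
    forall t (i k : 'I_4), pbox lam e1 t -> datum sg i (om t k) = (i == k)%:R,
    forall j k, (j < 4)%N -> ulip (pbox lam e1) seg (fun x t => om t k j x) &
    forall t y, pbox lam e1 t -> sol (q t) y -> forall j x, (j < 4)%N ->
      y j x = \sum_(k < 4) datum sg k y * om t k j x].
Proof.
have det_lip := lipc_det (@pdist_ge0 R) H_lip.
have c0 : 0 < `|\det (H (0, lam))| by rewrite normr_gt0; exact: H_limit.
have [r r0 Hr] := lipc_away c0 det_lip.
pose e1 : R := Num.min 1 r.
have e1_gt0 : 0 < e1 by rewrite lt_min ltr01.
have e1_le1 : e1 <= 1 by rewrite ge_min lexx.
have e1_ler : e1 <= r by rewrite ge_min lexx orbT.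
have sub := @pbox_le R lam _ _ e1_le1.
have det_away t : pbox lam e1 t -> `|\det (H (0, lam))| / 2 <= `|\det (H t)|.
  move=> At; apply: (Hr t (0, t.2)); [exact: sub|exact: (pbox0 ler01 (sub _ At))| |].
    by apply: le_trans (pdist0 At) _; case: At => /andP[_ h] _; exact: le_trans e1_ler.
  by rewrite /H q_limit.
have c20 : 0 < `|\det (H (0, lam))| / 2 by rewrite divr_gt0.
have det_n0 t : pbox lam e1 t -> \det (H t) != 0.
  by move=> At; rewrite -normr_gt0 (lt_le_trans c20)// det_away.
(* The inverse through the adjugate, whose entries are polynomials in those of [H] and hence
   Lipschitz. *)
pose K t : 'M[R]_4 := (\det (H t))^-1 *: \adj (H t).
have KH t : pbox lam e1 t -> K t *m H t = 1%:M.
  move=> At; rewrite /K -scalemxAl mul_adj_mx.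
  by rewrite scale_scalar_mx mulVf// det_n0.
have HK t : pbox lam e1 t -> H t *m K t = 1%:M.
  by move=> At; apply: mulmx1C; exact: KH.
pose om t (k : 'I_4) (j : nat) x := \sum_(m < 4) K t m k * fund (q t) (-1) m j x.
have om_sol t k : sol (q t) (om t k).
  by apply: sol_sum => m; exact: (fundP (-1) m (q_coef t)).1.
have om_datum t (i k : 'I_4) : pbox lam e1 t -> datum sg i (om t k) = (i == k)%:R.
  move=> At; have := congr1 (fun M : 'M[R]_4 => M i k) (HK t At); rewrite !mxE => h; rewrite -[RHS]h.
  by rewrite /datum /om; apply: eq_bigr => m _; rewrite !mxE mulrC.
exists e1, om; split => //.
- by rewrite e1_gt0 e1_le1.
- move=> j k j4; apply: (@ulip_sum R (pbox lam e1) R seg 4 (fun m x t => K t m k * fund (q t) (-1) m j x)) => m.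
  apply: ulipM; last exact: ulip_sub sub (fund_ulip (ltn_ord m) j4).
  apply: ulip_cst; apply: (@lipc_eq _ _ _ _ (fun t => (\det (H t))^-1 * (\adj (H t)) m k)).
    by move=> t _; rewrite [RHS]mxE.
  apply: lipcM.
    by apply: (lipcV (@pdist_ge0 R) c20 det_away); exact: lipc_sub sub det_lip.
  by apply: (lipc_sub sub); exact: (@lipc_adj R _ _ _ (@pdist_ge0 R) 4 H H_lip m k).
- move=> t y At sy j x j4; have gp := q_coef t.
  pose c : 'cV[R]_4 := \col_m y m (-1).
  have dat (i : 'I_4) : datum sg i y = (H t *m c) i 0.
    rewrite mxE /datum (sol_expand (-1) gp sy) ?dord_lt4// /comb.
    by apply: eq_bigr => m _; rewrite !mxE mulrC.
  have cE : c = K t *m (H t *m c) by rewrite mulmxA KH// mul1mx.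
  rewrite (sol_expand (-1) gp sy)// /comb /om.
  under [RHS]eq_bigr do rewrite mulr_sumr.
  rewrite exchange_big /=; apply: eq_bigr => m _.
  have -> : y m (-1) = c m 0 by rewrite mxE.
  rewrite cE mxE mulr_suml; apply: eq_bigr => k _.
  by rewrite -dat mulrCA mulrA.
Qed.

End DualBasis.

(** * Convergence of the interface relation *)

Lemma Rintegral_Int (R : realType) (f : R -> R) c d : continuous f -> c < d ->
  \int[@lebesgue_measure R]_(x in `]c, d[) f x = Int c d f.
Proof.
move=> cf cd.
have fi : (@lebesgue_measure R).-integrable `[c, d] (EFin \o f).
  apply: continuous_compact_integrable; first exact: segment_compact.
  exact: continuous_subspaceT.
rewrite Rintegral_itv_obnd_cbnd; last first.
  by apply: integrableS fi => // t /=; rewrite !in_itv/= => /andP[/ltW -> /ltW ->].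
rewrite Rintegral_itv_bndo_bndc; last first.
  by apply: integrableS fi => // t /=; rewrite !in_itv/= => /andP[-> /ltW ->].
have [p0 pd] := primP c cf.
by rewrite (int_primitive cf pd (ltW cd)) p0 subr0.
Qed.

Section InterfaceFamilies.
Variables (R : realType) (a b : R) (U : R -> R).
Hypotheses (a_lt0 : a < 0) (b_gt0 : 0 < b) (U_smooth : smooth_on a b U).
Variables (alpha beta gamma1 gamma2 : R) (Psi Phi Ups1 Ups2 : R -> R).
Hypotheses (Psi_test : test_function Psi) (Phi_test : test_function Phi)
  (Ups1_test : test_function Ups1) (Ups2_test : test_function Ups2).
Hypothesis nondegenerate : nondegenerate_resonance Psi alpha.
Variable lam : R.

Let q (t : R * R) : R -> R := inner a b U alpha beta gamma1 gamma2 Psi Phi Ups1 Ups2 t.1 t.2.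
Let p (t : R * R) : R -> R := full a b U alpha beta gamma1 gamma2 Psi Phi Ups1 Ups2 t.1 t.2.
Let q0 (x : R) : R := - (alpha * Psi x).
Let box := pbox lam.
Let seg : set R := [set x | -1 <= x <= 1].
Let dist0 := @pdist_ge0 R.

Let q_coef t : bounded_coef (q t).
Proof. exact: inner_coef. Qed.

Lemma inner_limit mu : q (0, mu) = q0.
Proof. by apply/funext => x; rewrite /q /inner /= !expr0n/= !mul0r !addr0 sub0r. Qed.

Lemma outer_ulip e1 (X : set R) : 0 <= e1 -> ulip (box e1) X (fun x t => outer a b U t.2 x).
Proof.
move=> e10; have [_ [B HB]] := outer_coef a_lt0 b_gt0 U_smooth lam.
exists (B + 1) => x _; have B0 : 0 <= B by exact: le_trans (HB x).
apply: (lip_criterion e10); first by rewrite addr_ge0.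
- move=> t [_ tm]; rewrite (_ : outer _ _ _ _ _ = outer a b U lam x + (t.2 - lam)).
    by apply: le_trans (ler_normD _ _) _; rewrite lerD.
  by rewrite /outer; ring.
- move=> e mu mu' _ _; rewrite (_ : _ - _ = mu - mu'); last by rewrite /outer /=; ring.
  by rewrite ler_peMl// lerDr.
- by move=> t [/andP[t0 _] _]; rewrite subrr normr0 mulr_ge0// addr_ge0.
Qed.

Let test_lip f (c : R) n : test_function f ->
  ulip (box 1) [set: R] (fun x t => t.1 ^+ n * c * f x).
Proof.
move=> /test_bounded[B fB]; apply: ulipM; last exact: (ulip_fun _ (fun x _ => fB x)).
apply: ulip_cst; apply: lipcM => //; last exact: lipc_cst.
by apply: lipcX; exists (1 + 1); apply: lip_eps.
Qed.

(** The factor [t.1 ^+ n.+1] vanishes at eps = 0 and is at most [t.1], so the O(eps) bound follows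
    from the sup bound on [outer]. *)
Let scaled_outer_lip n :
  ulip (box 1) [set: R] (fun x t => t.1 ^+ n.+1 * outer a b U t.2 (t.1 * x)).
Proof.
have [M HM] := @outer_ulip 1 [set: R] ler01.
have [M0 _ _] := HM 0 I.
have ob t x : box 1 t -> `|outer a b U t.2 x| <= M by have [_ h _] := HM x I; exact: h.
have e4 t : box 1 t -> `|t.1 ^+ n.+1| <= t.1 /\ t.1 <= 1.
  move=> [/andP[t0 t1] _]; rewrite ger0_norm ?exprn_ge0//; split => //.
  by rewrite exprS ler_piMr// exprn_ile1.
exists (M + 1) => x _; apply: (lip_criterion ler01); first by rewrite addr_ge0.
- move=> t Bt; have [h1 h2] := e4 t Bt; rewrite normrM (le_trans (ler_pM _ _ h1 (ob t _ Bt)))//.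
  by have := ler_piMl M0 h2; lra.
- move=> e mu mu' B1 B2; have [h1 h2] := e4 _ B1; rewrite /= -mulrBr normrM.
  rewrite (_ : outer _ _ _ _ _ - _ = mu - mu'); last by rewrite /outer; ring.
  by rewrite ler_wpM2r// (le_trans h1)// (le_trans h2)// lerDr.
- move=> t Bt; have [h1 h2] := e4 t Bt; rewrite /= expr0n/= mul0r subr0 normrM.
  apply: le_trans (ler_pM _ _ h1 (ob t _ Bt)) _ => //.
  by rewrite mulrC ler_wpM2r ?lerDl//; case: Bt => /andP[].
Qed.

Let q_lip : ulip (box 1) [set: R] (fun x t => q t x).
Proof.
have [C HC] := ulipD (scaled_outer_lip 3) (ulipD (ulipD (test_lip (- alpha) 0%N Psi_test) (test_lip (- beta) 1%N Phi_test))
  (ulipD (test_lip (- gamma1) 2%N Ups1_test) (test_lip (- gamma2) 3%N Ups2_test))).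
by exists C => x xI; apply: lip_eq (HC x xI) => t _; rewrite /q /inner; ring.
Qed.

(* The jets of the function x |-> e^s y(x / e). *)
Definition stretch (s : nat) (e : R) (y : nat -> R -> R) : nat -> R -> R :=
  fun j x => e ^+ s / e ^+ j * y j (x / e).

Lemma sol_stretch s t y : t.1 != 0 -> sol (q t) y -> sol (p t) (stretch s t.1 y).
Proof.
move=> e0 [y1 y2].
have d j x l : der (y j) (x / t.1) l -> der (stretch s t.1 y j) x (t.1 ^+ s / t.1 ^+ j * (t.1^-1 * l)).
  move=> h; rewrite /stretch; apply: derMl.
  have -> : (fun x => y j (x / t.1)) = (fun x => y j (t.1^-1 * x + 0)).
    by apply/funext => u; rewrite addr0 mulrC.
  by apply: der_affine; rewrite addr0 mulrC.
split.
- move=> k x k3; apply: der_eq (d _ _ _ (y1 k (x / t.1) k3)) _.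
  by rewrite /stretch exprS; field; rewrite expf_neq0.
- move=> x; apply: der_eq (d _ _ _ (y2 (x / t.1))) _.
  rewrite /q /p inner_full// mulrC -/(p t) [in p t _]mulrC divfK//.
  rewrite /stretch expr0 divr1; by field.
Qed.

Lemma sol_shrink t y : t.1 != 0 -> sol (p t) y -> sol (q t) (fun j x => t.1 ^+ j * y j (t.1 * x)).
Proof.
move=> e0 [y1 y2].
have d j x l : der (y j) (t.1 * x) l -> der (fun x => t.1 ^+ j * y j (t.1 * x)) x (t.1 ^+ j * (t.1 * l)).
  move=> h; apply: derMl.
  have -> : (fun x => y j (t.1 * x)) = (fun x => y j (t.1 * x + 0)).
    by apply/funext => u; rewrite addr0.
  by apply: der_affine; rewrite addr0.
split.
- by move=> k x k3; apply: der_eq (d _ _ _ (y1 k (t.1 * x) k3)) _; rewrite exprS; ring.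
- move=> x; apply: der_eq (d _ _ _ (y2 (t.1 * x))) _.
  by rewrite /q inner_full// expr0 mul1r -/(p t); ring.
Qed.

(* For eps > 0 the [Om t k] are a basis of solutions of the full equation, with
   jets [lf] at -eps and [rf] at eps; at eps = 0 the pairs [(lf, rf)] parametrize
   the interface conditions of the limit operator. *)
Definition interface_family (e1 : R) (Om : R * R -> 'I_4 -> nat -> R -> R)
    (lf rf : R * R -> nat -> 'I_4 -> R) : Prop :=
  [/\ forall t, box e1 t -> 0 < t.1 ->
        [/\ forall k, sol (p t) (Om t k),
            forall j k, (j < 4)%N -> Om t k j (- t.1) = lf t j k /\ Om t k j t.1 = rf t j k,
            forall y, sol (p t) y -> exists c : 'I_4 -> R, forall j x, (j < 4)%N ->
              y j x = \sum_k c k * Om t k j x &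
            forall c : 'I_4 -> R, (forall j x, (j < 4)%N -> \sum_k c k * Om t k j x = 0) ->
              forall k, c k = 0],
      exists2 C : R, 0 <= C & forall t k x, box e1 t -> 0 < t.1 -> `|x| <= t.1 ->
        `|Om t k 0%N x| <= C * t.1,
      forall j k, (j < 4)%N -> lipc (box e1) (@pdist R) (fun t => lf t j k) /\
        lipc (box e1) (@pdist R) (fun t => rf t j k) &
      forall mu, `|mu - lam| <= 1 ->
        [/\ forall c : 'I_4 -> R, interface alpha beta Psi Phi
              (fun j => \sum_k lf (0, mu) j k * c k) (fun j => \sum_k rf (0, mu) j k * c k),
            forall l r, interface alpha beta Psi Phi l r -> exists c : 'I_4 -> R, forall j, (j < 4)%N ->
              l j = \sum_k lf (0, mu) j k * c k /\ r j = \sum_k rf (0, mu) j k * c k &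
            forall c : 'I_4 -> R, (forall j, (j < 4)%N -> \sum_k lf (0, mu) j k * c k = 0 /\
              \sum_k rf (0, mu) j k * c k = 0) -> forall k, c k = 0]].

Section FromDualBasis.
Variables (sg : nat) (e1 : R) (om : R * R -> 'I_4 -> nat -> R -> R) (sp : R * R -> R).
Hypotheses (sgE : sg = 1%N \/ sg = 2%N) (e1I : 0 < e1 <= 1)
  (om_sol : forall t k, box e1 t -> sol (q t) (om t k))
  (om_datum : forall t (i k : 'I_4), box e1 t -> datum sg i (om t k) = (i == k)%:R)
  (om_lip : forall j k, (j < 4)%N -> ulip (box e1) seg (fun x t => om t k j x))
  (om_expand : forall t y, box e1 t -> sol (q t) y -> forall j x, (j < 4)%N ->
      y j x = \sum_(k < 4) datum sg k y * om t k j x)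
  (sp_lip : lipc (box e1) (@pdist R) sp)
  (spE : forall t, box e1 t -> 0 < t.1 -> sg = 1%N -> om t ord0 2%N (-1) = t.1 * sp t).

(* [sp] is the one entry with a negative power of eps, eps^-1 w''(-1); it has to be
   supplied in a form that extends to eps = 0. *)
Definition left_family (t : R * R) (j : nat) (k : 'I_4) : R :=
  if (j <= dord sg k)%N then t.1 ^+ (dord sg k - j) * om t k j (-1)
  else if [&& sg == 1, j == 2 & k == 0 :> nat]%N then sp t else 0.

Definition right_family (t : R * R) (j : nat) (k : 'I_4) : R :=
  if (j <= dord sg k)%N then t.1 ^+ (dord sg k - j) * om t k j 1 else 0.

(** After stretching, derivatives of order above [dord sg k] carry negative powers of eps. At -1 and
    1 they are among the prescribed data and vanish; the exception occurs for [sg = 1], when the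
    second derivative at -1 is not prescribed. *)
Let om_eq0 t (k : 'I_4) j : box e1 t -> (dord sg k < j)%N -> (j < 4)%N ->
  om t k j 1 = 0 /\
  (~~ [&& sg == 1, j == 2 & k == 0 :> nat]%N -> om t k j (-1) = 0).
Proof.
move=> Bt; have o1 : (1 < 4)%N by []; have o2 : (2 < 4)%N by []; have o3 : (3 < 4)%N by [].
have := om_datum (Ordinal o1) k Bt; have := om_datum (Ordinal o2) k Bt.
have := om_datum (Ordinal o3) k Bt; rewrite /datum /dord /dpt /= -!val_eqE /=.
by case: k => [[|[|[|[|]]]]]//= kl; case: sgE => ->; case: j => [|[|[|[|]]]]//= -> -> ->.
Qed.


Let dord_gt0 (k : 'I_4) : (0 < dord sg k)%N.
Proof. by case: k => [[|[|[|[|]]]]]//= _; case: sgE => ->. Qed.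

Let e1_le1 : e1 <= 1. Proof. by case/andP: e1I. Qed.

(** Stretching by the power [dord] leaves the prescribed derivative of each basis function free of
    eps; lower derivatives get positive powers, and higher ones are settled by [om_eq0] and [spE].
    As [dord] is at least 1, the functions are O(eps) on [-eps, eps]. Resonance matters only for the
    limit at eps = 0, which is the hypothesis. *)
Lemma family_of_dual :
  (forall mu, `|mu - lam| <= 1 -> [/\ forall c : 'I_4 -> R, interface alpha beta Psi Phi
              (fun j => \sum_k left_family (0, mu) j k * c k) (fun j => \sum_k right_family (0, mu) j k * c k),
            forall l r, interface alpha beta Psi Phi l r -> exists c : 'I_4 -> R, forall j, (j < 4)%N ->
              l j = \sum_k left_family (0, mu) j k * c k /\ r j = \sum_k right_family (0, mu) j k * c k &
            forall c : 'I_4 -> R, (forall j, (j < 4)%N -> \sum_k left_family (0, mu) j k * c k = 0 /\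
              \sum_k right_family (0, mu) j k * c k = 0) -> forall k, c k = 0]) ->
  interface_family e1 (fun t k => stretch (dord sg k) t.1 (om t k)) left_family right_family.
Proof.
move=> lim; have e1_ge0 : 0 <= e1 by case/andP: e1I => /ltW.
split => //.
- move=> t Bt t0; have tn0 : t.1 != 0 by rewrite gt_eqF.
  split.
  + by move=> k; apply: sol_stretch => //; exact: om_sol.
  + move=> j k j4; rewrite /stretch mulNr divff//.
    rewrite /left_family /right_family; case: leqP => [jd|dj].
      by rewrite -{1 3}(subnK jd) exprD mulfK// expf_neq0.
    have [z1 z2] := om_eq0 Bt dj j4; rewrite z1 mulr0; split => //.
    case: ifPn => [/and3P[/eqP s1 /eqP j2 /eqP k0]|/z2 ->]; last by rewrite mulr0.
    have -> : k = ord0 by exact: val_inj.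
    by rewrite j2 spE// /dord s1 /= expr1; field.
  + move=> y sy; have sy' := sol_shrink tn0 sy.
    (* The data of the solution in the variable xi, with the stretching factor divided out. *)
    exists (fun k => datum sg k (fun j x => t.1 ^+ j * y j (t.1 * x)) / t.1 ^+ dord sg k) => j x j4.
    have := om_expand Bt sy' (x / t.1) j4; rewrite [t.1 * (x / t.1)]mulrC divfK// => h.
    apply: (mulfI (expf_neq0 j tn0)); rewrite h mulr_sumr; apply: eq_bigr => k _.
    by rewrite /stretch; field; rewrite !expf_neq0.
  + move=> c h k.
    have := h (dord sg k) (t.1 * dpt R k) (dord_lt4 k _).
    have -> : (sg < 4)%N by case: sgE => ->.
    move=> /(_ isT); rewrite (bigD1 k)//= big1 ?addr0 => [|i ik].
      rewrite /stretch [t.1 * _]mulrC mulfK// divff ?expf_neq0// mul1r.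
      by have := om_datum k k Bt; rewrite /datum eqxx => ->; rewrite mulr1.
    rewrite /stretch [t.1 * _]mulrC mulfK//.
    by have := om_datum k i Bt; rewrite /datum eq_sym (negbTE ik) => ->; rewrite !mulr0.
- have [C HC] := choice (fun k => om_lip k (isT : (0 < 4)%N)).
  have C0 k : 0 <= C k.
    by have [] := HC k 0; first by rewrite /seg /=; apply/andP; split; lra.
  exists (\sum_k C k); first exact: sumr_ge0.
  move=> t k x Bt t0 xt; rewrite /stretch expr0 divr1 normrM mulrC.
  have t1 : t.1 <= 1 by case: Bt => /andP[_ h] _; exact: le_trans e1_le1.
  have xI : seg (x / t.1).
    by rewrite /seg /= -ler_norml normrM normfV (gtr0_norm t0) ler_pdivrMr// mul1r.
  have [_ h _] := HC k _ xI; apply: ler_pM => //.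
  + apply: le_trans (h _ Bt) _; rewrite (bigD1 k)//= lerDl.
    exact: sumr_ge0.
  + have t0' := ltW t0; rewrite ger0_norm ?exprn_ge0//.
    by case: (dord sg k) (dord_gt0 k) => // n _; rewrite exprS ler_piMr ?exprn_ile1.
- have eps n : lipc (box e1) (@pdist R) (fun t => t.1 ^+ n).
    by apply: lipcX; exists (e1 + 1); apply: lip_eps.
  have ev (j : nat) k x : (j < 4)%N -> seg x -> lipc (box e1) (@pdist R) (fun t => om t k j x).
    by move=> j4 xI; exact: ulip_lipc xI (om_lip k j4).
  have c0 := lipc_cst (box e1) dist0 0.
  have sm : seg (-1) by rewrite /seg /=; apply/andP; split; lra.
  have sp1 : seg 1 by rewrite /seg /=; apply/andP; split; lra.
  move=> j k j4; rewrite /left_family /right_family; case: leqP => jd.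
    by split; apply: lipcM => //; exact: ev.
  by split => //; case: (sg == 1)%N; case: (j == 2)%N; case: (k == 0 :> nat)%N.
Qed.

End FromDualBasis.

Let o (n : nat) (h : (n < 4)%N) : 'I_4 := Ordinal h.
Let k0 : 'I_4 := ord0.
Let k1 : 'I_4 := lift ord0 ord0.
Let k2 : 'I_4 := lift ord0 (lift ord0 ord0).
Let k3 : 'I_4 := lift ord0 (lift ord0 (lift ord0 ord0)).

Let ord4_ind (Q : 'I_4 -> Prop) : Q k0 -> Q k1 -> Q k2 -> Q k3 -> forall k, Q k.
Proof.
move=> h0 h1 h2 h3 k.
have : k \in [:: k0; k1; k2; k3] by case: k => [[|[|[|[|]]]]].
by rewrite !inE => /or4P[] /eqP ->.
Qed.

Let limit_datum sg (y : nat -> R -> R) :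
  (forall i : 'I_4, datum sg i y = 0) ->
  [/\ y sg (-1) = 0, y 3%N (-1) = 0, y 2%N 1 = 0 & y 3%N 1 = 0].
Proof.
by move=> H; split; [exact: (H (@o 0 isT))|exact: (H (@o 1 isT))
  |exact: (H (@o 2 isT))|exact: (H (@o 3 isT))].
Qed.

Let q0_coef : bounded_coef q0.
Proof. by rewrite -(inner_limit lam); exact: q_coef. Qed.

Let m1 : -1 < 1 :> R. Proof. lra. Qed.

Lemma inner_sol_eigen y : sol q0 y -> y 2%N (-1) = 0 -> y 3%N (-1) = 0 -> y 2%N 1 = 0 -> y 3%N 1 = 0 ->
  ~ inner_eigenfunctions Psi alpha (y 0%N) -> forall k x, (k < 4)%N -> y k x = 0.
Proof.
move=> sy h1 h2 h3 h4 ne; apply: (sol_eq0 q0_coef sy m1) => x xI.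
apply/eqP; apply: contraT => yx; case: ne; split; last by exists x; rewrite ?in_itv.
by apply/(inner_solutionsP alpha Psi_test); exists y.
Qed.

(** Without resonance w'' and w''' at both ends determine w, so [sg = 2]. At eps = 0 the jets then
    have arbitrary second and third derivatives on each side and zero lower ones, which is the
    decoupled limit condition. *)
Lemma nonresonant_family : ~ resonant_set Psi alpha ->
  exists e1 Om lf rf, 0 < e1 <= 1 /\ interface_family e1 Om lf rf.
Proof.
move=> nr.
have [|||||e1 [om [e1I om_sol om_datum om_lip om_expand]]] := @dual_basis R lam q _ _ _ 2 _ _.
- exact: q_coef.
- exact: q_lip.
- by move=> mu; rewrite !inner_limit.
- by [].
- move=> y; rewrite inner_limit => sy /limit_datum[] // h1 h2 h3 h4.
  by apply: inner_sol_eigen => // ye; apply: nr; exists (y 0%N).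
have e1_ge0 : 0 <= e1 by case/andP: e1I => /ltW.
exists e1, (fun t (k : 'I_4) => stretch (dord 2 k) t.1 (om t k)), (left_family 2 om (fun=> 0)), (right_family 2 om); split => //.
apply: family_of_dual => //; first by right.
  exact: lipc_cst.
move=> mu muI; have B0 : box e1 (0, mu) by split => //=; rewrite lexx.
have v (i k : 'I_4) := om_datum (0, mu) i k B0.
have l2 k : om (0, mu) k 2%N (-1) = (k == 0 :> nat)%:R by rewrite eq_sym; exact: (v (@o 0 isT) k).
have l3 k : om (0, mu) k 3%N (-1) = (k == 1 :> nat)%:R by rewrite eq_sym; exact: (v (@o 1 isT) k).
have r2 k : om (0, mu) k 2%N 1 = (k == 2 :> nat)%:R by rewrite eq_sym; exact: (v (@o 2 isT) k).
have r3 k : om (0, mu) k 3%N 1 = (k == 3 :> nat)%:R by rewrite eq_sym; exact: (v (@o 3 isT) k).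
have lE (c : 'I_4 -> R) j : (j < 4)%N -> \sum_k left_family 2 om (fun=> 0) (0, mu) j k * c k =
    (j == 2)%:R * c k0 + (j == 3)%:R * c k1.
  move=> j4; rewrite !big_ord_recl big_ord0 /left_family /=.
  case: j j4 => [|[|[|[|]]]]//= _; rewrite !expr0n /= ?l2 ?l3 /=; ring.
have rE (c : 'I_4 -> R) j : (j < 4)%N -> \sum_k right_family 2 om (0, mu) j k * c k =
    (j == 2)%:R * c k2 + (j == 3)%:R * c k3.
  move=> j4; rewrite !big_ord_recl big_ord0 /right_family /=.
  case: j j4 => [|[|[|[|]]]]//= _; rewrite !expr0n /= ?r2 ?r3 /=; ring.
split.
- by move=> c; split => // _; rewrite !lE// !rE//= !mul0r addr0.
- move=> l r [H _]; have [l0 r0 l1 r1] := H nr.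
  exists (fun k : 'I_4 => nth 0 [:: l 2%N; l 3%N; r 2%N; r 3%N] k) => j j4; rewrite lE// rE//=.
  by case: j j4 => [|[|[|[|]]]]//= _; rewrite ?mul0r ?mul1r ?add0r ?addr0.
- move=> c H k.
  have [] := H 2%N isT; have [] := H 3%N isT; rewrite !lE// !rE//= !mul0r !mul1r !add0r !addr0.
  by move=> *; elim/ord4_ind: k.
Qed.

(** Dividing by w'(-1), nonzero by nondegeneracy, removes the denominators from [theta] and [kappa];
    the result is the half-bound state used in Green's formula. *)
Lemma resonant_profile : resonant_set Psi alpha -> exists z,
  [/\ sol q0 z, [/\ z 2%N (-1) = 0, z 3%N (-1) = 0, z 2%N 1 = 0 & z 3%N 1 = 0],
    z 1%N (-1) = 1, z 1%N 1 = theta Psi alpha &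
    kappa Psi Phi alpha = Int (-1) 1 (fun x => Phi x * (z 0%N x * z 0%N x))].
Proof.
move=> res; have we : inner_eigenfunctions Psi alpha (w_ Psi alpha).
  exact: (xgetPex (cst 0) res).
have [/(inner_solutionsP alpha Psi_test)[y [sy wy [y2 y3] [y2' y3']]] _] := we.
have := (nondegenerate res).2 _ we; rewrite /theta /kappa.
rewrite (rtrace_sol m1 sy wy)// (ltrace_sol m1 sy wy)// mulf_eq0 negb_or => /andP[n1 _].
set c := y 1%N (-1) in n1 *.
exists (fun k x => c^-1 * y k x); split.
- exact: solZ.
- by rewrite y2 y3 y2' y3' mulr0.
- by rewrite mulVf.
- by rewrite mulrC.
- have cz : continuous (fun x => Phi x * (c^-1 * y 0%N x * (c^-1 * y 0%N x))).
    have cy : continuous (fun x => c^-1 * y 0%N x).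
      by apply: (@sol_cont _ _ (fun k x => c^-1 * y k x) 0%N (solZ _ sy)).
    by move=> x; apply: cvgM; [exact: test_cont|apply: cvgM; exact: cy].
  rewrite -(Rintegral_Int cz m1); apply: eq_Rintegral => x; rewrite inE/= in_itv/= => xI.
  by rewrite wy// expr2 mulrC [y 0%N x / c]mulrC mulrC.
Qed.

(** The half-bound state has w'' = w''' = 0 at both ends, so w''(-1) is replaced as a datum by
    w'(-1), which is nonzero on it. Green's formula against [z] recovers w''(-1): at eps = 0 from
    w''(1), with factor [theta], and at first order in eps from w'(-1), with [kappa]. *)
Lemma resonant_family : resonant_set Psi alpha ->
  exists e1 Om lf rf, 0 < e1 <= 1 /\ interface_family e1 Om lf rf.
Proof.
move=> res; have [z [sz [z2 z3 z2' z3'] z1 z1' kE]] := resonant_profile res.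
have sI : seg (-1) by rewrite /seg /=; apply/andP; split; lra.
have sI' : seg 1 by rewrite /seg /=; apply/andP; split; lra.
have wron_cst y : sol q0 y -> wron y z 1 = wron y z (-1).
  move=> sy; apply: (@der0_cst R _ (-1) 1) => // x _.
  by apply: der_eq (der_wron x sy sz) _; rewrite subrr mul0r.
have [|||||e1 [om [e1I om_sol om_datum om_lip om_expand]]] := @dual_basis R lam q _ _ _ 1 _ _.
- exact: q_coef.
- exact: q_lip.
- by move=> mu; rewrite !inner_limit.
- by [].
- move=> y; rewrite inner_limit => sy /limit_datum[h1 h2 h3 h4].
  have y2 : y 2%N (-1) = 0.
    have := wron_cst y sy; rewrite /wron h1 h2 h3 h4 z1 z2 z3 z2' z3' => h.
    apply: (@eq_trans _ _ (- (0 * z 0%N (-1) - y 2%N (-1) * 1 + 0 * 0 - y 0%N (-1) * 0))); first by ring.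
    by rewrite -h; ring.
  apply: inner_sol_eigen => // /((nondegenerate res).2 _).
  by rewrite (rtrace_sol m1 sy (fun _ _ => erefl))// h1 mul0r eqxx.
have e1_gt0 : 0 < e1 by case/andP: e1I.
have e1_ge0 := ltW e1_gt0.
have B0 mu : `|mu - lam| <= 1 -> box e1 (0, mu) by move=> h; split => //=; rewrite lexx.
have omz mu : `|mu - lam| <= 1 -> forall j x, (j < 4)%N -> om (0, mu) k0 j x = z j x.
  move=> muI j x j4; have sz' : sol (q (0, mu)) z by rewrite inner_limit.
  rewrite (om_expand _ _ (B0 _ muI) sz' j x j4) !big_ord_recl big_ord0 /datum /= z1 z3 z2' z3'.
  by rewrite !mul0r !addr0 mul1r.
(* The difference quotient in eps of the inner coefficient, in a closed form that extends to eps = 0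
   with value - beta Phi. *)
pose g (t : R * R) x : R := t.1 ^+ 3 * outer a b U t.2 (t.1 * x)
  - (beta * Phi x + t.1 * gamma1 * Ups1 x + t.1 ^+ 2 * gamma2 * Ups2 x).
have gq t x : q t x - q0 x = t.1 * g t x by rewrite /q /q0 /g /inner; ring.
have cg t : continuous (g t).
  have [] // : bounded_coef (g t).
  rewrite (_ : g t = fun x => t.1 ^+ 3 * outer a b U t.2 (t.1 * x) + ((- beta) * Phi x
      + ((- (t.1 * gamma1)) * Ups1 x + (- (t.1 ^+ 2 * gamma2)) * Ups2 x))); last first.
    by apply/funext => x; rewrite /g; ring.
  apply: bounded_coefD; first by apply: bounded_coefZ; apply: bounded_coef_scale; exact: outer_coef.
  by apply: bounded_coefD; [|apply: bounded_coefD]; apply: bounded_coefZ; exact: test_bounded_coef.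
have g_lip : ulip (box 1) [set: R] (fun x t => g t x).
  have [C HC] := ulipD (scaled_outer_lip 2) (ulipD (test_lip (- beta) 0%N Phi_test)
    (ulipD (test_lip (- gamma1) 1%N Ups1_test) (test_lip (- gamma2) 2%N Ups2_test))).
  by exists C => x xI; apply: lip_eq (HC x xI) => t _; rewrite /g; ring.
pose f t x := g t x * (om t k0 0%N x * z 0%N x).
have cf t : box e1 t -> continuous (f t).
  move=> Bt x; apply: cvgM; first exact: cg.
  by apply: cvgM; [exact: (sol_cont (om_sol _ _ Bt))|exact: (sol_cont sz)].
(* Green's formula on [-1, 1] against the half-bound state z. *)
pose sp t := Int (-1) 1 (f t).
have sub : box e1 `<=` box 1 by apply: pbox_le; case/andP: e1I.
have sp_lip : lipc (box e1) (@pdist R) sp.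
  apply: (lipc_Int m1 cf); apply: ulipM.
    by have [C HC] := g_lip; exists C => x _; exact: lip_sub sub (HC x I).
  apply: ulipM; first exact: om_lip.
  have [C HC] := om_lip 0%N k0 isT; apply: (@ulip_fun _ _ _ _ _ C) => x xI.
  have ll : `|lam - lam| <= 1 by rewrite subrr normr0.
  by rewrite -(omz lam ll)//; have [_ h _] := HC x xI; apply: h; exact: B0.
have spE t : box e1 t -> 0 < t.1 -> 1%N = 1%N -> om t ord0 2%N (-1) = t.1 * sp t.
  move=> Bt t0 _; have so := om_sol t k0 Bt.
  have dat (i : 'I_4) := om_datum t i k0 Bt.
  have d0 := dat (@o 0 isT); have d1 := dat (@o 1 isT); have d2 := dat (@o 2 isT); have d3 := dat (@o 3 isT).
  rewrite /datum /dord /dpt /= in d0 d1 d2 d3.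
  rewrite /sp (@Int_eq R (-1) 1 m1 (f t) (fun x => t.1^-1 * wron (om t k0) z x) (cf t Bt)); last first.
    move=> x _; apply: der_eq (derMl _ (der_wron x so sz)) _.
    by rewrite gq /f; field; rewrite gt_eqF.
  rewrite /wron d0 d1 d2 d3 z1 z2 z3 z2' z3' -/k0.
  by field; rewrite gt_eqF.
exists e1, (fun t (k : 'I_4) => stretch (dord 1 k) t.1 (om t k)), (left_family 1 om sp), (right_family 1 om); split => //.
apply: family_of_dual => //; first by left.
move=> mu muI; have Bm := B0 mu muI.
have v (i k : 'I_4) := om_datum (0, mu) i k Bm.
have l1 k : om (0, mu) k 1%N (-1) = (k == 0 :> nat)%:R by rewrite eq_sym; exact: (v (@o 0 isT) k).
have l3 k : om (0, mu) k 3%N (-1) = (k == 1 :> nat)%:R by rewrite eq_sym; exact: (v (@o 1 isT) k).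
have r2 k : om (0, mu) k 2%N 1 = (k == 2 :> nat)%:R by rewrite eq_sym; exact: (v (@o 2 isT) k).
have r3 k : om (0, mu) k 3%N 1 = (k == 3 :> nat)%:R by rewrite eq_sym; exact: (v (@o 3 isT) k).
set th := theta Psi alpha in z1' *.
have r1 : om (0, mu) k0 1%N 1 = th by rewrite omz.
(* Constancy of Lagrange's form against [z] turns w''(1) = 1 into w''(-1) = z'(1). *)
have l2 : om (0, mu) k2 2%N (-1) = th.
  have so : sol q0 (om (0, mu) k2) by rewrite -(inner_limit mu); exact: om_sol.
  have := wron_cst _ so; rewrite /wron l1 l3 r2 r3 z1 z2 z3 z2' z3' z1' /=.
  move=> h; apply: (@eq_trans _ _ (- (0 * z 0%N (-1) - om (0, mu) k2 2%N (-1) * 1 + 0 * 0 - om (0, mu) k2 0%N (-1) * 0))).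
    by ring.
  by rewrite -h; ring.
have spK : sp (0, mu) = - (beta * kappa Psi Phi alpha).
  pose h x := Phi x * (z 0%N x * z 0%N x).
  have ch : continuous h.
    by move=> x; apply: cvgM; [exact: test_cont|apply: cvgM; exact: (sol_cont sz)].
  have [p0 pd] := primP (-1) ch.
  rewrite kE /sp (@Int_eq R (-1) 1 m1 (f (0, mu)) (fun x => - beta * prim h (-1) x) (cf _ Bm)).
    by rewrite p0 mulr0 subr0 mulNr.
  move=> x _; apply: der_eq (derMl _ (pd x)) _.
  by rewrite /f /g /h omz//= expr0n /= !expr0n /=; ring.
have lE (c : 'I_4 -> R) j : (j < 4)%N -> \sum_k left_family 1 om sp (0, mu) j k * c k =
    (j == 1)%:R * c k0 + (j == 2)%:R * (- (beta * kappa Psi Phi alpha) * c k0 + th * c k2) + (j == 3)%:R * c k1.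
  move=> j4; rewrite !big_ord_recl big_ord0 /left_family /=.
  by case: j j4 => [|[|[|[|]]]]//= _; rewrite !expr0n /= ?l1 ?l3 ?l2 ?spK /=; ring.
have rE (c : 'I_4 -> R) j : (j < 4)%N -> \sum_k right_family 1 om (0, mu) j k * c k =
    (j == 1)%:R * (th * c k0) + (j == 2)%:R * c k2 + (j == 3)%:R * c k3.
  move=> j4; rewrite !big_ord_recl big_ord0 /right_family /=.
  by case: j j4 => [|[|[|[|]]]]//= _; rewrite !expr0n /= ?r1 ?r2 ?r3 /=; ring.
split.
- by move=> c; split => // _; rewrite !lE// !rE//= -/th; split; ring.
- move=> l r [_ H]; have [l0 r0 h1 h2] := H res.
  exists (fun k : 'I_4 => nth 0 [:: l 1%N; l 3%N; r 2%N; r 3%N] k) => j j4; rewrite lE// rE//=.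
  by case: j j4 => [|[|[|[|]]]]//= _; rewrite -/th in h1 h2; split; lra.
- move=> c H k.
  have [e1' _] := H 1%N isT; have [_ e2] := H 2%N isT; have [e3 e4] := H 3%N isT.
  move: e1' e2 e3 e4; rewrite !lE// !rE//= !mul0r !mul1r !add0r !addr0.
  by move=> *; elim/ord4_ind: k.
Qed.

Lemma interface_family_exists : exists e1 Om lf rf, 0 < e1 <= 1 /\ interface_family e1 Om lf rf.
Proof.
by have [/resonant_family|/nonresonant_family] := pselect (resonant_set Psi alpha).
Qed.

End InterfaceFamilies.

(** * Shooting *)

(** The perturbed and unperturbed coefficients coincide only off (-eps, eps), so uniqueness is
    needed along the segment from [x0] to [x] alone. *)
Lemma sol_agree (R : realType) (p q : R -> R) (y z : nat -> R -> R) (x0 x : R) :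
  bounded_coef p -> bounded_coef q -> sol p y -> sol q z ->
  (forall t, Num.min x0 x <= t <= Num.max x0 x -> p t = q t) ->
  (forall k, (k < 4)%N -> y k x0 = z k x0) -> forall k, (k < 4)%N -> y k x = z k x.
Proof.
move=> gp gq sy sz pq yz k k4; rewrite (sol_expand x0 gq sz)//.
apply/eqP; rewrite -subr_eq0 -normr_le0.
have [M pM] := gp.2; have M0 : 0 <= M by exact: le_trans (pM 0).
pose w := comb (z ^~ x0) q x0.
have sw : sol q w by exact: sol_comb.
have [h1 h2] := solB sy (sol_comb (z ^~ x0) x0 gp).
have [y1 y2] := sy; have [w1 w2] := sw.
have := @gronwall R (fun k x => y k x - w k x) (fun x => p x * y 0%N x - q x * w 0%N x) M 0 0 x0 x M0 (lexx 0) _ _ k k4.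
rewrite mulr0 addr0 mul0r; apply.
- move=> t tI; split.
  + by move=> i i3; apply: derB; [exact: y1|exact: w1].
  + by apply: derB.
  + by rewrite -(pq t tI) -mulrBr normrM addr0 ler_wpM2r.
- by move=> i i4; rewrite /w comb_init// yz// subrr normr0.
Qed.

Lemma ae_neq0 (R : realType) : {ae @lebesgue_measure R, forall x : R, x != 0}.
Proof.
exists [set 0]; split; [exact: measurable_set1|exact: lebesgue_measure_set1|].
by move=> x /= /negP; rewrite negbK => /eqP.
Qed.

(** * Bordered matrices *)

Section BorderedMatrix.
Variables (R : fieldType) (n : nat).
Implicit Types (F : 'M[R]_n) (r j : 'I_n) (c : 'I_n -> R).

(** [bord_sol] is a column of the adjugate of the bordered matrix: it satisfies every equation of
    [F] but row [r], where the defect is [bord_res]. Not dividing by the determinant keeps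
    everything polynomial in the entries, hence Lipschitz in the parameters. *)
Definition bord r j F : 'M[R]_n := \matrix_(i, k) if i == r then (k == j)%:R else F i k.
Definition bord_sol r j F : 'I_n -> R := fun k => (\adj (bord r j F)) k r.
Definition bord_res r j F : R := \sum_k F r k * bord_sol r j F k.

Lemma bord_solE r j F i : \sum_k F i k * bord_sol r j F k = (i == r)%:R * bord_res r j F.
Proof.
have [->|ir] := eqVneq i r; first by rewrite mul1r.
have := congr1 (fun M : 'M[R]_n => M i r) (mul_mx_adj (bord r j F)).
rewrite !mxE (negbTE ir) mulr0n mul0r => h; rewrite -[RHS]h.
by apply: eq_bigr => k _; rewrite [bord _ _ _ _ _]mxE (negbTE ir).
Qed.

Lemma bord_sol_pivot r j F : bord_sol r j F j = \det (bord r j F).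
Proof.
have := congr1 (fun M : 'M[R]_n => M r r) (mul_mx_adj (bord r j F)).
rewrite !mxE eqxx mulr1n => <-; rewrite (bigD1 j)//= big1 ?addr0 => [|k kj].
  by rewrite [bord _ _ _ _ _]mxE !eqxx mul1r.
by rewrite [bord _ _ _ _ _]mxE eqxx (negbTE kj) mul0r.
Qed.

(** Subtracting the multiple of [bord_sol] with the same coordinate [j] leaves a vector annihilated
    by the invertible bordered matrix. Row [r] then relates [c j] to the defect. *)
Lemma bord_kernel r j F c : \det (bord r j F) != 0 -> (forall i, \sum_k F i k * c k = 0) ->
  (forall k, c k = c j / bord_sol r j F j * bord_sol r j F k) /\ c j * bord_res r j F = 0.
Proof.
move=> d0 Fc.
have p0 : bord_sol r j F j != 0 by rewrite bord_sol_pivot.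
set s := c j / bord_sol r j F j.
pose v : 'cV[R]_n := \col_k (c k - s * bord_sol r j F k).
have Bv : bord r j F *m v = 0.
  apply/colP => i; rewrite !mxE; have [->|ir] := eqVneq i r.
    rewrite (bigD1 j)//= big1 ?addr0 => [|k kj]; last first.
      by rewrite [bord _ _ _ _ _]mxE eqxx (negbTE kj) mul0r.
    by rewrite !mxE !eqxx mul1r /s divfK// subrr.
  rewrite (eq_bigr (fun k => F i k * c k - s * (F i k * bord_sol r j F k))) => [|k _].
    by rewrite sumrB Fc -mulr_sumr bord_solE (negbTE ir) mul0r mulr0 subrr.
  by rewrite !mxE (negbTE ir) mulrBr mulrCA.
have v0 : v = 0.
  have := congr1 (mulmx (\adj (bord r j F))) Bv.
  rewrite mulmxA mul_adj_mx mulmx0 mul_scalar_mx => /eqP.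
  by rewrite scaler_eq0 (negbTE d0) => /eqP.
have cE k : c k = s * bord_sol r j F k.
  by have := congr1 (fun w : 'cV[R]_n => w k 0) v0; rewrite !mxE => /eqP; rewrite subr_eq0 => /eqP.
split => //.
have := Fc r; rewrite (eq_bigr (fun k => s * (F r k * bord_sol r j F k))) => [|k _]; last first.
  by rewrite cE mulrCA.
rewrite -mulr_sumr -/(bord_res r j F) => /eqP; rewrite mulf_eq0 => /orP[|/eqP ->]; last by rewrite mulr0.
by rewrite /s mulf_eq0 invr_eq0 (negbTE p0) orbF => /eqP ->; rewrite mul0r.
Qed.

(* A left null vector of F tells which row to replace, the null vector u which
   coordinate to normalize. *)
Lemma bord_exists F (u : 'I_n -> R) j : u j != 0 -> (forall i, \sum_k F i k * u k = 0) ->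
  (forall c, (forall i, \sum_k F i k * c k = 0) -> exists s, forall k, c k = s * u k) ->
  exists r, \det (bord r j F) != 0.
Proof.
move=> uj Fu ker.
have dF : \det F == 0.
  rewrite -det_tr; apply/det0P; exists (\row_k u k).
    by apply/eqP => /rowP/(_ j); rewrite !mxE => /eqP; rewrite (negbTE uj).
  apply/rowP => i; rewrite !mxE -[RHS](Fu i); apply: eq_bigr => k _.
  by rewrite !mxE mulrC.
have /det0P[z z0 zF] := dF.
have [r zr] : exists r, z 0 r != 0.
  apply/existsP; apply: contraT; rewrite negb_exists => /forallP h; case/eqP: z0.
  by apply/rowP => r; rewrite mxE; apply/eqP; have := h r; rewrite negbK.
exists r; apply/negP; rewrite -det_tr => /det0P[c c0 cB]; case/eqP: c0.
have Bc i : \sum_k bord r j F i k * c 0 k = 0.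
  have := congr1 (fun w : 'rV[R]_n => w 0 i) cB; rewrite !mxE => h; rewrite -[RHS]h.
  by apply: eq_bigr => k _; rewrite [_^T _ _]mxE mulrC.
have cj : c 0 j = 0.
  rewrite -[RHS](Bc r) (bigD1 j)//= big1 ?addr0 => [|k kj]; first by rewrite mxE !eqxx mul1r.
  by rewrite mxE eqxx (negbTE kj) mul0r.
have Fci i : i != r -> \sum_k F i k * c 0 k = 0.
  by move=> ir; rewrite -[RHS](Bc i); apply: eq_bigr => k _; rewrite mxE (negbTE ir).
have Fcr : \sum_k F r k * c 0 k = 0.
  have : \sum_i z 0 i * (\sum_k F i k * c 0 k) = 0.
    under eq_bigr do rewrite mulr_sumr.
    rewrite exchange_big big1//= => k _.
    under eq_bigr do rewrite mulrA.
    rewrite -mulr_suml; have := congr1 (fun w : 'rV[R]_n => w 0 k) zF; rewrite !mxE => ->.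
    by rewrite mul0r.
  rewrite (bigD1 r)//= [X in _ + X]big1 ?addr0 => [/eqP|i ir]; last by rewrite Fci// mulr0.
  by rewrite mulf_eq0 (negbTE zr) => /eqP.
have [|s cE] := ker (fun k => c 0 k).
  by move=> i; have [->//|] := eqVneq i r; exact: Fci.
apply/rowP => k; rewrite mxE cE.
have : s * u j = 0 by rewrite -cE.
by move=> /eqP; rewrite mulf_eq0 (negbTE uj) orbF => /eqP ->; rewrite mul0r.
Qed.

End BorderedMatrix.

(* D(eps, .) changes sign near lam because D(0, mu) does, by the identity with I. *)
Lemma perturbed_root (R : realType) (lam e1 : R) (D I : R * R -> R) (kap r0 : R) :
  0 < e1 -> 0 < r0 -> lipc (pbox lam e1) (@pdist R) D -> lipc (pbox lam e1) (@pdist R) I ->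
  0 < I (0, lam) -> (forall mu, `|mu - lam| <= 1 -> D (0, mu) * kap = (mu - lam) * I (0, mu)) ->
  exists e2 del K : R, [/\ 0 < e2 <= e1 /\ e2 <= r0, 0 < del <= 1 /\ del <= r0, 0 <= K /\ K * e2 < del,
    forall e, 0 < e <= e2 -> exists2 mu, `|mu - lam| < del & D (e, mu) = 0 &
    forall e mu, 0 < e <= e2 -> `|mu - lam| <= del -> D (e, mu) = 0 -> `|mu - lam| <= K * e].
Proof.
move=> e1_gt0 r0_gt0 [C [C0 _ Dl]] Il I0 DE.
have e1_ge0 := ltW e1_gt0.
have I20 : 0 < I (0, lam) / 2 by rewrite divr_gt0.
have [r r_gt0 Hr] := lipc_near I20 Il.
pose del : R := Num.min (Num.min 1 r0) r.
have del_gt0 : 0 < del by rewrite !lt_min ltr01 r0_gt0.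
have del1 : del <= 1 by rewrite !ge_min lexx.
have del2 : del <= r0 by rewrite !ge_min lexx orbT.
have del3 : del <= r by rewrite ge_min lexx orbT.
have box mu e : 0 <= e -> e <= e1 -> `|mu - lam| <= del -> pbox lam e1 (e, mu).
  by move=> h1 h2 h3; split => /=; [rewrite h1|exact: le_trans del1].
have Ip mu : `|mu - lam| <= del -> I (0, lam) / 2 <= I (0, mu).
  move=> h; have := Hr (0, mu) (0, lam) (box _ _ (lexx 0) e1_ge0 h) (pbox_limit lam e1_ge0).
  by rewrite pdist_same => /(_ (le_trans h del3)); rewrite ler_distl => /andP[]; lra.
have D0 e mu : 0 <= e -> e <= e1 -> `|mu - lam| <= del -> `|D (e, mu) - D (0, mu)| <= C * e.
  move=> h1 h2 h3; have B := box mu e h1 h2 h3.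
  apply: le_trans (Dl _ _ B (pbox0 e1_ge0 B)) _; rewrite ler_wpM2l//.
  exact: pdist0 B.
(* A zero of D(e, .) has |D(0, mu)| <= C e, hence |mu - lam| I(0, mu) <= C |kap| e, where I(0, mu)
   is at least half of I(0, lam). *)
pose K : R := C * `|kap| / (I (0, lam) / 2).
have K0 : 0 <= K by rewrite divr_ge0 ?mulr_ge0// ltW.
have K1 : 0 < K + 1 by rewrite ltr_wpDl.
pose e2 : R := Num.min (Num.min e1 r0) (del / (K + 1)).
have e2_gt0 : 0 < e2 by rewrite !lt_min e1_gt0 r0_gt0 divr_gt0.
have e21 : e2 <= e1 by rewrite !ge_min lexx.
have e22 : e2 <= r0 by rewrite !ge_min lexx orbT.
have Ke2 : K * e2 < del.
  have : e2 <= del / (K + 1) by rewrite ge_min lexx orbT.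
  by rewrite ler_pdivlMr// mulrDr mulr1 mulrC; lra.
have CK e : C * e * `|kap| = K * e * (I (0, lam) / 2) by rewrite /K; field; rewrite gt_eqF.
exists e2, del, K; split => //; try by rewrite ?e2_gt0 ?del_gt0.
- move=> e /andP[e0 ee2]; have e_le := le_trans ee2 e21.
  have Kd : K * e < del by apply: le_lt_trans Ke2; rewrite ler_wpM2l.
  have KI : `|kap| * (C * e) < del * (I (0, lam) / 2) by rewrite mulrC CK ltr_pM2r.
  have key mu : `|mu - lam| = del -> `|kap * D (e, mu) - (mu - lam) * I (0, mu)| < del * (I (0, lam) / 2).
    move=> mE; rewrite -DE ?mE// [D (0, mu) * _]mulrC -mulrBr normrM.
    by apply: le_lt_trans KI; rewrite ler_wpM2l// D0 ?mE// ltW.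
  have m1 : `|lam - del - lam| = del by rewrite addrAC subrr sub0r normrN gtr0_norm.
  have m2 : `|lam + del - lam| = del by rewrite addrAC subrr add0r gtr0_norm.
  have i1 : del * (I (0, lam) / 2) <= del * I (0, lam - del) by rewrite ler_wpM2l ?Ip ?m1// ltW.
  have i2 : del * (I (0, lam) / 2) <= del * I (0, lam + del) by rewrite ler_wpM2l ?Ip ?m2// ltW.
  have [||||mu /andP[h1 h2] Dmu] := @lipschitz_IVT R (fun mu => kap * D (e, mu)) (`|kap| * C) (lam - del) (lam + del).
  + move=> x y xI yI; rewrite -mulrBr normrM -mulrA ler_wpM2l// -(pdist_same e).
    by apply: Dl; apply: box => //; [exact: ltW|rewrite ler_distl|exact: ltW|rewrite ler_distl].
  + by lra.
  + have := key _ m1; rewrite ltr_distl => /andP[_].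
    by rewrite (_ : lam - del - lam = - del) ?mulNr; [lra|ring].
  + have := key _ m2; rewrite ltr_distl => /andP[+ _].
    by rewrite (_ : lam + del - lam = del); [lra|ring].
  exists mu; first by rewrite ltr_distl h1.
  (* With [kap = 0] the left side of the estimate [key] at [lam + del] would be at least its right
     side, as [I] is positive there. *)
  have kap0 : kap != 0.
    apply/eqP => k0; have := key _ m2; rewrite k0 mul0r sub0r normrN.
    have -> : lam + del - lam = del by ring.
    by move=> h; have := ler_norm (del * I (0, lam + del)); lra.
  by apply: (mulfI kap0); rewrite mulr0.
- move=> e mu /andP[e0 ee2] mI DZ.
  have := D0 e mu (ltW e0) (le_trans ee2 e21) mI; rewrite DZ sub0r normrN => Dm.
  have := DE mu (le_trans mI del1) => /(congr1 (fun x => `|x|)); rewrite !normrM => E.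
  have Ipm := Ip _ mI.
  rewrite -(@ler_pM2r _ (I (0, lam) / 2))// -CK.
  apply: (@le_trans _ _ (`|mu - lam| * `|I (0, mu)|)).
    by rewrite ler_wpM2l// ger0_norm//; lra.
  by rewrite -E ler_wpM2r.
Qed.

Section Shooting.
Variables (R : realType) (a b : R) (U : R -> R).
Hypotheses (a_lt0 : a < 0) (b_gt0 : 0 < b) (U_smooth : smooth_on a b U).
Variables (alpha beta gamma1 gamma2 : R) (Psi Phi Ups1 Ups2 : R -> R).
Hypotheses (Psi_test : test_function Psi) (Phi_test : test_function Phi)
  (Ups1_test : test_function Ups1) (Ups2_test : test_function Ups2).
Variables (lam e1 : R) (Om : R * R -> 'I_4 -> nat -> R -> R)
  (lf rf : R * R -> nat -> 'I_4 -> R).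
Hypotheses (e1I : 0 < e1 <= 1) (e1a : e1 <= - a) (e1b : e1 <= b).
Hypothesis family :
  interface_family a b U alpha beta gamma1 gamma2 Psi Phi Ups1 Ups2 lam e1 Om lf rf.

Let q (t : R * R) : R -> R := outer a b U t.2.
Let p (t : R * R) : R -> R := full a b U alpha beta gamma1 gamma2 Psi Phi Ups1 Ups2 t.1 t.2.
Let box := pbox lam e1.
Let dist0 := @pdist_ge0 R.
Let e1_ge0 : 0 <= e1. Proof. by case/andP: e1I => /ltW. Qed.
Let e1_le1 : e1 <= 1. Proof. by case/andP: e1I. Qed.
Let q_coef t : bounded_coef (q t). Proof. exact: outer_coef. Qed.
Let p_coef t : bounded_coef (p t). Proof. exact: full_coef. Qed.
Let L : R := 1 + `|a| + `|b|.
Let ball : set R := [set x | `|x| <= L].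

Let L1 : 1 <= L. Proof. by rewrite /L -addrA lerDl addr_ge0. Qed.

Let box_ball t (s : bool) : box t -> ball ((-1) ^+ s * t.1).
Proof.
move=> [/andP[h1 h2] _]; rewrite /ball /= normrM normr_sign mul1r ger0_norm//.
by apply: le_trans h2 _; exact: le_trans L1.
Qed.

(** The base point moves with eps. The solutions normalized at [u] and at 0 are compared through
    their jets at 0, which differ by O(|u|) because solutions are Lipschitz in x; Gronwall's
    estimate carries this to [x]. *)
Lemma fund_base_ulip (s : bool) k j : (k < 4)%N -> (j < 4)%N ->
  ulip box ball (fun x t => fund (q t) ((-1) ^+ s * t.1) k j x).
Proof.
move=> k4 j4.
have [M HM] := outer_ulip a_lt0 b_gt0 U_smooth lam [set: R] e1_ge0.
have [M0 _ _] := HM 0 I.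
have qM t x : box t -> `|q t x| <= M by have [_ h _] := HM x I; exact: h.
have [||C HC] := @lip_fund R _ box _ dist0 q M M L M0 M0 (fun t _ => q_coef t).
- by move=> t x At _; exact: qM.
- by move=> t u x At As _; have [_ _ h] := HM x I; exact: h.
have b0 : ball 0 by rewrite /ball /= normr0 (le_trans ler01).
have [C0 _ _] := HC 0 0 0%N 0%N b0 b0 isT isT.
pose D := C + 2 * ((C + M * C) * expR ((M + 4) * L)).
have CD : C <= D by rewrite lerDl !mulr_ge0 ?expR_ge0// addr_ge0// mulr_ge0.
exists D => x xL; apply: (lip_criterion e1_ge0); first exact: le_trans CD.
- move=> t Bt; have [_ h _] := HC _ _ k j (box_ball s Bt) xL k4 j4.
  exact: le_trans (h t Bt) CD.
- move=> e mu mu' B1 B2; have [_ _ h] := HC _ _ k j (box_ball s B1) xL k4 j4.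
  by have := h _ _ B1 B2; rewrite pdist_same => /le_trans; apply; rewrite ler_wpM2r.
- move=> t Bt; have t0 : 0 <= t.1 by case: Bt => /andP[].
  have sb := box_ball s Bt; set u := (-1) ^+ s * t.1 in sb *.
  have un : `|u| = t.1 by rewrite normrM normr_sign mul1r ger0_norm.
  have [sf f0] := fundP u k (q_coef t); have [sg g0] := fundP 0 k (q_coef t).
  have d0 i : (i < 4)%N -> `|fund (q t) u k i 0 - fund (q t) 0 k i 0| <= (C + M * C) * t.1.
    move=> i4; rewrite g0// -(f0 i i4) -un -[`|u|]normrN -[- u]sub0r.
    have bb w : ball w -> - L <= w <= L by rewrite /ball /= ler_norml.
    apply: (@sol_lipschitz R (q t) _ M C (- L) L C0 sf _ i 0 u i4 (bb _ b0) (bb _ sb)).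
    move=> w; rewrite -ler_norml => wL; split; first exact: qM.
    by move=> i' i4'; have [_ h _] := HC _ _ k i' sb wL k4 i4'; exact: h.
  have t20 : 0 <= 0 :> R by [].
  have e0 : (-1) ^+ s * (0, t.2).1 = 0 :> R by rewrite mulr0.
  have := @sol_diff R (q t) (q t) (fund (q t) u k) (fund (q t) 0 k) M 0 C ((C + M * C) * t.1) 0 x M0 t20 C0 sf sg _ d0 j j4.
  rewrite mul0r addr0 subr0 => h; rewrite [(-1) ^+ s * _]e0.
  apply: le_trans (h _) _.
    move=> w wI; split; first exact: qM.
      by rewrite subrr normr0.
    have wL : ball w.
      move: xL wI; rewrite /ball /= !ler_norml => /andP[x1 x2] /andP[]; rewrite ge_min le_max.
      by have := L1; move=> ? /orP[?|?] /orP[?|?]; apply/andP; split; lra.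
    by have [_ h' _] := HC 0 w k 0%N b0 wL k4 isT; exact: h'.
  apply: (@le_trans _ _ (2 * ((C + M * C) * expR ((M + 4) * L)) * t.1)); last first.
    by rewrite /D [leRHS]mulrDl lerDr mulr_ge0.
  rewrite (_ : 2 * ((C + M * C) * _) * t.1 = 2 * ((C + M * C) * t.1) * expR ((M + 4) * L)); last by ring.
  rewrite ler_wpM2l ?mulr_ge0 ?addr_ge0 ?mulr_ge0// ler_expR ler_wpM2l// addr_ge0//.
Qed.

(** Continuation of the inner jets from -eps and eps by the unperturbed equation. [yL] and [yR] make
    sense at eps = 0; for eps > 0, [yM] solves the full equation and coincides with them off (-eps,
    eps). *)
Definition outL (t : R * R) (k : 'I_4) : nat -> R -> R := comb (lf t ^~ k) (q t) (- t.1).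
Definition outR (t : R * R) (k : 'I_4) : nat -> R -> R := comb (rf t ^~ k) (q t) t.1.
Definition yL (t : R * R) (c : 'I_4 -> R) : nat -> R -> R := fun j x => \sum_k c k * outL t k j x.
Definition yR (t : R * R) (c : 'I_4 -> R) : nat -> R -> R := fun j x => \sum_k c k * outR t k j x.
Definition yM (t : R * R) (c : 'I_4 -> R) : nat -> R -> R := fun j x => \sum_k c k * Om t k j x.

Lemma outL_ulip j k : (j < 4)%N -> ulip box ball (fun x t => outL t k j x).
Proof.
move=> j4; have [_ _ lfl _] := family.
apply: ulip_sum => i; apply: ulipM.
  by apply: ulip_cst; have [] := lfl i k (ltn_ord i).
apply: ulip_eq (fund_base_ulip true (ltn_ord i) j4) => x t _ _.
by rewrite expr1 mulN1r.
Qed.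

Lemma outR_ulip j k : (j < 4)%N -> ulip box ball (fun x t => outR t k j x).
Proof.
move=> j4; have [_ _ lfl _] := family.
apply: ulip_sum => i; apply: ulipM.
  by apply: ulip_cst; have [] := lfl i k (ltn_ord i).
by apply: ulip_eq (fund_base_ulip false (ltn_ord i) j4) => x t _ _; rewrite expr0 mul1r.
Qed.

Lemma yL_sol t c : sol (q t) (yL t c).
Proof. by apply: sol_sum => k; exact: sol_comb. Qed.

Lemma yR_sol t c : sol (q t) (yR t c).
Proof. by apply: sol_sum => k; exact: sol_comb. Qed.

Lemma yL_init t c j : (j < 4)%N -> yL t c j (- t.1) = \sum_k lf t j k * c k.
Proof. by move=> j4; apply: eq_bigr => k _; rewrite /outL comb_init// mulrC. Qed.

Lemma yR_init t c j : (j < 4)%N -> yR t c j t.1 = \sum_k rf t j k * c k.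
Proof. by move=> j4; apply: eq_bigr => k _; rewrite /outR comb_init// mulrC. Qed.

Lemma yM_sol t c : box t -> 0 < t.1 -> sol (p t) (yM t c).
Proof. by move=> Bt t0; apply: sol_sum => k; have [/(_ t Bt t0)[h _ _ _] _ _ _] := family; exact: h. Qed.

Lemma yM_left t c j x : box t -> 0 < t.1 -> (j < 4)%N -> x <= - t.1 -> yM t c j x = yL t c j x.
Proof.
move=> Bt t0 j4 xt; have [/(_ t Bt t0)[_ h _ _] _ _ _] := family.
apply: (sol_agree (x0 := - t.1) (p_coef t) (q_coef t) (yM_sol c Bt t0) (yL_sol t c)) => //.
  move=> s /andP[_]; rewrite le_max => sI; apply: full_outer => //.
  have st : s <= - t.1 by case/orP: sI => // /le_trans; apply.
  by rewrite ler0_norm; lra.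
by move=> i i4; rewrite yL_init//; apply: eq_bigr => k _; have [-> _] := h i k i4; rewrite mulrC.
Qed.

Lemma yM_right t c j x : box t -> 0 < t.1 -> (j < 4)%N -> t.1 <= x -> yM t c j x = yR t c j x.
Proof.
move=> Bt t0 j4 xt; have [/(_ t Bt t0)[_ h _ _] _ _ _] := family.
apply: (sol_agree (x0 := t.1) (p_coef t) (q_coef t) (yM_sol c Bt t0) (yR_sol t c)) => //.
  move=> s /andP[]; rewrite ge_min => sI _; apply: full_outer => //.
  have st : t.1 <= s by case/orP: sI => //; exact: le_trans.
  by rewrite ger0_norm; lra.
by move=> i i4; rewrite yR_init//; apply: eq_bigr => k _; have [_ ->] := h i k i4; rewrite mulrC.
Qed.

Definition bdata (i : nat) (l r : nat -> R -> R) : R :=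
  nth 0 [:: l 0%N a; l 1%N a; r 0%N b; r 1%N b] i.

Definition bmat (t : R * R) : 'M[R]_4 := \matrix_(i, k) bdata i (outL t k) (outR t k).

Lemma bdata_sum t c (i : 'I_4) : bdata i (yL t c) (yR t c) = \sum_k bmat t i k * c k.
Proof.
rewrite (eq_bigr (fun k => c k * bdata i (outL t k) (outR t k))) => [|k _]; last by rewrite mxE mulrC.
by case: i => [[|[|[|[|]]]]].
Qed.

Lemma bmat_lip (i k : 'I_4) : lipc box (@pdist R) (fun t => bmat t i k).
Proof.
apply: (@lipc_eq _ _ _ _ (fun t => bdata i (outL t k) (outR t k))) => [t _|]; first by rewrite mxE.
have aB : ball a by rewrite /ball /= /L [1 + _]addrC -addrA lerDl addr_ge0.
have bB : ball b by rewrite /ball /= /L lerDr addr_ge0.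
have l0 := ulip_lipc aB (outL_ulip k (isT : (0 < 4)%N)).
have l1 := ulip_lipc aB (outL_ulip k (isT : (1 < 4)%N)).
have r0 := ulip_lipc bB (outR_ulip k (isT : (0 < 4)%N)).
have r1 := ulip_lipc bB (outR_ulip k (isT : (1 < 4)%N)).
by case: i => [[|[|[|[|]]]]].
Qed.

Let kernel t (c : 'I_4 -> R) : Prop := forall i, \sum_k bmat t i k * c k = 0.

Lemma bdata0 t c : kernel t c ->
  [/\ yL t c 0%N a = 0, yL t c 1%N a = 0, yR t c 0%N b = 0 & yR t c 1%N b = 0].
Proof.
move=> h.
by split; [have := h (@Ordinal 4 0 isT)|have := h (@Ordinal 4 1 isT)|have := h (@Ordinal 4 2 isT)
  |have := h (@Ordinal 4 3 isT)]; rewrite -bdata_sum.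
Qed.

Let kernel_bdata t c :
  [/\ yL t c 0%N a = 0, yL t c 1%N a = 0, yR t c 0%N b = 0 & yR t c 1%N b = 0] -> kernel t c.
Proof. by move=> [h1 h2 h3 h4] i; rewrite -bdata_sum; case: i => [[|[|[|[|]]]]]. Qed.

Let box_a t : box t -> a <= - t.1 /\ t.1 <= b.
Proof. by move=> [/andP[_ h] _]; split; [rewrite lerNr|]; exact: le_trans h _. Qed.

Lemma eigfun_kernel t c : box t -> 0 < t.1 -> eigfun a b (p t) (yM t c) <-> kernel t c.
Proof.
move=> Bt t0; have [ha hb] := box_a Bt; split.
- move=> [_ h1 h2 h3 h4]; apply: kernel_bdata.
  by rewrite -!yM_left// -!yM_right.
- by move=> /bdata0[h1 h2 h3 h4]; split;
    [exact: yM_sol|rewrite yM_left|rewrite yM_left|rewrite yM_right|rewrite yM_right].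
Qed.

Lemma eigfun_expand t y : box t -> 0 < t.1 -> eigfun a b (p t) y ->
  exists2 c, kernel t c & forall j x, (j < 4)%N -> y j x = yM t c j x.
Proof.
move=> Bt t0 ey; have [/(_ t Bt t0)[_ _ h _] _ _ _] := family.
have [sy y1 y2 y3 y4] := ey.
have [c cE] := h y sy; exists c => //; apply/(eigfun_kernel c Bt t0).
by split; [exact: yM_sol|rewrite /yM -cE|rewrite /yM -cE|rewrite /yM -cE|rewrite /yM -cE].
Qed.

Lemma yM_eq0 t c : box t -> 0 < t.1 -> (forall j x, (j < 4)%N -> yM t c j x = 0) -> forall k, c k = 0.
Proof. by move=> Bt t0 h; have [/(_ t Bt t0)[_ _ _ ind] _ _ _] := family; exact: ind. Qed.

Lemma interface_ext l r l' r' : (forall j, (j < 4)%N -> l j = l' j) -> (forall j, (j < 4)%N -> r j = r' j) ->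
  interface alpha beta Psi Phi l r -> interface alpha beta Psi Phi l' r'.
Proof. by move=> hl hr; rewrite /interface !hl// !hr. Qed.

Lemma limit_interface mu c : `|mu - lam| <= 1 ->
  interface alpha beta Psi Phi (yL (0, mu) c ^~ 0) (yR (0, mu) c ^~ 0).
Proof.
move=> h; have [_ _ _ /(_ mu h)[H _ _]] := family.
apply: interface_ext (H c) => j j4; first by rewrite -yL_init//= oppr0.
by rewrite -yR_init.
Qed.

Lemma limit_kernel mu c : `|mu - lam| <= 1 -> kernel (0, mu) c ->
  limit_eig a b U alpha beta Psi Phi mu (yL (0, mu) c) (yR (0, mu) c).
Proof.
by move=> h /bdata0 hc; split => //; [exact: yL_sol|exact: yR_sol|exact: limit_interface].
Qed.

Lemma limit_expand mu zl zr : `|mu - lam| <= 1 ->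
  limit_eig a b U alpha beta Psi Phi mu zl zr ->
  exists2 c, kernel (0, mu) c & forall j x, (j < 4)%N ->
    zl j x = yL (0, mu) c j x /\ zr j x = yR (0, mu) c j x.
Proof.
move=> h [sl sr [b1 b2 b3 b4] ic]; have [_ _ _ /(_ mu h)[_ H _]] := family.
have [c cE] := H _ _ ic.
have E j x : (j < 4)%N -> zl j x = yL (0, mu) c j x /\ zr j x = yR (0, mu) c j x.
  move=> j4; split.
  - apply: (sol_unique (x0 := 0) (q_coef (0, mu)).2 sl (yL_sol _ _)) => // i i4.
    by have := yL_init (0, mu) c i4; rewrite /= oppr0 => ->; have [] := cE i i4.
  - apply: (sol_unique (x0 := 0) (q_coef (0, mu)).2 sr (yR_sol _ _)) => // i i4.
    by have := yR_init (0, mu) c i4 => /= ->; have [] := cE i i4.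
exists c => //; apply: kernel_bdata.
by have [<- _] := E 0%N a isT; have [<- _] := E 1%N a isT; have [_ <-] := E 0%N b isT; have [_ <-] := E 1%N b isT.
Qed.

Lemma limit_eq0 mu c : `|mu - lam| <= 1 ->
  (forall j, (j < 4)%N -> yL (0, mu) c j 0 = 0 /\ yR (0, mu) c j 0 = 0) -> forall k, c k = 0.
Proof.
move=> h H; have [_ _ _ /(_ mu h)[_ _ ind]] := family; apply: ind => j j4.
by rewrite -yL_init// -yR_init//= oppr0; exact: H.
Qed.

Hypothesis lambda_simple : simple_eigenvalue a b (S_limit a b U alpha beta Psi Phi) lam.

Let lam1 : `|lam - lam| <= 1. Proof. by rewrite subrr normr0. Qed.

Let glue c : R -> R := fun x => if x < 0 then yL (0, lam) c 0%N x else yR (0, lam) c 0%N x.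

Let glueB (s s' : R) c c' x : glue (fun k => s * c k - s' * c' k) x = s * glue c x - s' * glue c' x.
Proof.
rewrite /glue; case: ifP => _; rewrite /yL /yR !mulr_sumr -sumrB;
  by apply: eq_bigr => k _; ring.
Qed.

Let glue_eigen c : kernel (0, lam) c -> op_eigenspace (S_limit a b U alpha beta Psi Phi) lam (fun x => ((glue c x)%:C)%C).
Proof.
move=> kc; have K0 : kernel (0, lam) (fun=> 0) by move=> i; rewrite big1// => k _; rewrite mulr0.
have E c' f : kernel (0, lam) c' -> (forall x, f x = glue c' x) ->
    S_limit a b U alpha beta Psi Phi f (fun x => lam * f x).
  move=> /(limit_kernel lam1) le fE; apply/(S_limit_eig a_lt0 b_gt0 U_smooth).
  exists (yL (0, lam) c'), (yR (0, lam) c'); split => // x /andP[x1 x2].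
    by rewrite fE /glue x2.
  by rewrite fE /glue ltNge ltW.
split; first exact: (E c).
by apply: (E _ _ K0) => x; rewrite /glue /yL /yR /= !big1 ?if_same// => k _; rewrite mul0r.
Qed.

Let glue_ae0 c : {ae @lebesgue_measure R, forall x, `]a, b[%classic x -> glue c x = 0} ->
  forall k, c k = 0.
Proof.
move=> h; apply: (limit_eq0 lam1) => j j4; split.
- apply: (sol_eq0 (q_coef (0, lam)) (yL_sol _ c) a_lt0) => // x xI.
  apply: (@continuous_ae0 R (yL (0, lam) c 0%N) `]a, 0[%classic a 0 _ _ _ x xI).
  + exact: (sol_cont (yL_sol _ _)).
  + by move=> s; rewrite /= in_itv.
  + apply: ae_mono h => s H; rewrite /= in_itv/= => /andP[s1 s2].
    by rewrite -[RHS]H /glue ?s2//= in_itv/= s1 (lt_trans s2).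
- apply: (sol_eq0 (q_coef (0, lam)) (yR_sol _ c) b_gt0) => // x xI.
  apply: (@continuous_ae0 R (yR (0, lam) c 0%N) `]0, b[%classic 0 b _ _ _ x xI).
  + exact: (sol_cont (yR_sol _ _)).
  + by move=> s; rewrite /= in_itv.
  + apply: ae_mono h => s H; rewrite /= in_itv/= => /andP[s1 s2].
    by rewrite -[RHS]H /glue ?ltNge ?(ltW s1)//= in_itv/= s2 (lt_trans _ s1).
Qed.

(** Simplicity in complex L_2 is carried over to the real kernel by gluing the two pieces at 0. Two
    glued functions are proportional over the complex numbers; a real factor comes from the real or
    the imaginary part, whichever is nonzero on the coefficient of [u]. *)
Let limit_simple : exists2 u : 'I_4 -> R, (exists j, u j != 0) /\ kernel (0, lam) u &
  forall c, kernel (0, lam) c -> exists s : R, forall k, c k = s * u k.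
Proof.
have [e [Ee ie se]] := lambda_simple.
have real_part f : S_limit a b U alpha beta Psi Phi f (fun x => lam * f x) ->
    exists2 c, kernel (0, lam) c & forall x, a < x < b -> x != 0 -> f x = glue c x.
  move=> /(S_limit_eig a_lt0 b_gt0 U_smooth)[zl [zr [/(limit_expand lam1)[c kc cE] fl fr]]].
  exists c => // x /andP[x1 x2] x0; rewrite /glue; case: ltP => xs.
    by rewrite fl ?x1//; have [-> _] := cE 0%N x isT.
  rewrite fr ?x2 ?andbT ?lt_neqAle ?xs 1?eq_sym ?x0//.
  by have [_ ->] := cE 0%N x isT.
have [u [ju uj] ku] : exists2 u : 'I_4 -> R, exists j, u j != 0 & kernel (0, lam) u.
  apply: contrapT => H.
  have K0 c : kernel (0, lam) c -> forall x, glue c x = 0.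
    move=> kc x; rewrite /glue /yL /yR !big1 ?if_same// => k _;
      by (have [->|ck] := eqVneq (c k) 0; first by rewrite mul0r);
      case: H; exists c => //; exists k.
  have [/real_part[c1 k1 E1] /real_part[c2 k2 E2]] := Ee ord0.
  suff h : forall i : 'I_1, (fun=> 1 : R[i]) i = 0 by have /eqP := h ord0; rewrite oner_eq0.
  apply: (ie (fun=> 1)); apply: ae_mono (@ae_neq0 R) => x x0; rewrite /= in_itv/= => xI.
  rewrite big_ord_recl big_ord0 addr0 mul1r; apply: complex_eq.
    by rewrite E1// K0.
  by rewrite E2// K0.
exists u; first by split => //; exists ju.
have [gu hu] := se _ (glue_eigen ku).
have gu0 : gu ord0 != 0.
  apply/eqP => g0; move/eqP: uj; apply; apply: glue_ae0.
  apply: ae_mono hu => x H xD; have := congr1 (@complex.Re R) (H xD).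
  by rewrite big_ord_recl big_ord0 addr0 g0 mul0r.
move=> c kc; have [gc hc] := se _ (glue_eigen kc).
have key (pr : R[i] -> R) : (forall z x, pr (z * (x%:C)%C) = pr z * x) -> pr (gu ord0) != 0 ->
    exists s : R, forall k, c k = s * u k.
  move=> prM p0; exists (pr (gc ord0) / pr (gu ord0)) => k.
  suff h : pr (gu ord0) * c k - pr (gc ord0) * u k = 0.
    apply: (mulfI p0); rewrite mulrA [pr (gu ord0) * (_ / _)]mulrC divfK//.
    by apply/eqP; rewrite -subr_eq0 h.
  apply: (@glue_ae0 (fun k => pr (gu ord0) * c k - pr (gc ord0) * u k)).
  apply: ae_mono (ae_and hu hc) => x [Hu Hc] xD; rewrite glueB -!prM Hu// Hc//.
  by rewrite !big_ord_recl !big_ord0 !addr0 mulrCA subrr.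
have [r0|r0] := eqVneq (complex.Re (gu ord0)) 0; last exact: (key _ (@Re_mulr R) r0).
apply: (key _ (@Im_mulr R)); apply: contraNneq gu0 => i0.
by apply/eqP; exact: complex_eq.
Qed.

Let Int_sqr_ge0 c d t z : c < d -> sol (q t) z -> 0 <= Int c d (fun x => z 0%N x * z 0%N x) /\
  (~ (forall k x, (k < 4)%N -> z k x = 0) -> 0 < Int c d (fun x => z 0%N x * z 0%N x)).
Proof.
move=> cd sz; have [z0|nz] := pselect (forall k x, (k < 4)%N -> z k x = 0).
  split; last by move=> /(_ z0).
  rewrite (_ : (fun x => _) = fun=> 0); last first.
    by apply/funext => x; rewrite z0// mulr0.
  rewrite (@Int_eq R c d cd (fun=> 0) (fun=> 0)) ?subrr//; first by move=> x; exact: cvg_cst.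
  by move=> x _; exact: derC.
by have h := Int_sqr_gt0 cd (q_coef t) sz nz; rewrite ltW.
Qed.

Let Int_wron c d t t' y z : c < d -> sol (q t) y -> sol (q t') z ->
  (t.2 - t'.2) * Int c d (fun x => y 0%N x * z 0%N x) = wron y z d - wron y z c.
Proof.
move=> cd sy sz.
have cp : continuous (fun x => y 0%N x * z 0%N x).
  by move=> x; apply: cvgM; [exact: (sol_cont sy)|exact: (sol_cont sz)].
have [p0 pd] := primP c cp.
have cp' : continuous (fun x => (t.2 - t'.2) * (y 0%N x * z 0%N x)).
  by move=> x; apply: cvgM; [exact: cvg_cst|exact: cp].
rewrite -(@Int_eq R c d cd _ (wron y z) cp'); last first.
  by move=> x _; apply: der_eq (der_wron x sy sz) _; rewrite /q /outer; ring.
rewrite (@Int_eq R c d cd _ (fun x => (t.2 - t'.2) * prim (fun x => y 0%N x * z 0%N x) c x) cp').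
  by rewrite p0 mulr0 subr0.
by move=> x _; exact: derMl.
Qed.

(** Symmetry of the limit operator at 0: the factors [theta] match up across 0 and the
    [beta * kappa] terms cancel. Hence 0 contributes nothing to Lagrange's identity on (a, b). *)
Let interface_wron l r l' r' y z y' z' (x : R) :
  interface alpha beta Psi Phi l r -> interface alpha beta Psi Phi l' r' ->
  (forall j, y j x = l j) -> (forall j, z j x = l' j) -> (forall j, y' j x = r j) -> (forall j, z' j x = r' j) ->
  wron y z x = wron y' z' x.
Proof.
move=> [n1 r1] [n2 r2] yl zl yr zr; rewrite /wron !yl !zl !yr !zr.
have [res|nr] := pselect (resonant_set Psi alpha).
  have [a1 a2 a3 a4] := r1 res; have [b1 b2 b3 b4] := r2 res.
  rewrite a1 a2 b1 b2.
  have -> : r 1%N = theta Psi alpha * l 1%N by apply/eqP; rewrite -subr_eq0 a3.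
  have -> : r' 1%N = theta Psi alpha * l' 1%N by apply/eqP; rewrite -subr_eq0 b3.
  have -> : l 2%N = theta Psi alpha * r 2%N - beta * kappa Psi Phi alpha * l 1%N.
    by apply/eqP; rewrite -subr_eq0 -oppr_eq0; apply/eqP; rewrite -[RHS]a4; ring.
  have -> : l' 2%N = theta Psi alpha * r' 2%N - beta * kappa Psi Phi alpha * l' 1%N.
    by apply/eqP; rewrite -subr_eq0 -oppr_eq0; apply/eqP; rewrite -[RHS]b4; ring.
  by ring.
have [-> -> -> ->] := n1 nr; have [-> -> -> ->] := n2 nr.
by rewrite !mul0r !mulr0.
Qed.

Let limit_left0 mu c : `|mu - lam| <= 1 -> yL (0, mu) c 0%N 0 = 0 /\ yR (0, mu) c 0%N 0 = 0.
Proof.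
move=> h; have [n r] := limit_interface c h.
by have [/r[]|/n[]] := pselect (resonant_set Psi alpha).
Qed.

Lemma shooting_window : exists (e2 del K C : R) (yl yr : nat -> R -> R),
  [/\ 0 < e2 <= e1 /\ 0 < del, [/\ 0 <= K, K * e2 < del & 0 <= C],
    limit_eig a b U alpha beta Psi Phi lam yl yr /\
      (forall zl zr, limit_eig a b U alpha beta Psi Phi lam zl zr -> exists s : R,
        forall j x, (j < 4)%N -> zl j x = s * yl j x /\ zr j x = s * yr j x),
    forall e, 0 < e <= e2 -> exists2 mu, `|mu - lam| < del &
        has_dim `]a, b[%classic (real_eig a b (p (e, mu))) 1 &
    forall e mu, 0 < e <= e2 -> `|mu - lam| <= del ->
      has_dim `]a, b[%classic (real_eig a b (p (e, mu))) 0 \/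
      [/\ has_dim `]a, b[%classic (real_eig a b (p (e, mu))) 1, `|mu - lam| <= K * e &
        exists2 y, eigfun a b (p (e, mu)) y &
          (forall x, a <= x <= 0 -> `|y 0%N x - yl 0%N x| <= C * e) /\
          (forall x, 0 <= x <= b -> `|y 0%N x - yr 0%N x| <= C * e)]].
Proof.
have e1_gt0 : 0 < e1 by case/andP: e1I.
have Bt0 := pbox_limit lam e1_ge0.
have [u [[j uj] ku] ker] := limit_simple.
have [r0 detB] := bord_exists uj ku ker.
pose phi t := bord_sol r0 j (bmat t).
pose D t := bord_res r0 j (bmat t).
have Bl (i k : 'I_4) : lipc box (@pdist R) (fun t => bord r0 j (bmat t) i k).
  apply: (@lipc_eq _ _ _ _ (fun t => if i == r0 then (k == j)%:R else bmat t i k)) => [t _|].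
    by rewrite [RHS]mxE.
  by case: (i == r0); [exact: lipc_cst|exact: bmat_lip].
have phil k : lipc box (@pdist R) (fun t => phi t k).
  by apply: (@lipc_adj R _ _ _ dist0 4 (fun t => bord r0 j (bmat t)) Bl).
have Dl : lipc box (@pdist R) D.
  by apply: (lipc_sum dist0) => k; apply: lipcM; [exact: bmat_lip|exact: phil].
pose yl t := yL t (phi t); pose yr t := yR t (phi t).
have yl_ulip i : (i < 4)%N -> ulip box ball (fun x t => yl t i x).
  by move=> i4; apply: ulip_sum => k; apply: ulipM; [exact: ulip_cst|exact: outL_ulip].
have yr_ulip i : (i < 4)%N -> ulip box ball (fun x t => yr t i x).
  by move=> i4; apply: ulip_sum => k; apply: ulipM; [exact: ulip_cst|exact: outR_ulip].
have aB : ball a by rewrite /ball /= /L [1 + _]addrC -addrA lerDl addr_ge0.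
have bB : ball b by rewrite /ball /= /L lerDr addr_ge0.
have ab_ball x : a <= x <= b -> ball x.
  by move=> /andP[h1 h2]; exact: itv_norm_le h1 h2 aB bB.
have c0 : 0 < `|\det (bord r0 j (bmat (0, lam)))| by rewrite normr_gt0.
have [r r_gt0 Hr] := lipc_away c0 (lipc_det dist0 Bl).
have D0 : D (0, lam) = 0.
  have [_ h] := bord_kernel detB ku.
  by move/eqP: h; rewrite mulf_eq0 (negbTE uj) => /eqP.
have kphi t : D t = 0 -> kernel t (phi t).
  by move=> Dt i; rewrite /phi bord_solE -/(D t) Dt mulr0.
have phi_j t : phi t j = \det (bord r0 j (bmat t)) by exact: bord_sol_pivot.
pose yl0 := yl (0, lam); pose yr0 := yr (0, lam).
have lim0 : limit_eig a b U alpha beta Psi Phi lam yl0 yr0 by apply: limit_kernel => //; exact: kphi.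
(* The L_2 product of the bordered solution with the limit eigenfunction, which Lagrange's identity
   produces as the factor of [mu - lam]. *)
pose I t := Int a 0 (fun x => yl t 0%N x * yl0 0%N x) + Int 0 b (fun x => yr t 0%N x * yr0 0%N x).
have cl t : continuous (fun x => yl t 0%N x * yl0 0%N x).
  by move=> x; apply: cvgM; exact: (sol_cont (yL_sol _ _)).
have cr t : continuous (fun x => yr t 0%N x * yr0 0%N x).
  by move=> x; apply: cvgM; exact: (sol_cont (yR_sol _ _)).
have bnd (y : R -> R * R -> R) (X : set R) : X `<=` ball -> ulip box ball y -> ulip box X (fun x t => y x t * y x (0, lam)).
  move=> XB [C HC]; apply: ulipM; first by exists C => x /XB; exact: HC.
  by apply: (@ulip_fun _ _ _ _ _ C) => x /XB/HC[_ h _]; exact: h.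
have Il : lipc box (@pdist R) I.
  apply: lipcD.
    apply: (lipc_Int a_lt0 (fun t _ => cl t)); apply: (bnd (fun x t => yl t 0%N x)); last exact: yl_ulip.
    by move=> x /= /andP[h1 h2]; apply: ab_ball; rewrite h1 (le_trans h2)// ltW.
  apply: (lipc_Int b_gt0 (fun t _ => cr t)); apply: (bnd (fun x t => yr t 0%N x)); last exact: yr_ulip.
  by move=> x /= /andP[h1 h2]; apply: ab_ball; rewrite h2 (le_trans _ h1)// ltW.
have I0 : 0 < I (0, lam).
  have [l1 l2] := Int_sqr_ge0 a_lt0 (yL_sol (0, lam) (phi (0, lam))).
  have [r1 r2] := Int_sqr_ge0 b_gt0 (yR_sol (0, lam) (phi (0, lam))).
  rewrite /I -/(yl (0, lam)) -/(yr (0, lam)).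
  have [z1|/l2 h] := pselect (forall k x, (k < 4)%N -> yl (0, lam) k x = 0); last exact: ltr_wpDr.
  have [z2|/r2 h] := pselect (forall k x, (k < 4)%N -> yr (0, lam) k x = 0); last exact: ltr_wpDl.
  have := limit_eq0 (c := phi (0, lam)) lam1 _ j; rewrite phi_j => h.
  by move/eqP: detB; rewrite h// => i i4; split; [exact: z1|exact: z2].
(* The bordered solution violates only boundary condition [r0], by [D]. In Lagrange's form this
   datum is multiplied by the complementary derivative of the limit eigenfunction at the same end,
   which [kap] selects with its sign. *)
pose kap : R := (@Ordinal 4 0 isT == r0)%:R * yl0 3%N a - (@Ordinal 4 1 isT == r0)%:R * yl0 2%N a
  - (@Ordinal 4 2 isT == r0)%:R * yr0 3%N b + (@Ordinal 4 3 isT == r0)%:R * yr0 2%N b.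
have DE mu : `|mu - lam| <= 1 -> D (0, mu) * kap = (mu - lam) * I (0, mu).
  move=> h; have dat i := esym (bdata_sum (0, mu) (phi (0, mu)) i).
  have b0 := dat (@Ordinal 4 0 isT); have b1 := dat (@Ordinal 4 1 isT).
  have b2 := dat (@Ordinal 4 2 isT); have b3 := dat (@Ordinal 4 3 isT).
  rewrite /phi !bord_solE -/(phi _) -/(D _) /bdata /= in b0 b1 b2 b3.
  have w1 : (mu - lam) * Int a 0 (fun x => yl (0, mu) 0%N x * yl0 0%N x)
      = wron (yl (0, mu)) yl0 0 - wron (yl (0, mu)) yl0 a.
    exact: (Int_wron a_lt0 (yL_sol (0, mu) _) (yL_sol (0, lam) _)).
  have w2 : (mu - lam) * Int 0 b (fun x => yr (0, mu) 0%N x * yr0 0%N x)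
      = wron (yr (0, mu)) yr0 b - wron (yr (0, mu)) yr0 0.
    exact: (Int_wron b_gt0 (yR_sol (0, mu) _) (yR_sol (0, lam) _)).
  have -> : (mu - lam) * I (0, mu) = (wron (yl (0, mu)) yl0 0 - wron (yl (0, mu)) yl0 a)
      + (wron (yr (0, mu)) yr0 b - wron (yr (0, mu)) yr0 0) by rewrite -w1 -w2 -mulrDr.
  have := @interface_wron _ _ _ _ (yl (0, mu)) yl0 (yr (0, mu)) yr0 0 (limit_interface (phi (0, mu)) h) (limit_interface (phi (0, lam)) lam1)
    (fun _ => erefl) (fun _ => erefl) (fun _ => erefl) (fun _ => erefl).
  rewrite -/(yl (0, mu)) -/(yr (0, mu)) -/yl0 -/yr0 => ->.
  have [_ _ [z1 z2 z3 z4] _] := lim0.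
  have wa : wron (yl (0, mu)) yl0 a = yl (0, mu) 1%N a * yl0 2%N a - yl (0, mu) 0%N a * yl0 3%N a.
    by rewrite /wron z1 z2 !mulr0 subrr add0r.
  have wb : wron (yr (0, mu)) yr0 b = yr (0, mu) 1%N b * yr0 2%N b - yr (0, mu) 0%N b * yr0 3%N b.
    by rewrite /wron z3 z4 !mulr0 subrr add0r.
  by rewrite wa wb /kap /yl /yr -b0 -b1 -b2 -b3; ring.
have r20 : 0 < r / 2 by rewrite divr_gt0.
have [e2 [del [K [[e2I e2r] [/andP[del0 del1] delr] [K0 Ke] ex un]]]] := perturbed_root e1_gt0 r20 Dl Il I0 DE.
have e2e1 : e2 <= e1 by case/andP: e2I.
have Bt e mu : 0 < e <= e2 -> `|mu - lam| <= del -> box (e, mu).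
  move=> /andP[h1 h2] h3; split => /=; last exact: le_trans del1.
  by rewrite (ltW h1) (le_trans h2).
have dt0 e mu : 0 < e <= e2 -> `|mu - lam| <= del -> pdist (e, mu) (0, lam) <= e + `|mu - lam|.
  move=> /andP[h1 h2] h3; rewrite /pdist /= gt_eqF// normr0 addr0 gtr0_norm//.
have det_n0 e mu : 0 < e <= e2 -> `|mu - lam| <= del -> \det (bord r0 j (bmat (e, mu))) != 0.
  move=> eI mI; rewrite -normr_gt0.
  have h := Hr _ _ (Bt _ _ eI mI) Bt0 _ (lexx _).
  apply: (@lt_le_trans _ _ (`|\det (bord r0 j (bmat (0, lam)))| / 2)); first by rewrite divr_gt0.
  apply: h; apply: le_trans (dt0 _ _ eI mI) _.
  by move: eI => /andP[_ eI]; lra.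
have dim1 e mu : 0 < e <= e2 -> `|mu - lam| <= del -> D (e, mu) = 0 ->
    eigfun a b (p (e, mu)) (yM (e, mu) (phi (e, mu))) /\ has_dim `]a, b[%classic (real_eig a b (p (e, mu))) 1.
  move=> eI mI DZ; have B := Bt _ _ eI mI; have e0 : 0 < (e, mu).1 by case/andP: eI.
  have ef : eigfun a b (p (e, mu)) (yM (e, mu) (phi (e, mu))).
    by apply/(eigfun_kernel _ B e0); exact: kphi.
  split => //; apply: (eig_dim1 a_lt0 b_gt0 (p_coef _) ef).
    move=> h; have := yM_eq0 B e0 (fun i x => h i x) j.
    by rewrite phi_j => /eqP; rewrite (negbTE (det_n0 _ _ eI mI)).
  move=> y /(eigfun_expand B e0)[c kc cE].
  have [ce _] := bord_kernel (det_n0 _ _ eI mI) kc.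
  exists (c j / bord_sol r0 j (bmat (e, mu)) j) => x; rewrite cE// /yM mulr_sumr.
  by apply: eq_bigr => k _; rewrite {1}ce mulrA.
have dim0 e mu : 0 < e <= e2 -> `|mu - lam| <= del -> D (e, mu) != 0 ->
    has_dim `]a, b[%classic (real_eig a b (p (e, mu))) 0.
  move=> eI mI DZ; have B := Bt _ _ eI mI; have e0 : 0 < (e, mu).1 by case/andP: eI.
  apply: (eig_dim0 a_lt0 b_gt0 (p_coef _)) => y /(eigfun_expand B e0)[c kc cE] x.
  have [ce h] := bord_kernel (det_n0 _ _ eI mI) kc.
  have cj : c j = 0 by move/eqP: h; rewrite mulf_eq0 -/(D _) (negbTE DZ) orbF => /eqP.
  rewrite cE// /yM big1// => k _; by rewrite ce cj !mul0r.
have [Cl HCl] := yl_ulip 0%N isT; have [Cr HCr] := yr_ulip 0%N isT.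
have [Cl0 _ _] := HCl a aB; have [Cr0 _ _] := HCr a aB.
have [Dl' HDl] := yl_ulip 1%N isT; have [Dr' HDr] := yr_ulip 1%N isT.
have [Dl0 _ _] := HDl a aB; have [Dr0 _ _] := HDr a aB.
have [_ [Cm Cm0 HCm] _ _] := family.
have [Cp HCp] := choice phil.
pose S : R := \sum_k Cp k.
have S0 : 0 <= S by apply: sumr_ge0 => k _; have [] := HCp k.
(* On [-eps, eps] the two eigenfunctions are not compared with each other: each is O(eps), the limit
   one because it vanishes at 0 by [limit_left0]. *)
have yM_small e mu x : 0 < e <= e2 -> `|mu - lam| <= del -> `|x| <= e ->
    `|yM (e, mu) (phi (e, mu)) 0%N x| <= S * Cm * e.
  move=> eI mI xe; have B := Bt _ _ eI mI; have e0 : 0 < (e, mu).1 by case/andP: eI.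
  apply: le_trans (ler_norm_sum _ _ _) _; rewrite /S mulr_suml mulr_suml; apply: ler_sum => k _.
  rewrite normrM -mulrA; apply: ler_pM => //; last exact: HCm.
  by have [_ h _] := HCp k; exact: h.
have yl0_small x : a <= x <= 0 -> `|yl0 0%N x| <= Dl' * `|x|.
  move=> xI; have [z0 _] := limit_left0 (phi (0, lam)) lam1.
  have zI : a <= (0 : R) <= 0 by apply/andP; split; [exact: ltW|exact: lexx].
  have := @mean_value_ineq R (yl0 0%N) (yl0 1%N) Dl' a 0 _ _ x 0 xI zI.
  rewrite [yl0 0%N 0]z0 !subr0; apply.
    by move=> s _; have [h _] := yL_sol (0, lam) (phi (0, lam)); exact: (h 0%N).
  move=> s /andP[s1 s2]; have sB : ball s by apply: ab_ball; rewrite s1 (le_trans s2)// ltW.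
  by have [_ h _] := HDl s sB; exact: h.
have yr0_small x : 0 <= x <= b -> `|yr0 0%N x| <= Dr' * `|x|.
  move=> xI; have [_ z0] := limit_left0 (phi (0, lam)) lam1.
  have zI : (0 : R) <= 0 <= b by apply/andP; split; [exact: lexx|exact: ltW].
  have := @mean_value_ineq R (yr0 0%N) (yr0 1%N) Dr' 0 b _ _ x 0 xI zI.
  rewrite [yr0 0%N 0]z0 !subr0; apply.
    by move=> s _; have [h _] := yR_sol (0, lam) (phi (0, lam)); exact: (h 0%N).
  move=> s /andP[s1 s2]; have sB : ball s by apply: ab_ball; rewrite s2 (le_trans _ s1)// ltW.
  by have [_ h _] := HDr s sB; exact: h.
(* The first summand is the error off [-eps, eps], as (e, mu) is within [(1 + K) * e] of (0, lam);
   the second collects the bounds on [-eps, eps]. *)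
pose C : R := (Cl + Cr) * (1 + K) + (S * Cm + (Dl' + Dr')).
have K1 : 0 <= 1 + K by rewrite addr_ge0.
have SC : 0 <= S * Cm by rewrite mulr_ge0.
have CK : 0 <= (Cl + Cr) * (1 + K) by rewrite mulr_ge0// addr_ge0.
have clK : Cl * (1 + K) <= C.
  rewrite /C mulrDl -addrA lerDl; apply: addr_ge0; first exact: mulr_ge0.
  by rewrite !addr_ge0.
have crK : Cr * (1 + K) <= C.
  rewrite /C mulrDl -addrA addrCA lerDl; apply: addr_ge0; first exact: mulr_ge0.
  by rewrite !addr_ge0.
have dlK : S * Cm + Dl' <= C.
  by apply: (@le_trans _ _ (S * Cm + (Dl' + Dr'))); [rewrite lerD2l lerDl|rewrite /C lerDr].
have drK : S * Cm + Dr' <= C.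
  by apply: (@le_trans _ _ (S * Cm + (Dl' + Dr'))); [rewrite lerD2l lerDr|rewrite /C lerDr].
exists e2, del, K, C, yl0, yr0; split => //.
- by split => //; apply: le_trans clK; rewrite mulr_ge0.
- split => // zl zr /(limit_expand lam1)[c kc cE].
  have [ce _] := bord_kernel detB kc.
  exists (c j / bord_sol r0 j (bmat (0, lam)) j) => i x i4; have [-> ->] := cE i x i4.
  by split; rewrite /yl0 /yr0 /yl /yr /yL /yR mulr_sumr; apply: eq_bigr => k _; rewrite {1}ce mulrA.
- move=> e eI; have [mu mI DZ] := ex e eI; exists mu => //.
  by have [] := dim1 e mu eI (ltW mI) DZ.
- move=> e mu eI mI; have [DZ|DZ] := eqVneq (D (e, mu)) 0; last by left; exact: dim0.
  right; have [ef dm] := dim1 e mu eI mI DZ; have mK := un e mu eI mI DZ.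
  have e0 : 0 < e by case/andP: eI.
  have e0' : 0 <= e := ltW e0.
  have B := Bt _ _ eI mI.
  have pd : pdist (e, mu) (0, lam) <= (1 + K) * e.
    by apply: le_trans (dt0 _ _ eI mI) _; rewrite mulrDl mul1r lerD2l.
  split => //; exists (yM (e, mu) (phi (e, mu))) => //; split => x /andP[x1 x2].
  + have [xe|xe] := leP x (- e).
      rewrite yM_left//; have xB : ball x by apply: ab_ball; rewrite x1 ltW// (le_lt_trans x2).
      have [_ _ h] := HCl x xB; apply: le_trans (h _ _ B Bt0) _.
      apply: (@le_trans _ _ (Cl * ((1 + K) * e))); first by rewrite ler_wpM2l.
      by rewrite mulrA ler_wpM2r.
    have xe' : `|x| <= e by rewrite ler0_norm// lerNl ltW.
    apply: le_trans (ler_normB _ _) _.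
    apply: (@le_trans _ _ (S * Cm * e + Dl' * e)); last by rewrite -mulrDl ler_wpM2r.
    apply: lerD; first exact: yM_small.
    by apply: le_trans (yl0_small x _) _; [rewrite x1|rewrite ler_wpM2l].
  + have [xe|xe] := leP e x.
      rewrite yM_right//; have xB : ball x by apply: ab_ball; rewrite x2 ltW// (lt_le_trans a_lt0).
      have [_ _ h] := HCr x xB; apply: le_trans (h _ _ B Bt0) _.
      apply: (@le_trans _ _ (Cr * ((1 + K) * e))); first by rewrite ler_wpM2l.
      by rewrite mulrA ler_wpM2r.
    have xe' : `|x| <= e by rewrite ger0_norm// ltW.
    apply: le_trans (ler_normB _ _) _.
    apply: (@le_trans _ _ (S * Cm * e + Dr' * e)); last by rewrite -mulrDl ler_wpM2r.
    apply: lerD; first exact: yM_small.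
    by apply: le_trans (yr0_small x _) _; [rewrite x2 andbT|rewrite ler_wpM2l].
Qed.

End Shooting.

(** * Norms *)

Lemma interface_family_le (R : realType) (a b : R) (U : R -> R) (alpha beta gamma1 gamma2 : R)
  (Psi Phi Ups1 Ups2 : R -> R) (lam e1 e2 : R) Om lf rf : e2 <= e1 ->
  interface_family a b U alpha beta gamma1 gamma2 Psi Phi Ups1 Ups2 lam e1 Om lf rf ->
  interface_family a b U alpha beta gamma1 gamma2 Psi Phi Ups1 Ups2 lam e2 Om lf rf.
Proof.
move=> e21 [h1 [C C0 h2] h3 h4]; have sub := @pbox_le R lam _ _ e21; split => //.
- by move=> t /sub; exact: h1.
- by exists C => // t k x /sub; exact: h2.
- by move=> j k j4; have [] := h3 j k j4; split; exact: lipc_sub sub _.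
Qed.

Section SquareNorm.
Variables (R : realType) (a b : R).
Hypothesis ab : a < b.
Let D : set R := `]a, b[%classic.
Local Notation mu := (@lebesgue_measure R).
Implicit Types (c : R) (h g : R -> R).

Definition norm_L2 (h : R -> R) : \bar R := 'N[mu]_2%:E[EFin \o (h \_ D)]%E.

Let mD : measurable D. Proof. exact: measurable_itv. Qed.

Let restr_meas h : measurable_fun [set: R] h -> measurable_fun [set: R] (h \_ D).
Proof. by move=> mh; apply/(measurable_restrictT _ mD); exact: measurable_funS mh. Qed.

Let sqr_meas h : measurable_fun [set: R] h -> measurable_fun D (fun x => ((h x) ^+ 2)%:E).
Proof.
move=> mh; apply/measurable_EFinP; apply: measurable_funS (measurable_funX 2 mh) => //.
Qed.

Lemma norm_L2E h : norm_L2 h = ((\int[mu]_(x in D) ((h x) ^+ 2)%:E) `^ 2^-1)%E.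
Proof.
rewrite /norm_L2 unlock [in RHS]integral_mkcond; congr (_ `^ _)%E.
apply: eq_integral => x _; rewrite /= !patchE; case: ifPn => _.
  by rewrite powR_mulrn// real_normK ?num_real.
by rewrite normr0 powR0// pnatr_eq0.
Qed.

(** The point 0 is exempt because a limit eigenfunction has no prescribed value there. *)
Lemma norm_L2_le h g : measurable_fun [set: R] h -> measurable_fun [set: R] g ->
  (forall x, a < x < b -> x != 0 -> `|h x| <= g x) -> (norm_L2 h <= norm_L2 g)%E.
Proof.
move=> mh mg hg; rewrite !norm_L2E.
have i0 f : (0 <= \int[mu]_(x in D) ((f x) ^+ 2)%:E)%E.
  by apply: integral_ge0 => x _; rewrite lee_fin sqr_ge0.
apply: gt0_ler_poweR; rewrite ?in_itv/= ?i0 ?leey ?invr_ge0//.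
apply: ae_ge0_le_integral => //.
- by move=> x _; rewrite lee_fin sqr_ge0.
- exact: sqr_meas.
- by move=> x _; rewrite lee_fin sqr_ge0.
- exact: sqr_meas.
- apply: ae_mono (@ae_neq0 R) => x x0; rewrite /D /= in_itv/= => xI.
  rewrite lee_fin -[h x ^+ 2]real_normK ?num_real// lerXn2r ?nnegrE//; last exact: hg.
  by apply: le_trans (hg x xI x0).
Qed.

Lemma norm_L2D h g : measurable_fun [set: R] h -> measurable_fun [set: R] g ->
  (norm_L2 (fun x => h x + g x)%R <= norm_L2 h + norm_L2 g)%E.
Proof.
move=> mh mg; rewrite /norm_L2.
have -> : (fun x => h x + g x) \_ D = ((h \_ D) \+ (g \_ D))%R.
  by apply/funext => x; rewrite /= !patchE; case: ifP => _; rewrite ?addr0.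
by apply: minkowski_EFin; [exact: restr_meas|exact: restr_meas|rewrite ler1n].
Qed.

Lemma norm_L2Z c h : 0 <= c -> measurable_fun [set: R] h ->
  norm_L2 (fun x => c * h x) = (c%:E * norm_L2 h)%E.
Proof.
move=> c0 mh; rewrite !norm_L2E.
under eq_integral do rewrite exprMn EFinM.
rewrite ge0_integralZl//; last 3 first.
- exact: sqr_meas.
- by move=> x _; rewrite lee_fin sqr_ge0.
- by rewrite lee_fin sqr_ge0.
rewrite poweRM ?lee_fin ?sqr_ge0//; last by apply: integral_ge0 => x _; rewrite lee_fin sqr_ge0.
by rewrite poweR_EFin -powR_mulrn// -powRrM divff ?powRr1// pnatr_eq0.
Qed.

Lemma norm_L2_cst : norm_L2 (fun=> 1) = (Num.sqrt (b - a))%:E.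
Proof.
rewrite norm_L2E; under eq_integral do rewrite expr1n.
rewrite integral_cst// mul1e.
have e : mu D = (b - a)%:E by rewrite /D lebesgue_measure_itv/= lte_fin ab.
apply: (@eq_trans _ _ ((b - a)%:E `^ 2^-1)%E); first by congr (_ `^ _)%E; exact: e.
by rewrite poweR_EFin powR12_sqrt// subr_ge0 ltW.
Qed.

Lemma L2norm_ext (f : R -> R[i]) h : (forall x, a < x < b -> ComplexField.Normc.normc (f x) = h x) ->
  L2norm a b f = norm_L2 h.
Proof.
move=> fh; rewrite /L2norm /norm_L2; congr ('N[mu]_2%:E[_]%E).
apply/funext => x; rewrite /= !patchE; case: ifP => //.
by rewrite inE /D /= in_itv/= => xI; rewrite fh.
Qed.

Lemma measurable_piecewise (c : R) (f g : R -> R) : continuous f -> continuous g ->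
  measurable_fun [set: R] (fun x => if x == 0 then c else if x < 0 then f x else g x).
Proof.
move=> cf cg; apply: measurable_fun_ifT.
- exact: measurable_fun_eqr.
- exact: measurable_cst.
- apply: measurable_fun_ifT; [exact: measurable_fun_ltr|exact: continuous_measurable_fun|
    exact: continuous_measurable_fun].
Qed.

End SquareNorm.

(** * The perturbed potential as a function of eps *)

Section Perturbation.
Variables (R : realType) (a b : R) (U : R -> R)
  (alpha beta gamma1 gamma2 : R) (Psi Phi Ups1 Ups2 : R -> R).
Hypotheses (a_lt0 : a < 0) (b_gt0 : 0 < b) (U_smooth : smooth_on a b U).
Hypotheses (Psi_test : test_function Psi) (Phi_test : test_function Phi)
  (Ups1_test : test_function Ups1) (Ups2_test : test_function Ups2).

Let ab : a < b. Proof. exact: lt_trans b_gt0. Qed.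

Definition potential (e x : R) : R :=
  U (clamp a b x) + Psi_eps alpha beta gamma1 gamma2 Psi Phi Ups1 Ups2 e x.

Lemma potential_full e mu :
  (fun x => mu - potential e x) = full a b U alpha beta gamma1 gamma2 Psi Phi Ups1 Ups2 e mu.
Proof. by apply/funext => x; rewrite /potential /full /outer; ring. Qed.

Lemma potential_coef e : bounded_coef (potential e).
Proof.
rewrite (_ : potential e = fun x => 0 + (-1) * full a b U alpha beta gamma1 gamma2 Psi Phi Ups1 Ups2 e 0 x).
  apply: bounded_coefD; first exact: bounded_coef_cst.
  by apply: bounded_coefZ; exact: full_coef.
by apply/funext => x; rewrite -potential_full; ring.
Qed.

(** The constant depends on the lower bound [r] of eps, which is harmless: counting uses this only
    near a fixed positive eps. *)
Lemma scaled_test_lip (f : R -> R) (c L r : R) n : test_function f -> 0 < r -> 0 <= L ->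
  exists2 C : R, 0 <= C & forall e e' x : R, r <= e <= 1 -> r <= e' <= 1 -> `|x| <= L ->
    `|c * e ^- n * f (x / e) - c * e' ^- n * f (x / e')| <= C * `|e - e'|.
Proof.
move=> tf r0 L0.
have [B fB] := test_bounded tf; have [K K0 fK] := test_lipschitz tf.
pose A : set R := [set e | r <= e <= 1]; pose rho (e e' : R) : R := `|e - e'|.
have rho0 e e' : 0 <= rho e e' by exact: normr_ge0.
have idl : lipc A rho (fun e => e).
  exists 1; split => //; last by move=> e e' _ _; rewrite mul1r.
  by move=> e /andP[h1 h2]; rewrite ger0_norm// (le_trans (ltW r0)).
have invl : lipc A rho (fun e => e^-1).
  apply: (lipcV rho0 r0) idl => e /andP[h1 _]; exact: le_trans (ler_norm _).
have [C1 [C10 _ inv1]] := invl.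
have [C2 pw] : lipc A rho (fun e => c * e ^- n).
  apply: lipcM; first exact: lipc_cst.
  apply: (lipc_eq (h := fun e => \prod_(i < n) e^-1)) => [e _|].
    by rewrite prodr_const card_ord exprVn.
  by apply: lipc_prod.
have [C20 _ _] := pw.
have B0 : 0 <= B by exact: le_trans (fB 0).
have KLC : 0 <= K * (L * C1) by rewrite !mulr_ge0.
exists (2 * (C2 * (B + K * (L * C1)))); first by rewrite !mulr_ge0// addr_ge0.
move=> e e' x eI e'I xL.
have fl : lip A rho (B + K * (L * C1)) (fun e => f (x / e)).
  split; first exact: addr_ge0.
  - by move=> s _; rewrite (le_trans (fB _))// lerDl.
  - move=> s s' As As'; apply: le_trans (fK _ _) _.
    rewrite -mulrBr normrM; apply: (@le_trans _ _ (K * (L * C1) * rho s s')); last first.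
      by rewrite ler_wpM2r// lerDr.
    rewrite -!mulrA ler_wpM2l//; apply: ler_pM => //; exact: inv1.
by have [_ _ h] := lipM pw fl; exact: h.
Qed.

Lemma potential_lip (e0 L : R) : 0 <= L -> 0 < e0 -> e0 < 1 -> exists r C : R, [/\ 0 < r, 0 <= C,
  forall e : R, `|e - e0| < r -> 0 < e < 1 &
  forall e e' x : R, `|e - e0| < r -> `|e' - e0| < r -> `|x| <= L ->
    `|potential e x - potential e' x| <= C * `|e - e'|].
Proof.
move=> L0 e00 e01; have r0 : 0 < e0 / 2 by rewrite divr_gt0.
have [C1 C10 h1] := scaled_test_lip alpha 4 Psi_test r0 L0.
have [C2 C20 h2] := scaled_test_lip beta 3 Phi_test r0 L0.
have [C3 C30 h3] := scaled_test_lip gamma1 2 Ups1_test r0 L0.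
have [C4 C40 h4] := scaled_test_lip gamma2 1 Ups2_test r0 L0.
pose r : R := Num.min (e0 / 2) (1 - e0).
have rl : r <= e0 / 2 by rewrite ge_min lexx.
have ru : r <= 1 - e0 by rewrite ge_min lexx orbT.
have near_e0 e : `|e - e0| < r -> e0 / 2 < e < 1.
  by rewrite ltr_distl => /andP[? ?]; apply/andP; split; lra.
exists r, (C1 + C2 + C3 + C4); split.
- by rewrite lt_min r0 subr_gt0.
- by rewrite !addr_ge0.
- by move=> e /near_e0/andP[h ->]; rewrite (lt_trans r0).
- move=> e e' x /near_e0/andP[/ltW a1 /ltW a2] /near_e0/andP[/ltW b1 /ltW b2] xL.
  have eI : e0 / 2 <= e <= 1 by rewrite a1.
  have e'I : e0 / 2 <= e' <= 1 by rewrite b1.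
  have := h1 _ _ _ eI e'I xL; have := h2 _ _ _ eI e'I xL; have := h3 _ _ _ eI e'I xL; have := h4 _ _ _ eI e'I xL.
  move=> g4 g3 g2 g1.
  rewrite (_ : potential e x - potential e' x =
    (alpha * e ^- 4 * Psi (x / e) - alpha * e' ^- 4 * Psi (x / e'))
    + (beta * e ^- 3 * Phi (x / e) - beta * e' ^- 3 * Phi (x / e'))
    + (gamma1 * e ^- 2 * Ups1 (x / e) - gamma1 * e' ^- 2 * Ups1 (x / e'))
    + (gamma2 * e ^- 1 * Ups2 (x / e) - gamma2 * e' ^- 1 * Ups2 (x / e'))); last first.
    by rewrite /potential /Psi_eps; ring.
  rewrite !mulrDl.
  apply: le_trans (ler_normD _ _) _; apply: lerD g4; apply: le_trans (ler_normD _ _) _; apply: lerD g3.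
  exact: le_trans (ler_normD _ _) (lerD g1 g2).
Qed.

End Perturbation.

Lemma normc_real (R : rcfType) (z : R[i]) (r : R) :
  ComplexField.Normc.normc (z * (r%:C)%C) = ComplexField.Normc.normc z * `|r|.
Proof. by rewrite ComplexField.Normc.normcM /= expr0n /= addr0 sqrtr_sqr. Qed.

(** Let [m] be the norm of [zeta Y]. The error [d] before normalization gives |1 - m| <= d, so
    scaling by 1 / m costs another [d]; hence the factor 2. The bound [d < 1] keeps [m] positive.
    The profiles are real and [zeta] carries the complex factor of [v]. *)
Lemma normalize_near (R : realType) (a b M : R) (Y yl yr : R -> R) (zeta : R[i]) (v : R -> R[i]) :
  let z := ComplexField.Normc.normc zeta in
  a < b -> continuous Y -> continuous yl -> continuous yr ->
  (forall x, a < x < b -> x != 0 -> v x = zeta * (((if x < 0 then yl x else yr x)%:C)%C)) ->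
  L2norm a b v = 1%:E ->
  (forall x, a < x < 0 -> `|Y x - yl x| <= M) -> (forall x, 0 < x < b -> `|Y x - yr x| <= M) ->
  0 <= M -> z * M * Num.sqrt (b - a) < 1 ->
  exists s : R, L2norm a b (fun x => zeta * (s%:C)%C * ((Y x)%:C)%C) = 1%:E /\
    (L2norm a b (fun x => zeta * (s%:C)%C * ((Y x)%:C)%C - v x)%R <= (2 * (z * M * Num.sqrt (b - a)))%:E)%E.
Proof.
move=> z ab cY cl cr vE v1 Yl Yr M0 zM1.
have z0 : 0 <= z by rewrite /z; case: (zeta) => ? ?; exact: sqrtr_ge0.
have zM0 : 0 <= z * M by rewrite mulr_ge0.
set d := z * M * Num.sqrt (b - a) in zM1 *.
have d0 : 0 <= d by rewrite mulr_ge0// sqrtr_ge0.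
have cnorm (f : R -> R) : continuous f -> continuous (fun x => z * `|f x|).
  move=> cf x; apply: cvgM; first exact: cvg_cst.
  by apply: (@continuous_comp _ _ _ f (fun u => `|u|)); [exact: cf|exact: norm_continuous].
(* [v] is arbitrary at 0; inserting its own value there gives a measurable function on the line that
   equals the modulus of [v] on all of (a, b). *)
pose hv x := if x == 0 then ComplexField.Normc.normc (v 0) else if x < 0 then z * `|yl x| else z * `|yr x|.
pose hY x := z * `|Y x|.
have mv : measurable_fun [set: R] hv by apply: measurable_piecewise; exact: cnorm.
have mY : measurable_fun [set: R] hY by apply: continuous_measurable_fun; exact: cnorm.
have mc (c : R) : measurable_fun [set: R] (fun _ : R => c * 1) by exact: measurable_cst.
have hvE x : a < x < b -> ComplexField.Normc.normc (v x) = hv x.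
  move=> xI; rewrite /hv; case: eqP => [->//|/eqP x0]; rewrite vE// normc_real.
  by case: ifP.
have Nv : norm_L2 a b hv = 1%:E by rewrite -v1; apply/esym/L2norm_ext.
have NM : norm_L2 a b (fun=> z * M * 1) = d%:E.
  by rewrite norm_L2Z//; rewrite norm_L2_cst.
have close x : a < x < b -> x != 0 -> z * `|Y x - (if x < 0 then yl x else yr x)| <= z * M.
  move=> /andP[x1 x2] x0; rewrite ler_wpM2l//; case: ltP => xs; first by rewrite Yl ?x1.
  by rewrite Yr// x2 andbT lt_neqAle xs eq_sym x0.
have hvn x : x != 0 -> hv x = z * `|if x < 0 then yl x else yr x|.
  by rewrite /hv => /negbTE ->; case: ifP.
have NYle : (norm_L2 a b hY <= (1 + d)%:E)%E.
  rewrite EFinD -Nv -NM; apply: (le_trans _ (@norm_L2D R a b hv (fun=> z * M * 1) mv (mc _))).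
  apply: norm_L2_le => //; first by apply: measurable_funD => //; exact: mc.
  move=> x xI x0; rewrite ger0_norm ?mulr_ge0// hvn// mulr1.
  have := close x xI x0; have := ler_normD (Y x - (if x < 0 then yl x else yr x)) (if x < 0 then yl x else yr x).
  by rewrite subrK => /(ler_wpM2l z0); rewrite mulrDr /hY; lra.
have NYge : (1 <= norm_L2 a b hY + d%:E)%E.
  rewrite -Nv -NM; apply: (le_trans _ (@norm_L2D R a b hY (fun=> z * M * 1) mY (mc _))).
  apply: norm_L2_le => //; first by apply: measurable_funD => //; exact: mc.
  move=> x xI x0; rewrite hvn// ger0_norm ?mulr_ge0// mulr1.
  have := close x xI x0; have := ler_normD ((if x < 0 then yl x else yr x) - Y x) (Y x).
  by rewrite subrK distrC => /(ler_wpM2l z0); rewrite mulrDr /hY; lra.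
have [m mE] : exists m, norm_L2 a b hY = m%:E.
  exists (fine (norm_L2 a b hY)); rewrite fineK// ge0_fin_numE ?Lnorm_ge0//.
  exact: le_lt_trans NYle (ltry _).
rewrite mE -EFinD !lee_fin in NYle NYge.
have m0 : 0 < m by lra.
exists m^-1; split.
  rewrite (L2norm_ext (h := fun x => m^-1 * hY x)); last first.
    move=> x _; rewrite !normc_real ger0_norm ?invr_ge0 1?ltW// /hY -/z; ring.
  by rewrite norm_L2Z ?invr_ge0 1?ltW// mE -EFinM mulVf// gt_eqF.
pose f x := m^-1 * Y x.
pose g x := if x == 0 then ComplexField.Normc.normc (zeta * (m^-1%:C)%C * ((Y 0)%:C)%C - v 0)
  else if x < 0 then z * `|f x - yl x| else z * `|f x - yr x|.
have cf : continuous f by move=> x; apply: cvgM; [exact: cvg_cst|exact: cY].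
have mg : measurable_fun [set: R] g.
  by apply: measurable_piecewise; apply: cnorm => x; apply: cvgB; [exact: cf| |exact: cf|]; [exact: cl|exact: cr].
rewrite (L2norm_ext (h := g)); last first.
  move=> x xI; rewrite /g; case: eqP => [->//|/eqP x0]; rewrite vE//.
  rewrite -mulrA -mulrBr (_ : _ - _ = ((f x - (if x < 0 then yl x else yr x))%:C)%C).
    by rewrite normc_real; case: ifP.
  by rewrite /f; apply: complex_eq => /=; ring.
have Nsum : (norm_L2 a b (fun x => `|m^-1 - 1| * hY x + z * M * 1)%R <= (2 * d)%:E)%E.
  apply: le_trans (@norm_L2D R a b (fun x => `|m^-1 - 1| * hY x) (fun=> z * M * 1) _ (mc _)) _; first exact: measurable_funM.
  rewrite NM norm_L2Z// mE -EFinM -EFinD lee_fin.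
  have -> : `|m^-1 - 1| * m = `|1 - m|.
    by rewrite -{2}(gtr0_norm m0) -normrM mulrBl mul1r mulVf// gt_eqF.
  have : `|1 - m| <= d by rewrite ler_distl; apply/andP; split; lra.
  by lra.
apply: le_trans Nsum; apply: norm_L2_le => //.
  by apply: measurable_funD; [exact: measurable_funM|exact: mc].
move=> x xI x0.
have -> : g x = z * `|f x - (if x < 0 then yl x else yr x)| by rewrite /g (negbTE x0); case: ifP.
rewrite ger0_norm ?mulr_ge0// mulr1.
rewrite (_ : f x - _ = (m^-1 - 1) * Y x + (Y x - (if x < 0 then yl x else yr x))); last by rewrite /f; ring.
apply: (@le_trans _ _ (z * (`|(m^-1 - 1) * Y x| + `|Y x - (if x < 0 then yl x else yr x)|))).
  by rewrite ler_wpM2l// ler_normD.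
rewrite mulrDr lerD//; last exact: close.
by rewrite normrM mulrCA.
Qed.

Theorem theorem5p8 (R : realType) (a b : R) (U : R -> R)
  (alpha beta gamma1 gamma2 : R) (Psi Phi Ups1 Ups2 : R -> R)
  (lambda_eps : R -> nat -> R) (lambda : R) (v : R -> R[i])
  (a_lt0 : a < 0) (b_gt0 : 0 < b)
  (U_smooth : smooth_on a b U)
  (Psi_test : test_function Psi) (Phi_test : test_function Phi)
  (Ups1_test : test_function Ups1) (Ups2_test : test_function Ups2)
  (Psi_supp : supp Psi = `[-1, 1]%classic)
  (nondegenerate : nondegenerate_resonance Psi alpha)
  (lambda_epsE : forall eps, 0 < eps -> eps < 1 ->
     eigenvalue_enumeration a b
       (S_eps a b U alpha beta gamma1 gamma2 Psi Phi Ups1 Ups2 eps)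
       (lambda_eps eps))
  (lambda_simple :
     simple_eigenvalue a b (S_limit a b U alpha beta Psi Phi) lambda)
  (v_eigen : op_eigenspace (S_limit a b U alpha beta Psi Phi) lambda v)
  (v_norm : L2norm a b v = 1%:E) :
  exists (j : nat) (c1 c2 : R), \forall eps \near 0^'+,
    simple_eigenvalue a b
      (S_eps a b U alpha beta gamma1 gamma2 Psi Phi Ups1 Ups2 eps)
      (lambda_eps eps j) /\
    exists y : R -> R[i],
      [/\ op_eigenspace
            (S_eps a b U alpha beta gamma1 gamma2 Psi Phi Ups1 Ups2 eps)
            (lambda_eps eps j) y,
          L2norm a b y = 1%:E,
          `|lambda_eps eps j - lambda| <= c1 * eps &
          (L2norm a b (fun x => y x - v x)%R <= (c2 * eps)%:E)%E].
Proof.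
have [e1 [Om [lf [rf [e1I fam]]]]] := interface_family_exists a_lt0 b_gt0 U_smooth beta gamma1 gamma2
  Psi_test Phi_test Ups1_test Ups2_test nondegenerate lambda.
have [e1_gt0 e1_le1] := andP e1I.
(* Ensures that [-eps, eps] lies in [a, b]. *)
pose e1' : R := Num.min (Num.min e1 (- a)) b.
have e1'_le : e1' <= e1 by rewrite !ge_min lexx.
have e1'I : 0 < e1' <= 1.
  by rewrite !lt_min e1_gt0 oppr_gt0 a_lt0 b_gt0 (le_trans e1'_le).
have e1'a : e1' <= - a by rewrite !ge_min lexx orbT.
have e1'b : e1' <= b by rewrite ge_min lexx orbT.
have [e2 [del [K [C [yl [yr [[e2I del0] [K0 Ke C0] [lim limU] ex un]]]]]]] := shooting_window
  a_lt0 b_gt0 U_smooth Psi_test Phi_test Ups1_test Ups2_test e1'I e1'a e1'b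
  (interface_family_le e1'_le fam) lambda_simple.
have [e2_gt0 e2_le] := andP e2I.
have e2_le1 : e2 <= 1 by apply: le_trans e2_le _; case/andP: e1'I.
pose fl e mu := full a b U alpha beta gamma1 gamma2 Psi Phi Ups1 Ups2 e mu.
have ab : a < b by exact: lt_trans b_gt0.
have mult e mu n : 0 < e -> e < 1 -> has_dim `]a, b[%classic (real_eig a b (fl e mu)) n ->
    ([set k | lambda_eps e k = mu] #= `I_n)%card.
  move=> e0 e_lt1 h; have [_ /(_ mu)[n' [cn hn]]] := lambda_epsE e e0 e_lt1.
  have h' := eps_has_dim a_lt0 b_gt0 U_smooth Psi_test Phi_test Ups1_test Ups2_test h.
  by rewrite (has_dim_unique h' hn).
pose L : R := `|a| + `|b|.
have aL : `|a| <= L by rewrite lerDl.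
have bL : `|b| <= L by rewrite lerDr.
have L0 : 0 <= L by rewrite addr_ge0.
have [||n below_n] := @count_constant R a b a_lt0 b_gt0
  (potential a b U alpha beta gamma1 gamma2 Psi Phi Ups1 Ups2) L lambda_eps aL bL
  (fun e _ _ => potential_coef alpha beta gamma1 gamma2 a_lt0 b_gt0 U_smooth Psi_test Phi_test Ups1_test Ups2_test e)
  (fun e0 => potential_lip a b U alpha beta gamma1 gamma2 Psi_test Phi_test Ups1_test Ups2_test L0)
  (fun e e0 e_lt1 => (lambda_epsE e e0 e_lt1).1) _ e2 (lambda - del) e2_gt0 e2_le1.
- by move=> e mu n e0 e_lt1; rewrite potential_full; exact: mult.
(* The level [lambda - del] is at distance [del > K * e2] from [lambda], whereas an eigenvalue in
   the window is within [K * e]. *)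
- move=> e e0 e_lt k; apply/eqP => lk.
  have eI : 0 < e <= e2 by rewrite e0 ltW.
  have dl : `|lambda - del - lambda| = del by rewrite addrAC subrr sub0r normrN gtr0_norm.
  have [|d0|[_ + _]] := un e (lambda - del) eI; first by rewrite dl.
    have [S [_ sS HS]] := card_list (mult e _ _ e0 (lt_le_trans e_lt e2_le1) d0).
    by have := (HS k).1 lk; rewrite (size0nil sS).
  rewrite dl leNgt (le_lt_trans _ Ke)//; exact/ler_wpM2l/ltW.
(* Real and imaginary part of [v] are each a real multiple of the limit profile found by shooting,
   so [v] is one complex multiple [zeta] of it. *)
have [c1 [c2 [v1 v2]]] : exists c1 c2 : R, (forall x, a < x < b -> x != 0 ->
    complex.Re (v x) = c1 * (if x < 0 then yl 0%N x else yr 0%N x)) /\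
    (forall x, a < x < b -> x != 0 -> complex.Im (v x) = c2 * (if x < 0 then yl 0%N x else yr 0%N x)).
  have part f : S_limit a b U alpha beta Psi Phi f (fun x => lambda * f x) ->
      exists s : R, forall x, a < x < b -> x != 0 -> f x = s * (if x < 0 then yl 0%N x else yr 0%N x).
    move=> /(S_limit_eig a_lt0 b_gt0 U_smooth)[zl [zr [/limU[s sE] fl' fr]]].
    exists s => x /andP[x1 x2] x0; have [El Er] := sE 0%N x isT; case: ltP => xs.
      by rewrite fl' ?x1.
    by rewrite fr// x2 andbT lt_neqAle xs eq_sym x0.
  by have [/part[c1 h1] /part[c2 h2]] := v_eigen; exists c1, c2.
pose zeta : R[i] := (c1 +i* c2)%C; pose z := ComplexField.Normc.normc zeta.
have z0 : 0 <= z by exact: sqrtr_ge0.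
have vE x : a < x < b -> x != 0 -> v x = zeta * (((if x < 0 then yl 0%N x else yr 0%N x)%:C)%C).
  by move=> xI x0; apply: complex_eq; rewrite ?Re_mulr ?Im_mulr /= ?v1 ?v2.
have [syl syr _ _] := lim.
pose B : R := z * C * Num.sqrt (b - a).
have B0 : 0 <= B by rewrite !mulr_ge0 ?sqrtr_ge0.
(* Below [(B + 1)^-1] the error [B * e] is less than 1, as the normalization requires. *)
pose e3 : R := Num.min e2 (B + 1)^-1.
have e3_gt0 : 0 < e3 by rewrite lt_min e2_gt0 invr_gt0 ltr_wpDl.
(* As indices start at 0, the count [n] below [lambda - del] is the index of the first eigenvalue
   from that level on. *)
exists n, K, (2 * B); near=> e.
have e0 : 0 < e by near: e; exact: nbhs_right_gt.
have e_lt3 : e < e3 by near: e; exact: nbhs_right_lt.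
have e_lt : e < e2 by apply: lt_le_trans e_lt3 _; rewrite ge_min lexx.
have eB : B * e < 1.
  apply: (@lt_le_trans _ _ ((B + 1) * e)); first by rewrite ltr_pM2r// ltrDl.
  by rewrite -ler_pdivlMl ?ltr_wpDl// mulr1 (le_trans (ltW e_lt3))// ge_min lexx orbT.
have eI : 0 < e <= e2 by rewrite e0 ltW.
have e_lt1 : e < 1 := lt_le_trans e_lt e2_le1.
have bn := below_n e e0 e_lt.
have lo : lambda - del <= lambda_eps e n by rewrite leNgt bn ltnn.
(* The window contains some eigenvalue; its index is at least [n], so by monotonicity the eigenvalue
   with index [n] does not exceed it. *)
have hi : lambda_eps e n <= lambda + del.
  have [mu mI dm] := ex e eI.
  have [S [_ sS HS]] := card_list (mult e mu 1%N e0 e_lt1 dm).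
  have [k kS] : exists k, k \in S by case: S sS {HS} => // k S _; exists k; rewrite inE eqxx.
  have lk := (HS k).2 kS; move: mI; rewrite ltr_distl => /andP[m1 m2].
  apply: (@le_trans _ _ (lambda_eps e k)); last by rewrite lk ltW.
  apply: (lambda_epsE e e0 e_lt1).1; rewrite leqNgt -bn lk -leNgt; exact: ltW.
have lI : `|lambda_eps e n - lambda| <= del by rewrite ler_distl lo.
have [d0|[d1 lK [y ey [Yl Yr]]]] := un e (lambda_eps e n) eI lI.
  have [S [_ sS HS]] := card_list (mult e _ _ e0 e_lt1 d0).
  by have := (HS n).1 erefl; rewrite (size0nil sS).
split; first exact: (eps_has_dim a_lt0 b_gt0 U_smooth Psi_test Phi_test Ups1_test Ups2_test d1).
have sy : sol (fl e (lambda_eps e n)) y by case: ey.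
have Me : z * (C * e) * Num.sqrt (b - a) = B * e by rewrite /B; ring.
have [||||s [s1 s2]] := @normalize_near R a b (C * e) (y 0%N) (yl 0%N) (yr 0%N) zeta v ab
  (sol_cont (k := 0%N) sy isT) (sol_cont (k := 0%N) syl isT) (sol_cont (k := 0%N) syr isT) vE v_norm.
- by move=> x /andP[x1 x2]; apply: Yl; rewrite !ltW.
- by move=> x /andP[x1 x2]; apply: Yr; rewrite !ltW.
- by rewrite mulr_ge0// ltW.
- by rewrite Me.
exists (fun x => zeta * (s%:C)%C * ((y 0%N x)%:C)%C); split => //.
- rewrite (eps_eigenspaceE a_lt0 b_gt0 U_smooth)//; split.
  + exists (fun k x => complex.Re (zeta * (s%:C)%C) * y k x); first exact: eigfunZ.
    by move=> x _; rewrite -Re_mulr.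
  + exists (fun k x => complex.Im (zeta * (s%:C)%C) * y k x); first exact: eigfunZ.
    by move=> x _; rewrite -Im_mulr.
- by move: s2; rewrite Me mulrA.
Unshelve. all: by end_near. Qed.
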